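(* Let $(X,d,\mu)$ be a metric measure space which is either proper or doubling, and which satisfies assumption (HL). Let $p,q\in(1,\infty)$ and $\alpha>0$. Then the pairing $$\langle f,g\rangle := \iint_{X^+} f(y,t)\,\overline{g(y,t)}\,d\mu(y)\,\frac{dt}{t}\qquad (f\in T^{p,q,\alpha}(X),\ g\in T^{p',q',\alpha}(X))$$ realises $T^{p',q',\alpha}(X)$ as the Banach space dual of $T^{p,q,\alpha}(X)$, up to equivalence of norms. That is: for every $g\in T^{p',q',\alpha}(X)$ the integral $\langle f,g\rangle$ converges absolutely for all $f\in T^{p,q,\alpha}(X)$ and $f\mapsto\langle f,g\rangle$ is a bounded linear functional on $T^{p,q,\alpha}(X)$; every bounded linear functional on $T^{p,q,\alpha}(X)$ is of this form for a unique $g\in T^{p',q',\alpha}(X)$; and the norm of the functional is equivalent to $\|g\|_{T^{p',q',\alpha}(X)}$, with constants independent of $g$.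
   Context: A metric measure space $(X,d,\mu)$ is a metric space $(X,d)$ with a Borel measure $\mu$. Write $B(x,r)=\{y\in X: d(x,y)<r\}$ and $V(x,r)=\mu(B(x,r))$; it is assumed throughout that $0<V(x,r)<\infty$ for all $x\in X$, $r>0$. Assumptions: $X$ is *proper* if a subset of $X$ is compact if and only if it is closed and bounded, and $V(x,r)$ is lower semicontinuous as a function of $(x,r)$. $X$ is *doubling* if there is $C>0$ with $V(x,2r)\le C\,V(x,r)$ for all $x\in X$, $r>0$. $X$ satisfies *(HL)* if the uncentred Hardy--Littlewood maximal operator $\mathcal{M}(f)(x):=\sup_{B\ni x}\frac{1}{\mu(B)}\int_B|f|\,d\mu$ (supremum over all balls $B$ containing $x$) is of strong type $(r,r)$ for all $r>1$. Let $X^+:=X\times(0,\infty)$ with the product topology and the measure $d\mu(y)\,dt/t$. For $x\in X$, $\alpha>0$ the cone is $\Gamma^\alpha(x):=\{(y,t)\in X^+: d(x,y)<\alpha t\}$. For $q\in(0,\infty)$ and measurable $f:X^+\to\mathbb{C}$, $$\mathcal{A}_q^\alpha(f)(x):=\left(\iint_{\Gamma^\alpha(x)}|f(y,t)|^q\,\frac{d\mu(y)}{V(y,\alpha t)}\,\frac{dt}{t}\right)^{1/q}.$$ For $p,q\in(0,\infty)$, $T^{p,q,\alpha}(X)$ is the space of measurable $f:X^+\to\mathbb{C}$ (modulo a.e. equality) with $\|f\|_{T^{p,q,\alpha}(X)}:=\|\mathcal{A}_q^\alpha(f)\|_{L^p(X)}<\infty$. For $r\in(1,\infty)$, $r':=r/(r-1)$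 is the Hölder conjugate. *)

(* Defs.v *)
From HB Require Import structures.
From mathcomp Require Import all_boot all_order all_algebra.
From mathcomp Require Import all_classical all_reals all_analysis.
From mathcomp Require Import measurable_realfun.
From mathcomp Require Import complex.

Set Implicit Arguments.
Unset Strict Implicit.
Unset Printing Implicit Defensive.

Import Order.TTheory GRing.Theory Num.Theory.
Import numFieldNormedType.Exports.

Local Open Scope classical_set_scope.
Local Open Scope ring_scope.

HB.mixin Record MetricMeasurable_isBorel (R : numDomainType)
    (d : measure_display) T & Metric R T & Measurable d T := {
  measurable_borelE : @measurable d T = <<s @open T >>
}.

(* A metric space carrying its Borel sigma-algebra. [Measurable] includes
   [Pointed], so such a space is nonempty. *)
#[short(type="borelMetricType")]
HB.structure Definition BorelMetric (R : numDomainType) (d : measure_display) :=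
  {T of Metric R T & Measurable d T & MetricMeasurable_isBorel R d T}.

Section MeasureDtOverT.
Context (R : realType).
Local Open Scope ereal_scope.

(* The measure dt/t on the half-line, viewed as a measure on [R] which does not
   charge the nonpositive reals. *)
Definition dt_over_t (A : set R) : \bar R :=
  \int[@lebesgue_measure R]_(t in A `&` `]0%R, +oo[) (t^-1)%:E.

Let posA (A : set R) (t : R) : (A `&` `]0%R, +oo[) t -> 0 <= (t^-1)%:E.
Proof.
by move=> [_ /=]; rewrite in_itv/= andbT lee_fin invr_ge0 => /ltW.
Qed.

Let measurable_inv_pos (A : set R) :
  measurable_fun (A `&` `]0%R, +oo[) (fun t : R => (t^-1)%:E).
Proof.
apply/measurable_EFinP; apply: (@measurable_funS _ _ _ _ (`]0%R, +oo[ : set R)) => //.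
apply: open_continuous_measurable_fun; first exact: interval_open.
move=> x; rewrite inE/= in_itv/= andbT => x0.
by apply: inv_continuous; rewrite gt_eqF.
Qed.

Let dt_over_t0 : dt_over_t set0 = 0.
Proof. by rewrite /dt_over_t set0I integral_set0. Qed.

Let dt_over_t_ge0 (A : set R) : 0 <= dt_over_t A.
Proof. by apply: integral_ge0 => t; exact: posA. Qed.

Let dt_over_t_sigma_additive : semi_sigma_additive dt_over_t.
Proof.
move=> F mF tF mUF; rewrite /dt_over_t setI_bigcupl ge0_integral_bigcup//=.
- apply: is_cvg_ereal_nneg_natsum_cond => n _ _.
  by apply: integral_ge0 => t; exact: posA.
- by move=> k; apply: measurableI => //; exact: mF.
- by rewrite -setI_bigcupl; exact: measurable_inv_pos.
- by move=> t; rewrite -setI_bigcupl; exact: posA.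
- exact: trivIset_setIr.
Qed.

HB.instance Definition _ := isMeasure.Build _ _ _
  dt_over_t dt_over_t0 dt_over_t_ge0 dt_over_t_sigma_additive.

Let dt_over_t_sigma_finite : sigma_finite setT dt_over_t.
Proof.
pose F (n : nat) : set R := `]-oo, 0%R] `|` `[(n.+1%:R^-1)%R, n.+1%:R%R].
exists F.
  apply/esym/seteqP; split => // t _.
  have [t0|t0] := leP t 0%R.
    by exists 0%N => //; left; rewrite /= in_itv.
  exists (maxn (Num.truncn t) (Num.truncn t^-1)) => //; right => /=.
  rewrite in_itv/=; apply/andP; split.
    rewrite invf_ple ?posrE// ltW// (lt_le_trans (truncnS_gt _))//.
    by rewrite ler_nat ltnS leq_maxr.
  rewrite ltW// (lt_le_trans (truncnS_gt _))//.
  by rewrite ler_nat ltnS leq_maxl.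
move=> n; split; first by apply: measurableU; exact: measurable_itv.
rewrite /dt_over_t; set B := F n `&` _.
have Bsub : B `<=` `[(n.+1%:R^-1)%R, n.+1%:R%R].
  move=> t [[|//]] /=; rewrite !in_itv/= andbT => t0 t1.
  by move: (lt_le_trans t1 t0); rewrite ltxx.
have mB : measurable B.
  by apply: measurableI => //; apply: measurableU; exact: measurable_itv.
apply: (@le_lt_trans _ _ (\int[@lebesgue_measure R]_(t in B) (n.+1%:R)%:E)).
  apply: ge0_le_integral => //.
  - by move=> t; exact: posA.
  - exact: measurable_inv_pos.
  - move=> t /Bsub; rewrite /= in_itv/= lee_fin => /andP[t1 _].
    by rewrite invf_ple ?posrE// (lt_le_trans _ t1).
rewrite integral_cst// lte_mul_pinfty//.
apply: (@le_lt_trans _ _ (lebesgue_measure `[(n.+1%:R^-1)%R, (n.+1%:R : R)])).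
  by apply: le_measure => //; rewrite inE.
by rewrite lebesgue_measure_itv/=; case: ifP => // _; rewrite -EFinB ltry.
Qed.

HB.instance Definition _ :=
  Measure_isSigmaFinite.Build _ _ _ dt_over_t dt_over_t_sigma_finite.

End MeasureDtOverT.

Section MetricMeasureSpaces.
Context (R : realType) (d : measure_display) (X : borelMetricType R d).
Variable mu : {measure set X -> \bar R}.
Local Open Scope ereal_scope.

Local Notation cabs := (@Normc.normc R).

Definition vol (x : X) (r : R) : \bar R := mu (ball x r).

Definition bounded_subset (A : set X) : Prop :=
  exists (x : X) (r : R), A `<=` ball x r.

(* [ball x r] is empty for [r <= 0], so semicontinuity on X x R amounts to
   semicontinuity on X x (0, oo). *)
Definition proper_space : Prop :=
  (forall A : set X, compact A <-> closed A /\ bounded_subset A) /\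
  lower_semicontinuous (fun z : X * R => vol z.1 z.2).

Definition doubling_space : Prop :=
  exists2 C : R, (0 < C)%R &
    forall (x : X) (r : R), (0 < r)%R -> vol x (2 * r) <= C%:E * vol x r.

Definition cmeasurable_fun (d' : measure_display) (T : measurableType d')
    (D : set T) (f : T -> R[i]) : Prop :=
  measurable_fun D (fun z => complex.Re (f z)) /\
  measurable_fun D (fun z => complex.Im (f z)).

Definition HL_maximal_fun (f : X -> R[i]) (x : X) : \bar R :=
  ereal_sup [set a | exists (c : X) (r : R), [/\ (0 < r)%R, ball c r x &
    a = (vol c r)^-1 * \int[mu]_(y in ball c r) (cabs (f y))%:E]].

Definition HL_assumption : Prop :=
  forall r : R, (1 < r)%R -> exists C : R, forall f : X -> R[i],
    cmeasurable_fun setT f ->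
    'N[mu]_r%:E[EFin \o (cabs \o f)] < +oo ->
    'N[mu]_r%:E[HL_maximal_fun f] <=
      C%:E * 'N[mu]_r%:E[EFin \o (cabs \o f)].

(* Functions on X^+ are total functions on X x R, looked at on [Xplus] only.
   When balls have finite positive measure X is separable, so the product
   sigma-algebra of X x R used below is its Borel sigma-algebra. *)
Definition Xplus : set (X * R) := [set z | (0 < z.2)%R].

Definition muplus : {measure set (X * R) -> \bar R} := mu \x @dt_over_t R.

Definition cone (alpha : R) (x : X) : set (X * R) :=
  Xplus `&` [set z | (mdist x z.1 < alpha * z.2)%R].

Definition tent_A (q alpha : R) (f : X * R -> R[i]) (x : X) : \bar R :=
  (\int[muplus]_(z in cone alpha x)
     (((cabs (f z)) `^ q)%:E / vol z.1 (alpha * z.2)%R)) `^ q^-1.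

Definition tent_norm (p q alpha : R) (f : X * R -> R[i]) : \bar R :=
  'N[mu]_p%:E[tent_A q alpha f].

(* Representatives of the elements of T^{p,q,alpha}; two of them define the same
   element iff they are equal [muplus]-almost everywhere on [Xplus]. *)
Definition tent_space (p q alpha : R) : set (X * R -> R[i]) :=
  [set f | cmeasurable_fun Xplus f /\ tent_norm p q alpha f < +oo].

Definition bounded_linear_functional (p q alpha : R)
    (L : (X * R -> R[i]) -> R[i]) : Prop :=
  let T := tent_space p q alpha in
  [/\ forall f g, T f -> T g -> f = g %[ae muplus in Xplus] -> L f = L g,
      forall f g, T f -> T g -> L (fun z => f z + g z)%R = (L f + L g)%R,
      forall (a : R[i]) f, T f -> L (fun z => a * f z)%R = (a * L f)%R &
      exists M : R, forall f, T f ->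
        (cabs (L f))%:E <= M%:E * tent_norm p q alpha f].

Definition functional_norm (p q alpha : R) (L : (X * R -> R[i]) -> R[i]) :
    \bar R :=
  ereal_sup [set (cabs (L f))%:E |
    f in [set f | tent_space p q alpha f /\ tent_norm p q alpha f <= 1]].

Definition pairing_integrand (f g : X * R -> R[i]) (z : X * R) : R[i] :=
  (f z * (g z)^*%C)%R.

Definition pairing_converges (f g : X * R -> R[i]) : Prop :=
  cmeasurable_fun Xplus (pairing_integrand f g) /\
  \int[muplus]_(z in Xplus) (cabs (pairing_integrand f g z))%:E < +oo.

Definition pairing (f g : X * R -> R[i]) : R[i] :=
  ((\int[muplus]_(z in Xplus) complex.Re (pairing_integrand f g z))%R +i*
   (\int[muplus]_(z in Xplus) complex.Im (pairing_integrand f g z))%R)%C.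

End MetricMeasureSpaces.

Definition conjugate_exponent (R : realType) (r : R) : R := r / (r - 1).

(* Main.v *)
(* The tent norm of f is (\int A_q(f)^p dmu)^(1/p), where A_q(f)(x)^q is the integral of |f|^q
   against the kernel k(x, (y, t)) = 1_{d(x, y) < alpha t} / V(y, alpha t), and k(., (y, t)) is
   a probability density. Hence \iint |f g| = \int \iint k |f g| dmu, and Hoelder's inequality,
   applied in (y, t) and then in x, bounds the pairing.

   The reverse norm estimate comes from the explicit test function
     phi = |g|^(q' - 1) * avg u,   u = A_q'(g)^(p' - q'),
   where avg u (y, t) is the mean of u over B(y, alpha t). By Fubini, the pairing of phi with |g|
   is \int A_q'(g)^p' dmu, so it suffices that the energy \int A_q(phi)^p dmu is at most
   C \int A_q'(g)^p' dmu. For p = q this is trivial, for p < q one bounds avg u on the cone of x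
   by the maximal function of u at x, and for p > q one uses Jensen's inequality and the maximal
   function of A_q(phi)^(p - q).

   A bounded functional is represented by Radon-Nikodym on each set of an exhaustion (K_n) of X^+
   on which bounded functions belong to every tent space; the density lies in the dual tent space
   by the reverse estimate, and the representation extends by dominated convergence. *)

From HB Require Import structures.
Require Import Defs.
From mathcomp Require Import all_boot all_order all_algebra.
From mathcomp Require Import all_classical all_reals all_analysis.
From mathcomp Require Import measurable_realfun.
From mathcomp Require Import complex ring lra.

Set Implicit Arguments.
Unset Strict Implicit.
Unset Printing Implicit Defensive.

Import Order.TTheory GRing.Theory Num.Theory.
Import numFieldNormedType.Exports.

(** The test function is the duality map of L^p'(L^q') made independent of x. If a function of both
    x and z = (y, t) were allowed, equality in the two Hoelder inequalities would ask for |g(z)|^(q'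
    - 1) * A_q'(g)(x)^(p' - q'). A function on X^+ cannot see x, so the second factor is averaged
    over all x whose cone contains z. The maximal function is the price of that averaging. Two steps
    divide by a power of a quantity that must be known to be finite: the absorption in the case p >
    q, and the passage from I <= M * (C * I)^(1/p) to a bound on I. The reverse estimate is
    therefore proved first for bounded g supported in some K_n, with constants that do not depend on
    these data, and then extended by monotone convergence. A density given by Radon-Nikodym is a
    priori only integrable on each K_n, so it may be tested only against functions under which the
    product stays bounded. The estimates are stated for an abstract kernel and [0, +oo]-valued
    functions; geometry enters through the properties of one kernel, and complex values come back
    only in the final sections. *)

Local Open Scope classical_set_scope.
Local Open Scope ring_scope.

(** * Hoelder's inequality for [0, +oo]-valued functions *)

Section ereal_hoelder.
Local Open Scope ereal_scope.
Context d (T : measurableType d) (R : realType).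
Variable mu : {measure set T -> \bar R}.

Lemma measurable_fun_poweR (f : T -> \bar R) (r : R) D :
  measurable_fun D f -> measurable_fun D (fun x => f x `^ r).
Proof. exact: (measurableT_comp (measurable_poweR _)). Qed.

Lemma ge0_integral_eq0_ae (f : T -> \bar R) :
  measurable_fun setT f -> (forall x, 0 <= f x) ->
  \int[mu]_x f x = 0 -> {ae mu, forall x, f x = 0}.
Proof.
move=> mf f0 If; have /(ae_eq_integral_abs mu measurableT mf) : \int[mu]_x `|f x| = 0.
  by rewrite -If; apply: eq_integral => x _; rewrite gee0_abs.
by apply: filterS => x /= /(_ I).
Qed.

Lemma ge0_integral_lty_ae (f : T -> \bar R) :
  measurable_fun setT f -> (forall x, 0 <= f x) ->
  \int[mu]_x f x < +oo -> {ae mu, forall x, f x < +oo}.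
Proof.
move=> mf f0 If.
have /(integrable_ae measurableT) : mu.-integrable setT f.
  by apply/integrableP; split => //; under eq_integral do rewrite gee0_abs//.
by apply: filterS => x /(_ I); rewrite ge0_fin_numE.
Qed.

(** If both integrals on the right are finite, [f] and [g] are finite almost everywhere and
    [hoelder] applies to their real parts [fine \o f] and [fine \o g]. The infinite cases are
    settled by hand. *)
Lemma ge0_hoelder (f g : T -> \bar R) (p q : R) :
  measurable_fun setT f -> measurable_fun setT g ->
  (forall x, 0 <= f x) -> (forall x, 0 <= g x) ->
  (0 < p)%R -> (0 < q)%R -> (p^-1 + q^-1 = 1)%R ->
  \int[mu]_x (f x * g x) <=
  (\int[mu]_x (f x `^ p)) `^ p^-1 * (\int[mu]_x (g x `^ q)) `^ q^-1.
Proof.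
move=> mf mg f0 g0 p0 q0 pq.
(* The statement is symmetric in [f] and [g], and if both integrals are infinite the right-hand side
   is +oo. *)
wlog suff : f g p q mf mg f0 g0 p0 q0 pq / \int[mu]_x (f x `^ p) < +oo ->
    \int[mu]_x (f x * g x) <=
    (\int[mu]_x (f x `^ p)) `^ p^-1 * (\int[mu]_x (g x `^ q)) `^ q^-1.
  move=> H; case: (ltP (\int[mu]_x (f x `^ p)) +oo) => [/H|]; first exact.
  rewrite leye_eq => /eqP foo.
  case: (ltP (\int[mu]_x (g x `^ q)) +oo) => [|].
    rewrite muleC; under [X in X <= _]eq_integral do rewrite muleC.
    by apply: H => //; rewrite addrC.
  rewrite leye_eq => /eqP goo.
  by rewrite foo goo !poweRyr ?gt_eqF ?invr_gt0// mulyy leey.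
move=> foo.
have int0 (h : T -> \bar R) r : 0 <= \int[mu]_x (h x `^ r).
  by apply: integral_ge0 => x _; exact: poweR_ge0.
case: (ltP (\int[mu]_x (g x `^ q)) +oo) => [goo|]; last first.
  rewrite leye_eq => /eqP goo; rewrite goo poweRyr ?gt_eqF ?invr_gt0//.
  (* The product 0 * +oo is 0 here, so when the first integral vanishes the left-hand side must be
     shown to vanish as well. *)
  have [F0|F0] := eqVneq (\int[mu]_x (f x `^ p)) 0; last first.
    by rewrite gt0_muley ?leey// poweR_gt0// lt0e F0 int0.
  rewrite F0 poweR0r ?gt_eqF ?invr_gt0// mul0e.
  rewrite (ae_eq_integral (cst 0)) ?integral0//; first exact: emeasurable_funM.
  have := ge0_integral_eq0_ae (measurable_fun_poweR p mf) (fun x => poweR_ge0 _ _) F0.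
  by apply: filterS => x /poweR_eq0_eq0 -/(_ (f0 x)) /= -> _; rewrite mul0e.
have fin (h : T -> \bar R) r : measurable_fun setT h -> (forall x, 0 <= h x) -> (0 < r)%R ->
    \int[mu]_x (h x `^ r) < +oo -> {ae mu, forall x, h x = (fine (h x))%:E}.
  move=> mh h0 r0 /(ge0_integral_lty_ae (measurable_fun_poweR r mh) (fun x => poweR_ge0 _ _)).
  apply: filterS => x /lty_poweRy; rewrite gt_eqF// => /(_ isT) hx.
  by rewrite fineK// ge0_fin_numE.
have mfine (h : T -> \bar R) : measurable_fun setT h -> measurable_fun setT (fine \o h).
  by move=> mh; exact: measurableT_comp.
have finp (h : T -> \bar R) r : measurable_fun setT h -> (forall x, 0 <= h x) -> (0 < r)%R ->
    {ae mu, forall x, h x = (fine (h x))%:E} ->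
    'N[mu]_r%:E[EFin \o (fine \o h)] = (\int[mu]_x (h x `^ r)) `^ r^-1.
  move=> mh h0 r0 aeh; rewrite unlock; congr (_ `^ _).
  apply: ge0_ae_eq_integral => //.
  - apply: measurable_fun_poweR; apply/measurableT_comp => //.
    by apply/measurable_EFinP; exact: mfine.
  - exact: measurable_fun_poweR.
  - by move=> x _; exact: poweR_ge0.
  - by move=> x _; exact: poweR_ge0.
  by apply: filterS aeh => x hx _; rewrite /= [in RHS]hx ger0_norm// fine_ge0.
have aef := fin _ _ mf f0 p0 foo; have aeg := fin _ _ mg g0 q0 goo.
have := hoelder mu (mfine _ mf) (mfine _ mg) p0 q0 pq.
rewrite (finp f p)// (finp g q)// => H; apply: le_trans H.
rewrite Lnorm1 le_eqVlt; apply/orP; left; apply/eqP.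
apply: ge0_ae_eq_integral => //.
- exact: emeasurable_funM.
- apply: measurableT_comp => //; apply/measurable_EFinP.
  by apply: measurable_funM; exact: mfine.
- by move=> x _; exact: mule_ge0.
- by apply: filterS2 aef aeg => x hf hg _; rewrite [in LHS]hf [in LHS]hg /= ger0_norm// mulr_ge0// fine_ge0.
Qed.

End ereal_hoelder.

(** * Powers of extended reals and Hoelder's inequality with a weight *)

Section weighted_hoelder.
Local Open Scope ereal_scope.
Context d (T : measurableType d) (R : realType).
Variable mu : {measure set T -> \bar R}.

Lemma ge0_le_poweR (x y : \bar R) (r : R) :
  (0 <= r)%R -> 0 <= x -> x <= y -> x `^ r <= y `^ r.
Proof.
move=> r0 x0 xy; apply: gt0_ler_poweR => //; rewrite in_itv/= leey andbT//.
exact: le_trans xy.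
Qed.

Lemma poweRK (x : \bar R) (r : R) : r != 0%R -> 0 <= x -> (x `^ r) `^ r^-1 = x.
Proof. by move=> r0 x0; rewrite -poweRrM mulfV// poweRe1. Qed.

Lemma poweRVK (x : \bar R) (r : R) : r != 0%R -> 0 <= x -> (x `^ r^-1) `^ r = x.
Proof. by move=> r0 x0; rewrite -poweRrM mulVf// poweRe1. Qed.

(** Write w = w^(1/p) * w^(1/q) and give one factor to [f] and the other to [g]. *)
Lemma ge0_hoelder_weighted (w f g : T -> \bar R) (p q : R) :
  measurable_fun setT w -> measurable_fun setT f -> measurable_fun setT g ->
  (forall x, 0 <= w x) -> (forall x, 0 <= f x) -> (forall x, 0 <= g x) ->
  (0 < p)%R -> (0 < q)%R -> (p^-1 + q^-1 = 1)%R ->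
  \int[mu]_x (w x * (f x * g x)) <=
  (\int[mu]_x (w x * f x `^ p)) `^ p^-1 * (\int[mu]_x (w x * g x `^ q)) `^ q^-1.
Proof.
move=> mw mf mg w0 f0 g0 p0 q0 pq.
have E x : w x * (f x * g x) = (w x `^ p^-1 * f x) * (w x `^ q^-1 * g x).
  rewrite muleACA; congr (_ * _).
  rewrite -poweRD ?pq ?poweRe1// add_neq0_poweRD_def// pq//.
under eq_integral do rewrite E.
have mp (r : R) h : measurable_fun setT h -> measurable_fun setT (fun x => w x `^ r * h x).
  by move=> mh; apply: emeasurable_funM => //; exact: measurable_fun_poweR.
have pp (r : R) h x : 0 <= h x -> 0 <= w x `^ r * h x.
  by move=> h0; rewrite mule_ge0// poweR_ge0.
apply: (le_trans (ge0_hoelder _ (mp _ _ mf) (mp _ _ mg) _ _ p0 q0 pq)) => //=; do ?by move=> x; exact: pp.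
have S r h : (forall x, 0 <= h x) -> (0 < r)%R ->
    \int[mu]_x ((w x `^ r^-1 * h x) `^ r) = \int[mu]_x (w x * h x `^ r).
  move=> h0 r0; apply: eq_integral => x _.
  by rewrite poweRM ?poweR_ge0// poweRVK// gt_eqF.
by rewrite !S.
Qed.

End weighted_hoelder.

(** * Cone integrals and averages against a kernel *)

Section kernel_averages.
Local Open Scope ereal_scope.
Context d1 d2 (X : measurableType d1) (Z : measurableType d2) (R : realType).
Variables (mu : {sigma_finite_measure set X -> \bar R})
          (nu : {sigma_finite_measure set Z -> \bar R}).
Variables (D : set Z) (k : X * Z -> \bar R).
Hypothesis mk : measurable_fun setT k.
Hypothesis k0 : forall w, 0 <= k w.
Hypothesis kD : forall x z, ~ D z -> k (x, z) = 0.
Hypothesis k1 : forall z, D z -> \int[mu]_x k (x, z) = 1.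

(* With [k (x, (y, t)) = 1_{d(x, y) < alpha t} / V(y, alpha t)], [kernel_sqfun q f x] is
   [A_q(f)(x) ^ q] and [kernel_energy p q f] is the [p]-th power of the tent norm of [f]. *)
Definition kernel_sqfun (q : R) (f : Z -> \bar R) (x : X) : \bar R :=
  \int[nu]_z (k (x, z) * f z `^ q).

Definition kernel_energy (p q : R) (f : Z -> \bar R) : \bar R :=
  \int[mu]_x (kernel_sqfun q f x `^ (p / q)).

Definition kernel_avg (u : X -> \bar R) (z : Z) : \bar R := \int[mu]_x (k (x, z) * u x).

(* For the kernel [kern] below, whose averages are averages over balls, this is
   what the Hardy-Littlewood hypothesis gives, [v] being the maximal function of [u]. *)
Definition averages_dominated := forall r : R, (1 < r)%R -> exists2 C : R, (0 <= C)%R &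
  forall u : X -> \bar R, measurable_fun setT u -> (forall x, 0 <= u x < +oo) ->
    \int[mu]_x (u x `^ r) < +oo ->
    exists v : X -> \bar R, [/\ measurable_fun setT v, forall x, 0 <= v x,
      forall x z, k (x, z) != 0 -> kernel_avg u z <= v x &
      \int[mu]_x (v x `^ r) <= C%:E * \int[mu]_x (u x `^ r)].

Lemma measurable_kernel_l x : measurable_fun setT (fun z => k (x, z)).
Proof. exact: measurableT_comp. Qed.

Lemma measurable_kernel_r z : measurable_fun setT (fun x => k (x, z)).
Proof. exact: measurableT_comp. Qed.

Lemma measurable_kernelM (u : X -> \bar R) (f : Z -> \bar R) :
  measurable_fun setT u -> measurable_fun setT f ->
  measurable_fun setT (fun w => k w * (u w.1 * f w.2)).
Proof.
move=> mu' mf; apply: emeasurable_funM => //; apply: emeasurable_funM.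
  exact: measurableT_comp.
exact: measurableT_comp.
Qed.

Lemma measurable_kint (f : Z -> \bar R) : measurable_fun setT f -> (forall z, 0 <= f z) ->
  measurable_fun setT (fun x => \int[nu]_z (k (x, z) * f z)).
Proof.
move=> mf f0.
have := @measurable_fun_fubini_tonelli_F _ _ _ _ _ nu (fun w => k w * (cst 1 w.1 * f w.2)).
rewrite /fubini_F.
have -> : (fun x => \int[nu]_y (k (x, y) * (cst 1 (x, y).1 * f (x, y).2))) =
          (fun x => \int[nu]_z (k (x, z) * f z)).
  by apply/funext => x; apply: eq_integral => z _; rewrite mul1e.
apply; first exact: measurable_kernelM.
by move=> w; rewrite mul1e mule_ge0.
Qed.

Lemma measurable_avg (u : X -> \bar R) : measurable_fun setT u -> (forall x, 0 <= u x) ->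
  measurable_fun setT (kernel_avg u).
Proof.
move=> mu' u0.
have := @measurable_fun_fubini_tonelli_G _ _ _ _ _ mu (fun w => k w * (u w.1 * cst 1 w.2)).
rewrite /fubini_G.
have -> : (fun y => \int[mu]_x (k (x, y) * (u (x, y).1 * cst 1 (x, y).2))) = kernel_avg u.
  by apply/funext => x; apply: eq_integral => z _; rewrite mule1.
apply; first exact: measurable_kernelM.
by move=> w; rewrite mule1 mule_ge0.
Qed.

Lemma kint_ge0 (f : Z -> \bar R) x : (forall z, 0 <= f z) ->
  0 <= \int[nu]_z (k (x, z) * f z).
Proof. by move=> f0; apply: integral_ge0 => z _; rewrite mule_ge0. Qed.

Lemma sqfun_ge0 q f x : 0 <= kernel_sqfun q f x.
Proof. by apply: kint_ge0 => z; exact: poweR_ge0. Qed.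

Lemma avg_ge0 u z : (forall x, 0 <= u x) -> 0 <= kernel_avg u z.
Proof. by move=> u0; apply: integral_ge0 => x _; rewrite mule_ge0. Qed.

Lemma energy_ge0 p q f : 0 <= kernel_energy p q f.
Proof. by apply: integral_ge0 => x _; exact: poweR_ge0. Qed.

Lemma measurable_sqfun q f : measurable_fun setT f -> measurable_fun setT (kernel_sqfun q f).
Proof.
move=> mf; apply: measurable_kint; first exact: measurable_fun_poweR.
by move=> z; exact: poweR_ge0.
Qed.

(** Tonelli's theorem, read as: averaging is the adjoint of integration over cones. *)
Lemma kernel_fubini (u : X -> \bar R) (f : Z -> \bar R) :
  measurable_fun setT u -> measurable_fun setT f ->
  (forall x, 0 <= u x) -> (forall z, 0 <= f z) ->
  \int[mu]_x (u x * \int[nu]_z (k (x, z) * f z)) = \int[nu]_z (f z * kernel_avg u z).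
Proof.
move=> mu' mf u0 f0.
transitivity (\int[mu]_x \int[nu]_z (k (x, z) * (u x * f z))).
  apply: eq_integral => x _; rewrite -ge0_integralZl//.
  - by apply: eq_integral => z _; rewrite muleCA.
  - by apply: emeasurable_funM => //; exact: measurable_kernel_l.
  - by move=> z _; rewrite mule_ge0.
rewrite (@fubini_tonelli _ _ _ _ _ mu nu (fun w => k w * (u w.1 * f w.2))).
- apply: eq_integral => z _; rewrite /kernel_avg -ge0_integralZl//.
  + by apply: eq_integral => x _ /=; rewrite [RHS]muleCA [in RHS](muleC (f z)).
  + by apply: emeasurable_funM => //; exact: measurable_kernel_r.
  + by move=> x _; rewrite mule_ge0.
- exact: measurable_kernelM.
- by move=> w; rewrite !mule_ge0.
Qed.

Lemma avg_bound (u : X -> \bar R) (c : \bar R) z : measurable_fun setT u -> (forall x, 0 <= u x) ->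
  (forall x, u x <= c) -> D z -> kernel_avg u z <= c.
Proof.
move=> mu' u0 uc Dz; rewrite -[leRHS]mule1 -(k1 Dz) -ge0_integralZl//.
- apply: ge0_le_integral => //.
  + by move=> x _; rewrite mule_ge0.
  + by apply: emeasurable_funM => //; exact: measurable_kernel_r.
  + by apply: emeasurable_funM => //; exact: measurable_kernel_r.
  + by move=> x _; rewrite muleC lee_pmul.
- exact: measurable_kernel_r.
- exact: le_trans (uc point).
Qed.

Lemma avg_cst1 z : D z -> kernel_avg (cst 1) z = 1.
Proof. by move=> Dz; rewrite -[RHS](k1 Dz); apply: eq_integral => x _; rewrite /= mule1. Qed.

(** Hoelder's inequality with weight k(., z) for [u] against the constant 1; the factor coming from
    1 is the integral of the kernel, which is 1 on [D]. *)
Lemma avg_jensen (u : X -> \bar R) (q : R) z : (1 < q)%R ->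
  measurable_fun setT u -> (forall x, 0 <= u x) ->
  D z -> kernel_avg u z `^ q <= kernel_avg (fun x => u x `^ q) z.
Proof.
move=> q1 mu' u0 Dz; have q0 : (0 < q)%R by exact: lt_trans q1.
have : kernel_avg u z <= kernel_avg (fun x => u x `^ q) z `^ q^-1.
  have := @ge0_hoelder_weighted _ X R mu (fun x => k (x, z)) u (cst 1) q (1 - q^-1)^-1.
  have -> : \int[mu]_x (k (x, z) * (u x * cst 1 x)) = kernel_avg u z.
    by apply: eq_integral => x _; rewrite mule1.
  have -> : \int[mu]_x (k (x, z) * cst 1 x `^ (1 - q^-1)^-1) = 1.
    by rewrite -[RHS](k1 Dz); apply: eq_integral => x _; rewrite poweR1r mule1.
  rewrite poweR1r mule1; apply => //; first exact: measurable_kernel_r.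
    by rewrite invr_gt0 subr_gt0 invf_lt1.
  by rewrite invrK addrC subrK.
move=> /(ge0_le_poweR (ltW q0) (avg_ge0 _ u0)).
rewrite poweRVK ?gt_eqF//; apply: avg_ge0 => x; exact: poweR_ge0.
Qed.

Lemma sqfun_hoelder (f g : Z -> \bar R) (q q' : R) x :
  measurable_fun setT f -> measurable_fun setT g ->
  (forall z, 0 <= f z) -> (forall z, 0 <= g z) ->
  (0 < q)%R -> (0 < q')%R -> (q^-1 + q'^-1 = 1)%R ->
  \int[nu]_z (k (x, z) * (f z * g z)) <= kernel_sqfun q f x `^ q^-1 * kernel_sqfun q' g x `^ q'^-1.
Proof. by move=> *; apply: ge0_hoelder_weighted => //; exact: measurable_kernel_l. Qed.

Lemma pairing_le_energy (f g : Z -> \bar R) (p p' q q' : R) :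
  measurable_fun setT f -> measurable_fun setT g ->
  (forall z, 0 <= f z) -> (forall z, 0 <= g z) ->
  (0 < p)%R -> (0 < p')%R -> (p^-1 + p'^-1 = 1)%R ->
  (0 < q)%R -> (0 < q')%R -> (q^-1 + q'^-1 = 1)%R ->
  \int[nu]_(z in D) (f z * g z) <= kernel_energy p q f `^ p^-1 * kernel_energy p' q' g `^ p'^-1.
Proof.
move=> mf mg f0 g0 p0 p'0 pp' q0 q'0 qq'.
have mfg : measurable_fun setT (fun z => f z * g z) by exact: emeasurable_funM.
have fg0 z : 0 <= f z * g z by rewrite mule_ge0.
have -> : \int[nu]_(z in D) (f z * g z) =
          \int[mu]_x \int[nu]_z (k (x, z) * (f z * g z)).
  (* The average of the constant 1 is 1 on [D] and 0 off [D], so inserting it turns the integral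
     over [D] into an iterated integral over cones. *)
  transitivity (\int[mu]_x (cst 1 x * \int[nu]_z (k (x, z) * (f z * g z)))); last first.
    by apply: eq_integral => x _; rewrite mul1e.
  rewrite kernel_fubini// integral_mkcond; apply: eq_integral => z _.
  rewrite patchE; case: ifPn => [/set_mem Dz|/negP nDz]; first by rewrite avg_cst1// mule1.
  rewrite /kernel_avg integral0_eq ?mule0// => x _.
  by rewrite kD ?mul0e// => Dz; apply: nDz; rewrite inE.
apply: (@le_trans _ _ (\int[mu]_x (kernel_sqfun q f x `^ q^-1 * kernel_sqfun q' g x `^ q'^-1))).
  apply: ge0_le_integral => //.
  - by move=> x _; exact: kint_ge0.
  - exact: measurable_kint.
  - by apply: emeasurable_funM; apply: measurable_fun_poweR; exact: measurable_sqfun.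
  - by move=> x _; exact: sqfun_hoelder.
apply: le_trans (ge0_hoelder _ _ _ _ _ p0 p'0 pp') _.
- by apply: measurable_fun_poweR; exact: measurable_sqfun.
- by apply: measurable_fun_poweR; exact: measurable_sqfun.
- by move=> x; exact: poweR_ge0.
- by move=> x; exact: poweR_ge0.
rewrite /kernel_energy le_eqVlt; apply/orP; left; apply/eqP; congr (_ `^ _ * _ `^ _).
- by apply: eq_integral => x _; rewrite -poweRrM mulrC.
- by apply: eq_integral => x _; rewrite -poweRrM mulrC.
Qed.

End kernel_averages.

(** * Absorption and limits of powers in [0, +oo] *)

Section ereal_sequences.
Local Open Scope ereal_scope.
Context (R : realType).

(** Cancelling x^(1/r) leaves x^(1/s) <= a. Finiteness of [x] cannot be dropped: +oo satisfies the
    inequality for every a > 0. *)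
Lemma poweR_absorb (x a : \bar R) (r s : R) : 0 <= a -> 0 <= x -> x < +oo ->
  (0 < r)%R -> (0 < s)%R -> (r^-1 + s^-1 = 1)%R -> x <= a * x `^ r^-1 -> x <= a `^ s.
Proof.
move=> a0 x0 xoo r0 s0 rs; have [->|xn0] := eqVneq x 0; first by rewrite poweR_ge0.
have xgt0 : 0 < x by rewrite lt0e xn0.
have xf : x \is a fin_num by rewrite ge0_fin_numE.
rewrite -{1}(poweRe1 x0) -rs poweRD; last by rewrite add_neq0_poweRD_def// rs.
rewrite [leLHS]muleC lee_pmul2r ?fin_num_poweR ?poweR_gt0// => H.
by rewrite -(@poweRVK _ x s) ?gt_eqF// ge0_le_poweR ?poweR_ge0// ltW.
Qed.

(** Both limits are suprema, and they are compared by applying the power 1/r to the inequalities u n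
    ^ r <= S. This treats an infinite limit together with the finite ones. *)
Lemma nondecreasing_cvg_poweR (u : (\bar R)^nat) (l : \bar R) (r : R) :
  (0 < r)%R -> (forall n, 0 <= u n) -> nondecreasing_seq u -> u @ \oo --> l ->
  (fun n => u n `^ r) @ \oo --> l `^ r.
Proof.
move=> r0 u0 nd ul.
have ndr : nondecreasing_seq (fun n => u n `^ r).
  by move=> m n mn; apply: ge0_le_poweR => //; [exact: ltW|exact: nd].
have [S uS [ubS lubS]] : exists2 S : \bar R, (fun n => u n `^ r) @ \oo --> S &
    (forall n, u n `^ r <= S) /\ (forall y, (forall n, u n `^ r <= y) -> S <= y).
  exists (ereal_sup (range (fun n => u n `^ r))); first exact: ereal_nondecreasing_cvgn.
  split=> [n|y uy]; first by apply: ereal_sup_ubound; exists n.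
  by apply: ge_ereal_sup => _ [n _ <-].
suff -> : l `^ r = S by [].
have lE : l = ereal_sup (range u).
  by apply: (cvg_unique _ ul) => //; exact: ereal_nondecreasing_cvgn.
have ule n : u n <= l by rewrite lE; apply: ereal_sup_ubound; exists n.
apply/eqP; rewrite eq_le; apply/andP; split; last first.
  by apply: lubS => n; apply: ge0_le_poweR => //; exact: ltW.
have S0 : 0 <= S by apply: (le_trans (poweR_ge0 (u 0%N) r)); apply: ubS.
rewrite -(@poweRVK _ S r) ?gt_eqF//; apply: ge0_le_poweR; [exact: ltW|exact: le_trans (ule 0%N)|].
rewrite lE; apply: ge_ereal_sup => _ [n _ <-].
rewrite -(@poweRK _ (u n) r) ?gt_eqF//; apply: ge0_le_poweR; [by rewrite invr_ge0 ltW|exact: poweR_ge0|exact: ubS].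
Qed.

Lemma cvg0_poweR (u : (\bar R)^nat) (r : R) : (0 < r)%R -> (forall n, 0 <= u n) ->
  u @ \oo --> 0 -> (fun n => u n `^ r) @ \oo --> 0.
Proof.
move=> r0 u0 u_0; apply/fine_cvgP.
have Ht (e : R) : (0 < e)%R -> \forall n \near \oo, u n <= e%:E.
  move=> e0; move/fine_cvgP : (u_0) => [uf /cvgrPdist_le/(_ e e0)].
  apply: filterS2 uf => n unf; rewrite sub0r normrN => /ler_normlW.
  by rewrite -lee_fin /= fineK.
split.
  by apply: filterS (Ht 1%R ltr01) => n un; rewrite fin_num_poweR// ge0_fin_numE// (le_lt_trans un)// ltry.
apply/cvgrPdist_le => e e0.
have := Ht (e `^ r^-1)%R (powR_gt0 _ e0); apply: filterS => n un.
have : u n `^ r <= e%:E.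
  apply: le_trans (ge0_le_poweR (ltW r0) (u0 n) un) _.
  by rewrite poweR_EFin -powRrM mulVf ?gt_eqF// powRr1// ltW.
have uf : u n `^ r \is a fin_num by rewrite fin_num_poweR// ge0_fin_numE// (le_lt_trans un)// ltry.
rewrite sub0r normrN /= ger0_norm ?fine_ge0 ?poweR_ge0// => H.
by rewrite -lee_fin fineK.
Qed.

End ereal_sequences.

(** * Monotone and dominated convergence for nonnegative functions *)

Section monotone_integral.
Local Open Scope ereal_scope.
Context d (T : measurableType d) (R : realType).
Variable mu : {measure set T -> \bar R}.

Lemma ge0_cvg_integral (f : (T -> \bar R)^nat) (g : T -> \bar R) :
  (forall n, measurable_fun setT (f n)) -> (forall n x, 0 <= f n x) ->
  (forall x, nondecreasing_seq (f ^~ x)) -> (forall x, f ^~ x @ \oo --> g x) ->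
  (fun n => \int[mu]_x f n x) @ \oo --> \int[mu]_x g x.
Proof.
move=> mf f0 nd fg.
have -> : \int[mu]_x g x = \int[mu]_x (limn (f ^~ x)).
  by apply: eq_integral => x _; apply/esym/cvg_lim.
by apply: cvg_monotone_convergence => // x _; exact: nd.
Qed.

Lemma ge0_cvg_integral0 (f : (T -> \bar R)^nat) (g : T -> \bar R) :
  (forall n, measurable_fun setT (f n)) -> (forall n x, 0 <= f n x) ->
  measurable_fun setT g ->
  (forall n x, f n x <= g x) -> \int[mu]_x g x < +oo ->
  {ae mu, forall x, f ^~ x @ \oo --> 0} ->
  (fun n => \int[mu]_x f n x) @ \oo --> 0.
Proof.
move=> mf f0 mg fg goo f_0.
have g0 x : 0 <= g x by apply: le_trans (fg 0%N x).
have := @dominated_convergence _ T R mu setT measurableT f (cst 0) g mf.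
case=> //.
- by apply: filterS f_0 => x H _.
- by apply/integrableP; split => //; under eq_integral do rewrite gee0_abs//.
- by apply: aeW => x n _; rewrite gee0_abs.
- by move=> _ _; rewrite integral0.
Qed.

End monotone_integral.

(** * Monotonicity, convergence and finiteness of energies *)

Section energy_estimates.
Local Open Scope ereal_scope.
Context d1 d2 (X : measurableType d1) (Z : measurableType d2) (R : realType).
Variables (mu : {sigma_finite_measure set X -> \bar R})
          (nu : {sigma_finite_measure set Z -> \bar R}).
Variables (D : set Z) (k : X * Z -> \bar R).
Hypothesis mk : measurable_fun setT k.
Hypothesis k0 : forall w, 0 <= k w.
Hypothesis koo : forall w, k w < +oo.
Hypothesis kD : forall x z, ~ D z -> k (x, z) = 0.

Local Notation sqfun := (kernel_sqfun nu k).
Local Notation energy := (kernel_energy mu nu k).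
Local Notation avg := (kernel_avg mu k).

Lemma le_sqfun q f g x : measurable_fun setT f -> measurable_fun setT g ->
  (0 < q)%R -> (forall z, 0 <= f z) -> (forall z, D z -> f z <= g z) ->
  sqfun q f x <= sqfun q g x.
Proof.
move=> mf mg q0 f0 fg; apply: ge0_le_integral => //.
- by move=> z _; rewrite mule_ge0// poweR_ge0.
- by apply: emeasurable_funM; [exact: measurable_kernel_l|exact: measurable_fun_poweR].
- by apply: emeasurable_funM; [exact: measurable_kernel_l|exact: measurable_fun_poweR].
- move=> z _; have [Dz|nDz] := pselect (D z); last by rewrite kD// !mul0e.
  by rewrite lee_wpmul2l// ge0_le_poweR//; [exact: ltW|exact: fg].
Qed.

Lemma le_energy p q f g : measurable_fun setT f -> measurable_fun setT g ->
  (0 < p)%R -> (0 < q)%R -> (forall z, 0 <= f z) -> (forall z, D z -> f z <= g z) ->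
  energy p q f <= energy p q g.
Proof.
move=> mf mg p0 q0 f0 fg; apply: ge0_le_integral => //.
- by move=> x _; exact: poweR_ge0.
- by apply: measurable_fun_poweR; exact: measurable_sqfun.
- by apply: measurable_fun_poweR; exact: measurable_sqfun.
- move=> x _; apply: ge0_le_poweR; first by rewrite divr_ge0// ltW.
    exact: sqfun_ge0.
  exact: le_sqfun.
Qed.

(** Dominated convergence is used twice: in [z], for almost every [x], since finite energy makes
    [sqfun q F x] finite almost everywhere, and then in [x] with majorant [sqfun q F x] raised to p
    / q. *)
Lemma energy_dominated_cvg0 p q (f : (Z -> \bar R)^nat) (F : Z -> \bar R) :
  (0 < p)%R -> (0 < q)%R ->
  (forall n, measurable_fun setT (f n)) -> measurable_fun setT F ->
  (forall n z, 0 <= f n z) -> (forall n z, f n z <= F z) ->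
  energy p q F < +oo -> (forall z, D z -> f ^~ z @ \oo --> 0) ->
  (fun n => energy p q (f n)) @ \oo --> 0.
Proof.
move=> p0 q0 mf mF f0 fF Foo f_0.
have F0 z : 0 <= F z by apply: le_trans (fF 0%N z).
have pq : (0 < p / q)%R by rewrite divr_gt0.
apply: (@ge0_cvg_integral0 _ _ _ mu _ (fun x => sqfun q F x `^ (p / q))) => //.
- by move=> n; apply: measurable_fun_poweR; exact: measurable_sqfun.
- by move=> n x; exact: poweR_ge0.
- by apply: measurable_fun_poweR; exact: measurable_sqfun.
- move=> n x; apply: ge0_le_poweR; [exact: ltW|exact: sqfun_ge0|].
  by apply: le_sqfun => // z _.
have := ge0_integral_lty_ae (measurable_fun_poweR (p / q) (measurable_sqfun nu mk k0 q mF)) (fun x => poweR_ge0 _ _) Foo.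
apply: filterS => x /lty_poweRy; rewrite gt_eqF// => /(_ isT) Fx.
apply: cvg0_poweR => //; first by move=> n; exact: sqfun_ge0.
apply: (@ge0_cvg_integral0 _ _ _ nu _ (fun z => k (x, z) * F z `^ q)) => //.
- by move=> n; apply: emeasurable_funM; [exact: measurable_kernel_l|exact: measurable_fun_poweR].
- by move=> n z; rewrite mule_ge0// poweR_ge0.
- by apply: emeasurable_funM; [exact: measurable_kernel_l|exact: measurable_fun_poweR].
- by move=> n z; rewrite lee_wpmul2l// ge0_le_poweR// ltW.
apply: aeW => z; have [Dz|nDz] := pselect (D z); last first.
  by under eq_fun do rewrite kD// mul0e; exact: cvg_cst.
rewrite -[X in _ --> X](mule0 (k (x, z))); apply: cvgeZl; first by rewrite ge0_fin_numE.
by apply: cvg0_poweR => //; exact: f_0.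
Qed.

Section bounded_support.
Variables (K : set Z) (B : set X) (kap : R).
Hypotheses (mK : measurable K) (mB : measurable B) (nuK : nu K < +oo) (muB : mu B < +oo).
Hypothesis kap0 : (0 <= kap)%R.
Hypothesis kK : forall x z, K z -> k (x, z) <= kap%:E * (\1_B x)%:E.

(** Over [K] the kernel is at most [kap] and vanishes unless [x] lies in [B], so kap * c^q * nu(K)
    is a bound that depends on [f] only through [c]. *)
Lemma sqfun_bounded_support q (c : R) : (0 < q)%R -> (0 <= c)%R ->
  exists2 b : R, (0 <= b)%R &
    forall f, measurable_fun setT f -> (forall z, 0 <= f z <= c%:E) ->
      (forall z, ~ K z -> f z = 0) ->
      forall x, sqfun q f x <= b%:E * (\1_B x)%:E.
Proof.
move=> q0 c0; exists (kap * c `^ q * fine (nu K))%R.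
  by rewrite !mulr_ge0// ?powR_ge0// fine_ge0.
move=> f mf fc fK x.
have nuKf : nu K \is a fin_num by rewrite ge0_fin_numE.
have -> : sqfun q f x = \int[nu]_(z in K) (k (x, z) * f z `^ q).
  rewrite [RHS]integral_mkcond; apply: eq_integral => z _; rewrite patchE.
  by case: ifPn => // /negP zK; rewrite fK ?poweR0r ?mule0 ?gt_eqF// => Kz; apply: zK; rewrite inE.
apply: (@le_trans _ _ (\int[nu]_(z in K) (cst ((kap * \1_B x * c `^ q)%:E) z))).
  apply: ge0_le_integral => //.
  - by move=> z _; rewrite mule_ge0// poweR_ge0.
  - apply: measurable_funTS; apply: emeasurable_funM; first exact: measurable_kernel_l.
    exact: measurable_fun_poweR.
  - move=> z Kz; rewrite EFinM; apply: lee_pmul => //; first exact: poweR_ge0.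
      exact: kK.
    by rewrite -poweR_EFin ge0_le_poweR//; [exact: ltW|case/andP: (fc z)|case/andP: (fc z)].
rewrite integral_cst// -[X in _ * X <= _](fineK nuKf) -!EFinM lee_fin.
by rewrite le_eqVlt; apply/orP; left; apply/eqP; ring.
Qed.

Lemma energy_bounded_support p q f (c : R) : (0 < p)%R -> (0 < q)%R -> (0 <= c)%R ->
  measurable_fun setT f -> (forall z, 0 <= f z <= c%:E) ->
  (forall z, ~ K z -> f z = 0) -> energy p q f < +oo.
Proof.
move=> p0 q0 c0 mf fc fK; have [b b0 Hb] := sqfun_bounded_support q0 c0.
have f0 z : 0 <= f z by case/andP : (fc z).
have pq : (0 < p / q)%R by rewrite divr_gt0.
apply: (@le_lt_trans _ _ (\int[mu]_(x in B) (cst (b `^ (p / q))%:E x))); last first.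
  by rewrite integral_cst// lte_mul_pinfty// lee_fin powR_ge0.
rewrite [leRHS]integral_mkcond; apply: ge0_le_integral => //.
- by move=> x _; exact: poweR_ge0.
- by apply: measurable_fun_poweR; exact: measurable_sqfun.
- by apply/(measurable_restrictT _ _).1 => //; exact: measurable_cst.
- move=> x _; rewrite patchE.
  have := Hb _ mf fc fK x; rewrite indicE; case: ifPn => xB; last first.
    rewrite mule0 => S0; have -> : sqfun q f x = 0 by apply/eqP; rewrite eq_le S0 sqfun_ge0.
    by rewrite poweR0r// gt_eqF.
  rewrite mule1 => Sb; rewrite /= -poweR_EFin; apply: ge0_le_poweR => //; first exact: ltW.
  exact: sqfun_ge0.
Qed.

End bounded_support.

End energy_estimates.

(** * The energy of the test function in the three cases p < q, p = q, p > q *)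

Section dual_test_functions.
Local Open Scope ereal_scope.
Context d1 d2 (X : measurableType d1) (Z : measurableType d2) (R : realType).
Variables (mu : {sigma_finite_measure set X -> \bar R})
          (nu : {sigma_finite_measure set Z -> \bar R}).
Variables (D : set Z) (k : X * Z -> \bar R).
Hypothesis mk : measurable_fun setT k.
Hypothesis k0 : forall w, 0 <= k w.
Hypothesis kD : forall x z, ~ D z -> k (x, z) = 0.
Hypothesis k1 : forall z, D z -> \int[mu]_x k (x, z) = 1.

Local Notation sqfun := (kernel_sqfun nu k).
Local Notation energy := (kernel_energy mu nu k).
Local Notation avg := (kernel_avg mu k).

Hypothesis HLk : averages_dominated mu k.

Variables (p p' q q' : R).
Hypotheses (p1 : (1 < p)%R) (p'1 : (1 < p')%R) (pp' : (p^-1 + p'^-1 = 1)%R).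
Hypotheses (q1 : (1 < q)%R) (q'1 : (1 < q')%R) (qq' : (q^-1 + q'^-1 = 1)%R).

Let p0 : (0 < p)%R. Proof. exact: lt_trans p1. Qed.
Let p'0 : (0 < p')%R. Proof. exact: lt_trans p'1. Qed.
Let q0 : (0 < q)%R. Proof. exact: lt_trans q1. Qed.
Let q'0 : (0 < q')%R. Proof. exact: lt_trans q'1. Qed.
Let pn0 : p != 0%R. Proof. by rewrite gt_eqF. Qed.
Let p'n0 : p' != 0%R. Proof. by rewrite gt_eqF. Qed.
Let qn0 : q != 0%R. Proof. by rewrite gt_eqF. Qed.
Let q'n0 : q' != 0%R. Proof. by rewrite gt_eqF. Qed.

Let pE : (p = p' / (p' - 1))%R.
Proof.
have h : (p^-1 = (p' - 1) / p')%R by rewrite mulrBl mul1r mulfV// -pp' addrK.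
by rewrite -[LHS]invrK h invf_div.
Qed.
Let qE : (q = q' / (q' - 1))%R.
Proof.
have h : (q^-1 = (q' - 1) / q')%R by rewrite mulrBl mul1r mulfV// -qq' addrK.
by rewrite -[LHS]invrK h invf_div.
Qed.
Let p'1n0 : (p' - 1 != 0)%R. Proof. by rewrite subr_eq0 gt_eqF. Qed.
Let q'1n0 : (q' - 1 != 0)%R. Proof. by rewrite subr_eq0 gt_eqF. Qed.

Definition test_fun (u : X -> \bar R) (g : Z -> \bar R) (z : Z) : \bar R :=
  g z `^ (q' - 1) * avg u z.

Lemma measurable_test_fun u g : measurable_fun setT u -> (forall x, 0 <= u x) ->
  measurable_fun setT g -> measurable_fun setT (test_fun u g).
Proof.
move=> mu' u0 mg; apply: emeasurable_funM; first exact: measurable_fun_poweR.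
exact: measurable_avg.
Qed.

Lemma test_fun_ge0 u g z : (forall x, 0 <= u x) -> 0 <= test_fun u g z.
Proof. by move=> u0; rewrite mule_ge0// ?poweR_ge0//; exact: avg_ge0. Qed.

Lemma avg_off u z : ~ D z -> avg u z = 0.
Proof. by move=> Dz; rewrite /kernel_avg integral0_eq// => x _; rewrite kD// mul0e. Qed.

Lemma test_fun_pairing u g : measurable_fun setT u -> (forall x, 0 <= u x) ->
  measurable_fun setT g -> (forall z, 0 <= g z) ->
  \int[nu]_(z in D) (test_fun u g z * g z) = \int[mu]_x (u x * sqfun q' g x).
Proof.
move=> mu' u0 mg g0; rewrite /kernel_sqfun kernel_fubini//; last 2 first.
- exact: measurable_fun_poweR.
- by move=> z; exact: poweR_ge0.
rewrite integral_mkcond; apply: eq_integral => z _; rewrite patchE.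
case: ifPn => [_|/negP zD]; last by rewrite avg_off ?mule0// => Dz; apply: zD; rewrite inE.
rewrite /test_fun muleAC; congr (_ * _); rewrite -{2}(poweRe1 (g0 z)) -poweRD ?subrK//.
by rewrite add_neq0_poweRD_def// subrK.
Qed.

(** Conjugacy of the exponents gives (q' - 1) * q = q'. *)
Lemma sqfun_test_fun u g x : (forall x, 0 <= u x) -> (forall z, 0 <= g z) ->
  sqfun q (test_fun u g) x = \int[nu]_z (k (x, z) * (g z `^ q' * avg u z `^ q)).
Proof.
move=> u0 g0; apply: eq_integral => z _; congr (_ * _).
rewrite poweRM ?poweR_ge0//; last exact: avg_ge0.
by rewrite -poweRrM; congr (_ `^ _ * _); rewrite qE; field.
Qed.

(** An average is controlled by the maximal function at [x] only for [z] in the cone of [x];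
    elsewhere the kernel is 0 and nothing has to be compared. *)
Lemma mul_le_kernel x z (a b c : \bar R) : 0 <= a -> (k (x, z) != 0 -> b <= c) ->
  k (x, z) * (a * b) <= k (x, z) * (a * c).
Proof.
move=> a0 bc; have [->|kn0] := eqVneq (k (x, z)) 0; first by rewrite !mul0e.
by rewrite lee_wpmul2l// lee_wpmul2l// bc.
Qed.

(* On the cone of [x] the average of [u] is at most the maximal function of [u] at [x]. *)
Lemma energy_test_fun_lt : (p < q)%R -> exists2 C : R, (0 <= C)%R &
  forall u g, measurable_fun setT u -> (forall x, 0 <= u x < +oo) ->
    measurable_fun setT g -> (forall z, 0 <= g z) ->
    energy p' q' g < +oo ->
    \int[mu]_x (u x `^ (p' / (p' - q'))) <= energy p' q' g ->
    energy p q (test_fun u g) <= C%:E * energy p' q' g.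
Proof.
move=> pq.
have q'p' : (q' < p')%R.
  have : (p'^-1 < q'^-1)%R.
    have : (q^-1 < p^-1)%R by rewrite ltf_pV2// posrE.
    by move: pp' qq'; lra.
  by rewrite ltf_pV2// posrE.
have s0 : (0 < p' - q')%R by rewrite subr_gt0.
have sn0 : (p' - q' != 0)%R by rewrite gt_eqF.
have r1 : (1 < p' / (p' - q'))%R by rewrite ltr_pdivlMr// mul1r ltrBlDr ltrDl.
have [C C0 HC] := HLk r1.
(* Conjugate exponents for the outer Hoelder inequality: [a] turns v^p into v^(p' / (p' - q')), the
   power that [HLk] controls, and [b] turns the power p / q of [sqfun q' g] into p' / q', the
   integrand of [energy p' q' g]. *)
pose a := (p' / ((p' - q') * p))%R; pose b := (p' * q / (q' * p))%R.
have a0 : (0 < a)%R by rewrite divr_gt0// mulr_gt0.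
have b0 : (0 < b)%R by rewrite divr_gt0// mulr_gt0.
have ab : (a^-1 + b^-1 = 1)%R.
  rewrite /a /b !invf_div pE qE; field.
  by rewrite p'n0 p'1n0 q'n0 q'1n0.
exists (C `^ a^-1)%R; first exact: powR_ge0.
move=> u g mu' uoo mg g0 Ioo uI; set I := energy p' q' g.
have u0 x : 0 <= u x by case/andP : (uoo x).
have I0 : 0 <= I by exact: energy_ge0.
have [v [mv v0 uv vC]] := HC u mu' uoo (le_lt_trans uI Ioo).
have mB := measurable_sqfun nu mk k0 q' mg.
have mT := measurable_test_fun mu' u0 mg.
have B0 x := sqfun_ge0 nu k0 q' g x.
have le1 x : sqfun q (test_fun u g) x <= v x `^ q * sqfun q' g x.
  rewrite sqfun_test_fun// /kernel_sqfun -ge0_integralZl//; last 3 first.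
  - by apply: emeasurable_funM; [exact: measurable_kernel_l|exact: measurable_fun_poweR].
  - by move=> z _; rewrite mule_ge0// poweR_ge0.
  - exact: poweR_ge0.
  apply: ge0_le_integral => //.
  - by move=> z _; rewrite !mule_ge0// poweR_ge0.
  - apply: emeasurable_funM; first exact: measurable_kernel_l.
    apply: emeasurable_funM; apply: measurable_fun_poweR => //.
    exact: measurable_avg.
  - apply: emeasurable_funM => //; apply: emeasurable_funM; first exact: measurable_kernel_l.
    exact: measurable_fun_poweR.
  - move=> z _; rewrite [leRHS]muleCA (muleC (v x `^ q)).
    apply: mul_le_kernel => [|kn0]; first exact: poweR_ge0.
    by apply: ge0_le_poweR; [exact: ltW|exact: avg_ge0|exact: uv].
have le2 : energy p q (test_fun u g) <=
    \int[mu]_x (v x `^ p * sqfun q' g x `^ (p / q)).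
  apply: ge0_le_integral => //.
  - by move=> x _; exact: poweR_ge0.
  - by apply: measurable_fun_poweR; exact: measurable_sqfun.
  - by apply: emeasurable_funM; exact: measurable_fun_poweR.
  - move=> x _; have -> : v x `^ p = (v x `^ q) `^ (p / q).
      by rewrite -poweRrM; congr (_ `^ _); field.
    rewrite -poweRM ?poweR_ge0//; apply: ge0_le_poweR => //.
      by rewrite divr_ge0// ltW.
    exact: sqfun_ge0.
apply: (le_trans le2).
apply: (le_trans (ge0_hoelder mu _ _ _ _ a0 b0 ab)).
- exact: measurable_fun_poweR.
- exact: measurable_fun_poweR.
- by move=> x; exact: poweR_ge0.
- by move=> x; exact: poweR_ge0.
have -> : \int[mu]_x ((sqfun q' g x `^ (p / q)) `^ b) = I.
  apply: eq_integral => x _; rewrite -poweRrM; congr (_ `^ _).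
  by rewrite /b; field; rewrite qn0 pn0 q'n0.
have -> : \int[mu]_x ((v x `^ p) `^ a) = \int[mu]_x (v x `^ (p' / (p' - q'))).
  apply: eq_integral => x _; rewrite -poweRrM; congr (_ `^ _).
  by rewrite /a; field; rewrite pn0 sn0.
(* Split I as I^(1/a) * I^(1/b). The second factor is already present on the left, and the first
   comes from [vC] and [uI] at the cost of C^(1/a). *)
rewrite -[X in _ <= _ * X](poweRe1 I0) -ab poweRD ?add_neq0_poweRD_def ?ab// muleA.
rewrite lee_wpmul2r ?poweR_ge0// -poweR_EFin -poweRM ?lee_fin//.
apply: ge0_le_poweR; first by rewrite invr_ge0 ltW.
  by apply: integral_ge0 => x _; exact: poweR_ge0.
by apply: (le_trans vC); rewrite lee_wpmul2l ?lee_fin.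
Qed.

(** Here also p' = q', so the weight to be used is an indicator function. Its averages are at most
    1, and the comparison is pointwise, with no maximal function. *)
Lemma energy_test_fun_eq u g : p = q ->
  measurable_fun setT u -> (forall x, 0 <= u x <= 1) ->
  measurable_fun setT g -> (forall z, 0 <= g z) ->
  energy p q (test_fun u g) <= energy p' q' g.
Proof.
move=> pq mu' u01 mg g0.
have u0 x : 0 <= u x by case/andP : (u01 x).
have p'q' : p' = q' by apply: invr_inj; move: pp' qq'; rewrite pq; lra.
have mT := measurable_test_fun mu' u0 mg.
rewrite /kernel_energy -p'q' pq !mulfV//; apply: ge0_le_integral => //.
- by move=> x _; exact: poweR_ge0.
- by apply: measurable_fun_poweR; exact: measurable_sqfun.
- by apply: measurable_fun_poweR; exact: measurable_sqfun.
move=> x _; rewrite !poweRe1; [|exact: sqfun_ge0..].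
rewrite sqfun_test_fun// p'q'; apply: ge0_le_integral => //.
- by move=> z _; rewrite !mule_ge0// poweR_ge0.
- apply: emeasurable_funM; first exact: measurable_kernel_l.
  apply: emeasurable_funM; apply: measurable_fun_poweR => //.
  exact: measurable_avg.
- by apply: emeasurable_funM; [exact: measurable_kernel_l|exact: measurable_fun_poweR].
move=> z _; rewrite -[X in _ <= _ * X]mule1; have [Dz|zD] := pselect (D z); last by rewrite kD// !mul0e.
apply: mul_le_kernel => [|_]; first exact: poweR_ge0.
rewrite -(poweR1r q); apply: ge0_le_poweR; [exact: ltW|exact: avg_ge0|].
by apply: avg_bound Dz => // x'; case/andP : (u01 x').
Qed.

(* Jensen moves the power [q] inside the average of [u]; pairing the result with the powers
   of [sqfun q (test_fun u g)] itself gives [E <= A * E ^ (1 / r)], which bounds [E] by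
   absorption once [E] is known to be finite. *)
Lemma energy_test_fun_gt : (q < p)%R -> exists2 C : R, (0 <= C)%R &
  forall u g, measurable_fun setT u -> (forall x, 0 <= u x < +oo) ->
    measurable_fun setT g -> (forall z, 0 <= g z) ->
    (forall x, u x `^ q * sqfun q' g x <= sqfun q' g x `^ (p' * q / (p * q'))) ->
    (forall x, sqfun q (test_fun u g) x < +oo) ->
    energy p q (test_fun u g) < +oo ->
    energy p q (test_fun u g) <= C%:E * energy p' q' g.
Proof.
move=> qp.
have s0 : (0 < p - q)%R by rewrite subr_gt0.
have sn0 : (p - q != 0)%R by rewrite gt_eqF.
have r1 : (1 < p / (p - q))%R by rewrite ltr_pdivlMr// mul1r ltrBlDr ltrDl.
have [C C0 HC] := HLk r1.
(* [r] is the conjugate exponent of p / q, which is what [tr] records. *)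
set r := (p / (p - q))%R in r1 HC *.
have r0 : (0 < r)%R by exact: lt_trans r1.
have t0 : (0 < p / q)%R by rewrite divr_gt0.
have tr : ((p / q)^-1 + r^-1 = 1)%R by rewrite /r !invf_div; field.
exists ((C `^ r^-1) `^ (p / q))%R; first exact: powR_ge0.
move=> u g mu' uoo mg g0 uB Phioo Eoo; set I := energy p' q' g.
have u0 x : 0 <= u x by case/andP : (uoo x).
have I0 : 0 <= I by exact: energy_ge0.
have mT := measurable_test_fun mu' u0 mg.
set Phi := sqfun q (test_fun u g) in Phioo *.
have Phi0 x : 0 <= Phi x by exact: sqfun_ge0.
have mPhi : measurable_fun setT Phi by exact: measurable_sqfun.
set E := energy p q (test_fun u g) in Eoo *.
have E0 : 0 <= E by exact: energy_ge0.
(* The factor dual to [Phi]: the integrand of E is [Phi x * H x], while the integral of H^r is E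
   again. *)
pose H x := Phi x `^ ((p - q) / q).
have H0 x : 0 <= H x by exact: poweR_ge0.
have mH : measurable_fun setT H by exact: measurable_fun_poweR.
have HE : \int[mu]_x (H x `^ r) = E.
  apply: eq_integral => x _; rewrite -poweRrM; congr (_ `^ _).
  by rewrite /r; field; rewrite sn0 qn0.
have Hoo x : 0 <= H x < +oo by rewrite H0 poweR_lty.
have [v [mv v0 uv vC]] := HC H mH Hoo (eq_ind_r (fun y => y < +oo) Eoo HE).
have mB := measurable_sqfun nu mk k0 q' mg.
have B0 x := sqfun_ge0 nu k0 q' g x.
pose w z := g z `^ q' * avg u z `^ q.
have mavgu : measurable_fun setT (avg u) by exact: measurable_avg.
have mavgH : measurable_fun setT (avg H) by exact: measurable_avg.
have avgu0 z : 0 <= avg u z by exact: avg_ge0.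
have avgH0 z : 0 <= avg H z by exact: avg_ge0.
have mgq : measurable_fun setT (fun z => g z `^ q') by exact: measurable_fun_poweR.
have muq : measurable_fun setT (fun x => u x `^ q) by exact: measurable_fun_poweR.
have mavguq : measurable_fun setT (avg (fun x => u x `^ q)).
  by apply: measurable_avg => // x; exact: poweR_ge0.
have mw : measurable_fun setT w.
  by apply: emeasurable_funM => //; exact: measurable_fun_poweR.
have step1 : E = \int[nu]_z (w z * avg H z).
  rewrite -kernel_fubini//; last by move=> z; rewrite mule_ge0// poweR_ge0.
  apply: eq_integral => x _; rewrite -/(sqfun q (test_fun u g) x) -sqfun_test_fun//.
  rewrite -/Phi -{2}(poweRe1 (Phi0 x)) -poweRD.
    by congr (_ `^ _); field.
  by rewrite add_neq0_poweRD_def// gt_eqF// addr_gt0// divr_gt0.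
(* After Jensen the average falls on u^q, which can be moved back to the [x] side; [avg H] stays
   inside the cone integral and is replaced there by the maximal function [v] of [H]. *)
have step2 : E <= \int[nu]_z ((g z `^ q' * avg H z) * avg (fun x => u x `^ q) z).
  rewrite step1; apply: ge0_le_integral => //.
  - by move=> z _; rewrite !mule_ge0// poweR_ge0.
  - exact: emeasurable_funM.
  - by apply: emeasurable_funM => //; exact: emeasurable_funM.
  - move=> z _; have [Dz|zD] := pselect (D z); last by rewrite (avg_off H zD) !mule0 mul0e.
    rewrite /w muleAC lee_wpmul2l//; first by rewrite mule_ge0// poweR_ge0.
    exact: (avg_jensen mk k0 k1).
have step3 : E <= \int[mu]_x (sqfun q' g x `^ (p' * q / (p * q')) * v x).
  apply: (le_trans step2); rewrite -kernel_fubini//; last 3 first.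
  - exact: emeasurable_funM.
  - by move=> x; exact: poweR_ge0.
  - by move=> z; rewrite mule_ge0// poweR_ge0.
  apply: ge0_le_integral => //.
  - move=> x _; rewrite mule_ge0// ?poweR_ge0//; apply: kint_ge0 => // z.
    by rewrite mule_ge0// poweR_ge0.
  - apply: emeasurable_funM => //; apply: measurable_kint => //.
      exact: emeasurable_funM.
    by move=> z; rewrite mule_ge0// poweR_ge0.
  - by apply: emeasurable_funM => //; exact: measurable_fun_poweR.
  - move=> x _; apply: (@le_trans _ _ (u x `^ q * (sqfun q' g x * v x))); last first.
      by rewrite muleA lee_wpmul2r.
    rewrite lee_wpmul2l ?poweR_ge0//.
    rewrite /kernel_sqfun -ge0_integralZr//; last 2 first.
    - by apply: emeasurable_funM => //; exact: measurable_kernel_l.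
    - by move=> z _; rewrite mule_ge0// poweR_ge0.
    apply: ge0_le_integral => //.
    + by move=> z _; rewrite !mule_ge0// poweR_ge0.
    + apply: emeasurable_funM; first exact: measurable_kernel_l.
      exact: emeasurable_funM.
    + by apply: emeasurable_funM => //; apply: emeasurable_funM => //; exact: measurable_kernel_l.
    + move=> z _; rewrite -muleA; apply: mul_le_kernel => [|kn0]; first exact: poweR_ge0.
      exact: uv.
have step4 : E <= (I `^ (p / q)^-1 * (C `^ r^-1)%:E) * E `^ r^-1.
  apply: (le_trans step3).
  apply: (le_trans (ge0_hoelder mu _ _ _ _ t0 r0 tr)) => //.
  - exact: measurable_fun_poweR.
  - by move=> x; exact: poweR_ge0.
  have -> : \int[mu]_x ((sqfun q' g x `^ (p' * q / (p * q'))) `^ (p / q)) = I.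
    apply: eq_integral => x _; rewrite -poweRrM; congr (_ `^ _).
    by field; rewrite qn0 pn0 q'n0.
  rewrite -muleA lee_wpmul2l ?poweR_ge0// -poweR_EFin -poweRM ?lee_fin//.
  apply: ge0_le_poweR; first by rewrite invr_ge0 ltW.
    by apply: integral_ge0 => x _; exact: poweR_ge0.
  by rewrite -HE.
have A0 : 0 <= I `^ (p / q)^-1 * (C `^ r^-1)%:E.
  by rewrite mule_ge0// ?poweR_ge0 ?lee_fin ?powR_ge0.
rewrite addrC in tr; have := poweR_absorb A0 E0 Eoo r0 t0 tr step4.
rewrite poweRM ?poweR_ge0 ?lee_fin ?powR_ge0//.
by rewrite poweRVK ?gt_eqF// muleC poweR_EFin.
Qed.

End dual_test_functions.

(** * The dual energy is controlled by pairings with test functions *)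

Section dual_norm_bound.
Local Open Scope ereal_scope.
Context d1 d2 (X : measurableType d1) (Z : measurableType d2) (R : realType).
Variables (mu : {sigma_finite_measure set X -> \bar R})
          (nu : {sigma_finite_measure set Z -> \bar R}).
Variables (D : set Z) (k : X * Z -> \bar R).
Hypothesis mk : measurable_fun setT k.
Hypothesis k0 : forall w, 0 <= k w.
Hypothesis kD : forall x z, ~ D z -> k (x, z) = 0.
Hypothesis k1 : forall z, D z -> \int[mu]_x k (x, z) = 1.

Local Notation sqfun := (kernel_sqfun nu k).
Local Notation energy := (kernel_energy mu nu k).
Local Notation avg := (kernel_avg mu k).

Hypothesis HLk : averages_dominated mu k.

Variables (K : (set Z)^nat) (B : (set X)^nat) (kap : nat -> R).
Hypotheses (mK : forall n, measurable (K n)) (mB : forall n, measurable (B n)).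
Hypotheses (nuK : forall n, nu (K n) < +oo) (muB : forall n, mu (B n) < +oo).
Hypothesis kap0 : forall n, (0 <= kap n)%R.
Hypothesis kK : forall n x z, K n z -> k (x, z) <= (kap n)%:E * (\1_(B n) x)%:E.
Hypothesis ndK : nondecreasing_seq K.
Hypothesis KD : \bigcup_n K n = D.

Variables (p p' q q' : R).
Hypotheses (p1 : (1 < p)%R) (p'1 : (1 < p')%R) (pp' : (p^-1 + p'^-1 = 1)%R).
Hypotheses (q1 : (1 < q)%R) (q'1 : (1 < q')%R) (qq' : (q^-1 + q'^-1 = 1)%R).

Let p0 : (0 < p)%R. Proof. exact: lt_trans p1. Qed.
Let p'0 : (0 < p')%R. Proof. exact: lt_trans p'1. Qed.
Let q0 : (0 < q)%R. Proof. exact: lt_trans q1. Qed.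
Let q'0 : (0 < q')%R. Proof. exact: lt_trans q'1. Qed.
Let pn0 : p != 0%R. Proof. by rewrite gt_eqF. Qed.
Let p'n0 : p' != 0%R. Proof. by rewrite gt_eqF. Qed.
Let qn0 : q != 0%R. Proof. by rewrite gt_eqF. Qed.
Let q'n0 : q' != 0%R. Proof. by rewrite gt_eqF. Qed.
Let pE : (p = p' / (p' - 1))%R.
Proof.
have h : (p^-1 = (p' - 1) / p')%R by rewrite mulrBl mul1r mulfV// -pp' addrK.
by rewrite -[LHS]invrK h invf_div.
Qed.
Let qE : (q = q' / (q' - 1))%R.
Proof.
have h : (q^-1 = (q' - 1) / q')%R by rewrite mulrBl mul1r mulfV// -qq' addrK.
by rewrite -[LHS]invrK h invf_div.
Qed.
Let p'1n0 : (p' - 1 != 0)%R. Proof. by rewrite subr_eq0 gt_eqF. Qed.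
Let q'1n0 : (q' - 1 != 0)%R. Proof. by rewrite subr_eq0 gt_eqF. Qed.

(* The weight [A_q'(g) ^ (p' - q')]; the exponent may be negative, hence the cut-off at [e]. *)
Definition dual_weight (g : Z -> \bar R) (e : R) : X -> \bar R :=
  (fun x => sqfun q' g x `^ ((p' - q') / q')) \_ [set x | e%:E < sqfun q' g x].

Lemma measurable_dual_weight g e : measurable_fun setT g ->
  measurable_fun setT (dual_weight g e).
Proof.
move=> mg; have mS := measurable_sqfun nu mk k0 q' mg.
apply/(measurable_restrictT _ _).1; last first.
  by apply: measurable_funTS; exact: measurable_fun_poweR.
by rewrite -[X in measurable X]setTI; exact: emeasurable_fun_o_infty.
Qed.

Lemma dual_weight_ge0 g e x : 0 <= dual_weight g e x.
Proof. by rewrite /dual_weight patchE; case: ifPn => // _; exact: poweR_ge0. Qed.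

(** The sign of [t] is not known: the bound is attained at [b] for t >= 0, and for t < 0 it is the
    value at [e], whence the need for e > 0. *)
Lemma bounded_powR_itv (e b t : R) : (0 < e)%R -> exists c : R,
  forall y, (e < y <= b -> y `^ t <= c)%R.
Proof.
move=> e0; have [t0|t0] := leP 0%R t.
  exists (b `^ t)%R => y /andP[ey yb]; have y0 : (0 <= y)%R by rewrite ltW// (lt_trans e0).
  by apply: ge0_ler_powR => //; rewrite nnegrE// (le_trans y0).
exists (e `^ t)%R => y /andP[ey _]; have y0 : (0 < y)%R by exact: lt_trans ey.
rewrite -(opprK t) (powRN y) (powRN e) lef_pV2 ?posrE ?powR_gt0//.
by apply: ge0_ler_powR; rewrite ?nnegrE ?oppr_ge0 ltW.
Qed.

Section bounded_g.
Variables (g : Z -> \bar R) (n : nat) (c : R).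
Hypothesis mg : measurable_fun setT g.
Hypothesis gc : forall z, 0 <= g z <= c%:E.
Hypothesis gK : forall z, ~ K n z -> g z = 0.

Let g0 z : 0 <= g z. Proof. by case/andP : (gc z). Qed.
Let c0 : (0 <= c)%R. Proof. by rewrite -lee_fin; case/andP : (gc point); exact: le_trans. Qed.

Lemma sqfun_fin : exists b : R, forall x, exists2 y : R, (0 <= y <= b)%R & sqfun q' g x = y%:E.
Proof.
have [b b0 Hb] := sqfun_bounded_support mk k0 (mK n) (nuK n) (kap0 n) (@kK n) q'0 c0.
exists b => x; have := Hb _ mg gc gK x; have := sqfun_ge0 nu k0 q' g x.
have : (\1_(B n) x)%:E <= 1%:E :> \bar R.
  by rewrite lee_fin indicE; case: (_ \in _); rewrite ?ler01 ?lexx.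
move=> B1 S0 Sb; have : sqfun q' g x <= b%:E.
  by rewrite (le_trans Sb)// -[leRHS]mule1 lee_wpmul2l.
move: S0; case: (sqfun q' g x) => // y; rewrite !lee_fin => y0 yb.
by exists y => //; rewrite y0.
Qed.

Lemma dual_weight_bounded e : (0 < e)%R -> exists2 c' : R, (0 <= c')%R &
  forall x, 0 <= dual_weight g e x <= c'%:E.
Proof.
move=> e0; have [b Hb] := sqfun_fin.
have [c' Hc'] := bounded_powR_itv b ((p' - q') / q') e0.
exists (Num.max c' 0)%R; first by rewrite le_max lexx orbT.
move=> x; rewrite dual_weight_ge0/= /dual_weight patchE.
case: ifPn => [|_]; last by rewrite lee_fin le_max lexx orbT.
rewrite inE /=; have [y /andP[y0 yb] ->] := Hb x; rewrite lte_fin => ey.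
by rewrite lee_fin le_max Hc'// ey.
Qed.

Lemma energy_g_fin : energy p' q' g < +oo.
Proof. exact: (energy_bounded_support mk k0 (mK n) (mB n) (nuK n) (muB n) (kap0 n) (@kK n) p'0 q'0 c0 mg gc gK). Qed.

Let phi e := test_fun mu k q' (dual_weight g e) g.

Lemma phi_bounded e : (0 < e)%R -> exists2 c' : R, (0 <= c')%R &
  forall z, 0 <= phi e z <= c'%:E.
Proof.
move=> e0; have [c' c'0 Hc'] := dual_weight_bounded e0.
exists (c `^ (q' - 1) * c')%R; first by rewrite mulr_ge0// powR_ge0.
move=> z; rewrite test_fun_ge0//=; last by move=> x; exact: dual_weight_ge0.
have q'1' : (0 <= q' - 1)%R by rewrite subr_ge0 ltW.
rewrite /phi /test_fun EFinM; apply: lee_pmul.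
- exact: poweR_ge0.
- by apply: avg_ge0 => // x; exact: dual_weight_ge0.
- by rewrite -poweR_EFin; apply: ge0_le_poweR => //; case/andP : (gc z).
have [Dz|zD] := pselect (D z); last by rewrite (avg_off mu kD)// lee_fin.
apply: (avg_bound mk k0 k1) => //; first exact: measurable_dual_weight.
  by move=> x; exact: dual_weight_ge0.
by move=> x; case/andP : (Hc' x).
Qed.

Lemma phi_support e z : g z = 0 -> phi e z = 0.
Proof. by move=> gz; rewrite /phi /test_fun gz poweR0r ?mul0e// subr_eq0 gt_eqF. Qed.

Lemma measurable_phi e : measurable_fun setT (phi e).
Proof.
apply: measurable_test_fun => //; first exact: measurable_dual_weight.
by move=> x; exact: dual_weight_ge0.
Qed.

Lemma phi_pairing e : (0 < e)%R -> \int[nu]_(z in D) (phi e z * g z) =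
  \int[mu]_x (((fun x => sqfun q' g x `^ (p' / q')) \_ [set x | e%:E < sqfun q' g x]) x).
Proof.
move=> e0; rewrite (test_fun_pairing mu nu mk k0 kD)//; last 2 first.
  exact: measurable_dual_weight.
  by move=> x; exact: dual_weight_ge0.
apply: eq_integral => x _; rewrite /dual_weight !patchE; case: ifPn => [|_]; last by rewrite mul0e.
rewrite inE/= => ey; have S0 : 0 < sqfun q' g x by apply: lt_trans ey; rewrite lte_fin.
have st : ((p' - q') / q' + 1 = p' / q')%R by field.
by rewrite -[X in _ * X]poweRe1 ?ltW// -poweRD ?st// add_neq0_poweRD_def// st gt_eqF// divr_gt0.
Qed.

End bounded_g.

(** The point is the order of quantifiers. [C] depends on neither the support nor the bound of [g]
    nor the cut-off [e], so all three can later be removed by limits. *)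
Lemma energy_phi_le : exists2 C : R, (0 <= C)%R &
  forall g n c e, measurable_fun setT g -> (forall z, 0 <= g z <= c%:E) ->
    (forall z, ~ K n z -> g z = 0) -> (0 < e)%R ->
    energy p q (test_fun mu k q' (dual_weight g e) g) <= C%:E * energy p' q' g.
Proof.
have mW := measurable_dual_weight; have W0 := dual_weight_ge0.
have g0 g c : (forall z, 0 <= g z <= c%:E) -> forall z : Z, 0 <= g z.
  by move=> gc z; case/andP : (gc z).
have Woo g n c e : measurable_fun setT g -> (forall z, 0 <= g z <= c%:E) ->
    (forall z, ~ K n z -> g z = 0) -> (0 < e)%R -> forall x, 0 <= dual_weight g e x < +oo.
  move=> mg gc gK e0 x; have [c' _ /(_ x)/andP[-> /=]] := dual_weight_bounded mg gc gK e0.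
  by move=> /le_lt_trans; apply; rewrite ltry.
have [pq|pq|pq] := ltgtP p q.
- have [C C0 HC] := energy_test_fun_lt nu mk k0 HLk p1 p'1 pp' q1 q'1 qq' pq.
  exists C => // g n c e mg gc gK e0; apply: HC => //.
  + exact: mW.
  + exact: (Woo _ _ _ _ mg gc gK).
  + exact: g0 gc.
  + exact: energy_g_fin gc gK.
  have q'p' : (q' < p')%R.
    have : (p'^-1 < q'^-1)%R.
      have : (q^-1 < p^-1)%R by rewrite ltf_pV2// posrE.
      by move: pp' qq'; lra.
    by rewrite ltf_pV2// posrE.
  have sn0 : (p' - q' != 0)%R by rewrite gt_eqF// subr_gt0.
  apply: ge0_le_integral => //.
  + by move=> x _; exact: poweR_ge0.
  + by apply: measurable_fun_poweR; exact: mW.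
  + by apply: measurable_fun_poweR; exact: measurable_sqfun.
  move=> x _; rewrite /dual_weight patchE; case: ifPn => _; last first.
    by rewrite poweR0r ?poweR_ge0// mulf_neq0// invr_eq0.
  rewrite -poweRrM le_eqVlt; apply/orP; left; apply/eqP; congr (_ `^ _).
  by field; rewrite sn0 q'n0.
- have [C C0 HC] := energy_test_fun_gt nu mk k0 kD k1 HLk p' p1 q1 q'1 qq' pq.
  exists C => // g n c e mg gc gK e0.
  (* The absorption argument requires the energy of the test function to be finite beforehand. It
     is, because this function is bounded and supported in [K n]. *)
  have [c1 c10 Hc1] := phi_bounded mg gc gK e0.
  have mphi : measurable_fun setT (test_fun mu k q' (dual_weight g e) g).
    exact: measurable_phi.
  have phiK z : ~ K n z -> test_fun mu k q' (dual_weight g e) g z = 0.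
    by move=> zK; apply: phi_support; exact: gK.
  apply: HC => //.
  + exact: mW.
  + exact: (Woo _ _ _ _ mg gc gK).
  + exact: g0 gc.
  + move=> x; rewrite /dual_weight patchE; case: ifPn => [|_]; last first.
      by rewrite poweR0r ?gt_eqF// mul0e poweR_ge0.
    rewrite inE/= => ex; have S0 : 0 < sqfun q' g x by apply: lt_trans ex; rewrite lte_fin.
    (* Multiplied by q' this reads (p' - q') * q + q' = q * (p' - 1) = p' * q / p. *)
    have st : ((p' - q') / q' * q + 1 = p' * q / (p * q'))%R.
      by rewrite pE qE; field; rewrite p'1n0 q'1n0 q'n0 p'n0.
    rewrite -st poweRD; last by rewrite add_neq0_poweRD_def// st gt_eqF// divr_gt0// mulr_gt0.
    by rewrite -poweRrM poweRe1// ltW.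
  + move=> x; have [b b0 Hb] := sqfun_bounded_support mk k0 (mK n) (nuK n) (kap0 n) (@kK n) q0 c10.
    apply: (le_lt_trans (Hb _ mphi Hc1 phiK x)).
    by rewrite -EFinM ltry.
  + exact: (energy_bounded_support mk k0 (mK n) (mB n) (nuK n) (muB n) (kap0 n) (@kK n) p0 q0 c10 mphi Hc1 phiK).
- exists 1%R => // g n c e mg gc gK e0; rewrite mul1e.
  apply: (energy_test_fun_eq nu mk k0 kD k1 p'1 pp' q1 q'1 qq' pq) => //.
  + exact: mW.
  + have p'q' : p' = q' by apply: invr_inj; move: pp' qq'; rewrite pq; lra.
    move=> x; rewrite W0 /dual_weight patchE p'q' subrr mul0r; case: ifPn => _ /=.
      by rewrite poweRe0. by rewrite lee_fin ler01.
  + exact: g0 gc.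
Qed.

(* By the last condition [phi * g] is bounded even if [g] is not, so that a functional defined
   on bounded functions supported in some [K n] can be tested. *)
Definition test_class (g phi : Z -> \bar R) (n : nat) :=
  [/\ measurable_fun setT phi, forall z, 0 <= phi z <= n%:R%:E,
      forall z, ~ K n z -> phi z = 0 & forall z, n%:R%:E < g z -> phi z = 0].

(** Testing with the cut-off function and letting [e] tend to 0 gives I <= M * (C * I)^(1/p) for I =
    [energy p' q' g]. As I is finite, absorption yields I^(1/p') <= C^(1/p) * M. Only test functions
    that vanish where [g] does are used, and the truncation argument for unbounded [g] relies on
    this. *)
Lemma bounded_dual_bound : exists2 C : R, (0 <= C)%R &
  forall (M : R) g n c, (0 <= M)%R ->
    measurable_fun setT g -> (forall z, 0 <= g z <= c%:E) ->
    (forall z, ~ K n z -> g z = 0) ->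
    (forall phi m, test_class g phi m -> (forall z, g z = 0 -> phi z = 0) ->
       \int[nu]_(z in D) (phi z * g z) <= M%:E * energy p q phi `^ p^-1) ->
  energy p' q' g `^ p'^-1 <= (C * M)%:E.
Proof.
have [C C0 HC] := energy_phi_le; exists (C `^ p^-1)%R; first exact: powR_ge0.
move=> M g n c M0 mg gc gK Hg; set I := energy p' q' g.
have I0 : 0 <= I by exact: energy_ge0.
have Ioo : I < +oo by exact: energy_g_fin gc gK.
pose f e := (fun x => sqfun q' g x `^ (p' / q')) \_ [set x | e%:E < sqfun q' g x].
have step e : (0 < e)%R -> \int[mu]_x f e x <= M%:E * (C%:E * I) `^ p^-1.
  move=> e0; have [c1 c10 Hc1] := phi_bounded mg gc gK e0.
  (* Large enough for the support of the test function to lie in [K m], for the test function to be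
     at most m, and for no point to satisfy g > m. *)
  pose m := maxn n (Num.truncn (Num.max c c1)).+1.
  have lem (y : R) : (y <= c)%R || (y <= c1)%R -> (y <= m%:R)%R.
    move=> y1; have : (y <= Num.max c c1)%R by rewrite le_max.
    move=> /le_trans; apply; apply: (@le_trans _ _ (Num.truncn (Num.max c c1)).+1%:R).
      by rewrite ltW// truncnS_gt.
    by rewrite ler_nat leq_maxr.
  rewrite -(phi_pairing mg gc e0).
  have := Hg (test_fun mu k q' (dual_weight g e) g) m.
  move=> /(_ _ _)/le_trans; apply.
  - split.
    + exact: measurable_phi.
    + move=> z; have /andP[-> h] := Hc1 z; apply: (le_trans h).
      by rewrite lee_fin lem// lexx orbT.
    + move=> z zK; apply: phi_support; apply: gK; apply: contra_not zK.
      by apply/subsetPset; apply: ndK; exact: leq_maxl.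
    + move=> z; rewrite ltNge; have /andP[_ h] := gc z.
      by rewrite (le_trans h)// lee_fin lem// lexx.
  - by move=> z; exact: phi_support.
  - rewrite lee_wpmul2l ?lee_fin//; apply: ge0_le_poweR.
    + by rewrite invr_ge0 ltW.
    + exact: energy_ge0.
    + exact: HC gc gK e0.
have mS := measurable_sqfun nu mk k0 q' mg.
have H : I <= M%:E * (C%:E * I) `^ p^-1.
  (* The cut-offs 1 / (j + 1) decrease to 0, so the integrands increase; where [sqfun q' g] is 0
     both they and the limit are 0. *)
  have : (fun j : nat => \int[mu]_x f j.+1%:R^-1%R x) @ \oo --> I.
    apply: ge0_cvg_integral => //.
    - move=> j; apply/(measurable_restrictT _ _).1; last first.
        by apply: measurable_funTS; exact: measurable_fun_poweR.
      by rewrite -[X in measurable X]setTI; exact: emeasurable_fun_o_infty.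
    - by move=> j x; rewrite /f patchE; case: ifPn => // _; exact: poweR_ge0.
    - move=> x i j ij; rewrite /f !patchE; case: ifPn => [|_]; last first.
        by case: ifPn => // _; exact: poweR_ge0.
      rewrite inE /= => h; rewrite ifT// inE/=; apply: le_lt_trans h.
      by rewrite lee_fin lef_pV2 ?posrE// ler_nat.
    - move=> x; have [S0|S0] := eqVneq (sqfun q' g x) 0.
        rewrite S0 poweR0r; last by rewrite mulf_neq0// invr_eq0.
        rewrite (_ : (fun _ => _) = cst 0); first exact: cvg_cst.
        apply/funext => j; rewrite /f patchE ifF//; apply/negbTE; rewrite notin_setE/=.
        by rewrite S0 lte_fin; apply/negP; rewrite -leNgt invr_ge0.
      have Sgt0 : 0 < sqfun q' g x by rewrite lt0e S0 sqfun_ge0.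
      have [b Hb] := sqfun_fin mg gc gK; have [y _ Sy] := Hb x.
      have y0 : (0 < y)%R by move: Sgt0; rewrite Sy lte_fin.
      apply: cvg_near_cst; near=> j; rewrite /f patchE ifT// inE/= Sy lte_fin.
      by near: j; exact: near_infty_natSinv_lt (PosNum y0).
  move=> cI; rewrite -[leLHS](cvg_lim _ cI)//; apply: lime_le; first by apply/cvg_ex; exists I.
  by apply: nearW => j; apply: step.
have A0 : 0 <= M%:E * (C `^ p^-1)%:E by rewrite mule_ge0// lee_fin powR_ge0.
have := @poweR_absorb _ I (M%:E * (C `^ p^-1)%:E) p p' A0 I0 Ioo p0 p'0 pp'.
rewrite -muleA -poweR_EFin -poweRM ?lee_fin// => /(_ H) HI.
rewrite -[leRHS](@poweRK _ _ p')// ?lee_fin ?mulr_ge0 ?powR_ge0//.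
apply: ge0_le_poweR => //; first by rewrite invr_ge0 ltW.
by rewrite (le_trans HI)// poweR_EFin -EFinM mulrC.
Unshelve. all: by end_near. Qed.

Definition truncation (g : Z -> \bar R) (m : nat) : Z -> \bar R :=
  g \_ (K m `&` [set z | g z <= m%:R%:E]).

Lemma truncationE g m z : truncation g m z = g z \/ truncation g m z = 0.
Proof. by rewrite /truncation patchE; case: ifPn => _; [left|right]. Qed.

Lemma truncation_sub g m z : truncation g m z != 0 -> K m z /\ g z <= m%:R%:E.
Proof.
rewrite /truncation patchE; case: ifPn => [|_]; first by rewrite inE.
by rewrite eqxx.
Qed.

Lemma measurable_truncation g m : measurable_fun setT g ->
  measurable_fun setT (truncation g m).
Proof.
move=> mg; apply/(measurable_restrictT _ _).1; last exact: measurable_funTS.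
apply: measurableI => //; rewrite -[X in measurable X]setTI.
exact: emeasurable_fun_infty_c.
Qed.

Lemma truncation_ge0 g m z : (forall z, 0 <= g z) -> 0 <= truncation g m z.
Proof. by move=> g0; rewrite /truncation patchE; case: ifPn. Qed.

Lemma truncation_le g m z : (forall z, 0 <= g z) -> truncation g m z <= m%:R%:E.
Proof.
move=> g0; have [->|/truncation_sub [_ h]] := eqVneq (truncation g m z) 0.
  by rewrite lee_fin.
by have [->|->] := truncationE g m z => //; rewrite lee_fin.
Qed.

Lemma truncation_nd g z : (forall z, 0 <= g z) -> nondecreasing_seq (truncation g ^~ z).
Proof.
move=> g0 i j ij; rewrite /truncation !patchE; case: ifPn => [|_]; last first.
  by case: ifPn.
rewrite inE => -[/= Kz gz]; rewrite ifT// inE; split => /=.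
  by move: Kz; apply/subsetPset; exact: ndK.
by rewrite (le_trans gz)// lee_fin ler_nat.
Qed.

Lemma truncation_near g z : (forall z, 0 <= g z) -> D z -> g z < +oo ->
  \forall m \near \oo, truncation g m z = g z.
Proof.
move=> g0; rewrite -KD => -[n _ Kz] goo.
have gf : g z \is a fin_num by rewrite ge0_fin_numE.
near=> m; rewrite /truncation patchE ifT// inE; split => /=.
  have nm : (n <= m)%N by near: m; exact: nbhs_infty_ge.
  by move: Kz; apply/subsetPset; exact: ndK.
rewrite -(fineK gf) lee_fin; near: m; exists (Num.truncn (fine (g z))).+1 => // m /= nm.
by rewrite (le_trans (ltW (truncnS_gt _)))// ler_nat.
Unshelve. all: by end_near. Qed.

(** The truncations increase to [g] on [D]. A function that vanishes where a truncation does has the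
    same pairing with the truncation as with [g], so the hypothesis passes to every truncation with
    the same [M], and monotone convergence finishes. *)
Lemma dual_bound : exists2 C : R, (0 <= C)%R &
  forall (M : R) g, (0 <= M)%R ->
    measurable_fun setT g -> (forall z, 0 <= g z) -> (forall z, D z -> g z < +oo) ->
    (forall phi m, test_class g phi m ->
       \int[nu]_(z in D) (phi z * g z) <= M%:E * energy p q phi `^ p^-1) ->
  energy p' q' g `^ p'^-1 <= (C * M)%:E.
Proof.
have [C C0 HC] := bounded_dual_bound; exists C => // M g M0 mg g0 goo Hg.
have mt m := measurable_truncation m mg.
have t0 m z := truncation_ge0 m z g0.
have tE m : energy p' q' (truncation g m) `^ p'^-1 <= (C * M)%:E.
  apply: (HC M (truncation g m) m m%:R%R) => //.
  - by move=> z; rewrite t0 truncation_le.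
  - move=> z zK; have [//|/truncation_sub[]//] := eqVneq (truncation g m z) 0.
  - move=> phi n [mphi phin phiK phig] phi0.
    have -> : \int[nu]_(z in D) (phi z * truncation g m z) =
              \int[nu]_(z in D) (phi z * g z).
      apply: eq_integral => z _; have [->//|tz] := truncationE g m z.
      by rewrite phi0// !mul0e.
    (* Where g > n, either the truncation equals [g] and so exceeds n, or it is 0; in both cases
       [phi] vanishes. *)
    apply: (Hg phi n); split => // z ngz.
    by have [tz|/phi0//] := truncationE g m z; apply: phig; rewrite tz.
have Em m : energy p' q' (truncation g m) <= (C * M)%:E `^ p'.
  rewrite -(@poweRVK _ (energy p' q' (truncation g m)) p')//; last exact: energy_ge0.
  by apply: ge0_le_poweR => //; [exact: ltW|exact: poweR_ge0].
have pq : (0 < p' / q')%R by rewrite divr_gt0.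
have tcvg z : D z -> truncation g ^~ z @ \oo --> g z.
  by move=> Dz; apply: cvg_near_cst; apply: truncation_near => //; exact: goo.
have cS x : (fun m => sqfun q' (truncation g m) x) @ \oo --> sqfun q' g x.
  apply: ge0_cvg_integral => //.
  - by move=> m; apply: emeasurable_funM; [exact: measurable_kernel_l|exact: measurable_fun_poweR].
  - by move=> m z; rewrite mule_ge0// poweR_ge0.
  - move=> z i j ij; rewrite lee_wpmul2l//; apply: ge0_le_poweR => //; first exact: ltW.
    exact: (@truncation_nd g z g0 i j ij).
  - move=> z; have [Dz|zD] := pselect (D z); last first.
      by rewrite kD// mul0e; under eq_fun do rewrite mul0e; exact: cvg_cst.
    apply: cvg_near_cst; apply: filterS (truncation_near g0 Dz (goo _ Dz)).
    by move=> m ->.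
have cE : (fun m => energy p' q' (truncation g m)) @ \oo --> energy p' q' g.
  apply: ge0_cvg_integral.
  - by move=> m; apply: measurable_fun_poweR; exact: measurable_sqfun.
  - by move=> m x; exact: poweR_ge0.
  - move=> x i j ij; apply: ge0_le_poweR; [exact: ltW|exact: sqfun_ge0|].
    apply: (le_sqfun _ mk k0 kD) => // z _; exact: (@truncation_nd g z g0 i j ij).
  - move=> x; apply: nondecreasing_cvg_poweR => //.
    + by move=> m; exact: sqfun_ge0.
    + move=> i j ij; apply: (le_sqfun _ mk k0 kD) => // z _; exact: (@truncation_nd g z g0 i j ij).
rewrite -[leRHS](@poweRK _ _ p')// ?lee_fin ?mulr_ge0//.
apply: ge0_le_poweR; [by rewrite invr_ge0 ltW|exact: energy_ge0|].
rewrite -[leLHS](cvg_lim _ cE)//; apply: lime_le; first by apply/cvg_ex; eexists; exact: cE.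
by apply: nearW => j; exact: Em.
Qed.

End dual_norm_bound.

(** * Modulus, real part and imaginary part *)

Section complex_modulus.
Context (R : realType).
Implicit Types x y : R[i].
Local Notation cabs := (@Normc.normc R).

Lemma normc_ge0 x : 0 <= cabs x.
Proof. by case: x => a b; exact: sqrtr_ge0. Qed.

Lemma normc_Re x : `|complex.Re x| <= cabs x.
Proof.
case: x => a b /=; rewrite -sqrtr_sqr ler_sqrt ?addr_ge0 ?sqr_ge0//.
by rewrite lerDl sqr_ge0.
Qed.

Lemma normc_Im x : `|complex.Im x| <= cabs x.
Proof.
case: x => a b /=; rewrite -sqrtr_sqr ler_sqrt ?addr_ge0 ?sqr_ge0//.
by rewrite lerDr sqr_ge0.
Qed.

Lemma normc_le_ReIm x : cabs x <= `|complex.Re x| + `|complex.Im x|.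
Proof.
case: x => a b /=; rewrite -[leRHS]ger0_norm ?addr_ge0// -sqrtr_sqr ler_sqrt ?sqr_ge0//.
rewrite -(real_normK (num_real a)) -(real_normK (num_real b)) sqrrD.
by rewrite addrAC lerDl mulrn_wge0// mulr_ge0.
Qed.

Lemma normc_conj x : cabs (x^*)%C = cabs x.
Proof. by case: x => a b /=; rewrite sqrrN. Qed.

Lemma normc_realE (a : R) : cabs (a%:C)%C = `|a|.
Proof. by rewrite /= expr0n/= addr0 sqrtr_sqr. Qed.

Lemma Re_addc x y : complex.Re (x + y) = complex.Re x + complex.Re y.
Proof. by case: x y => [a b] [c e]. Qed.

Lemma Im_addc x y : complex.Im (x + y) = complex.Im x + complex.Im y.
Proof. by case: x y => [a b] [c e]. Qed.

Lemma Re_subc x y : complex.Re (x - y) = complex.Re x - complex.Re y.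
Proof. by case: x y => [a b] [c e]. Qed.

Lemma Im_subc x y : complex.Im (x - y) = complex.Im x - complex.Im y.
Proof. by case: x y => [a b] [c e]. Qed.

Lemma Re_mulc x y : complex.Re (x * y) = complex.Re x * complex.Re y - complex.Im x * complex.Im y.
Proof. by case: x y => [a b] [c e]. Qed.

Lemma Im_mulc x y : complex.Im (x * y) = complex.Re x * complex.Im y + complex.Im x * complex.Re y.
Proof. by case: x y => [a b] [c e]. Qed.

Lemma Re_conjc x : complex.Re (x^*)%C = complex.Re x.
Proof. by case: x. Qed.

Lemma Im_conjc x : complex.Im (x^*)%C = - complex.Im x.
Proof. by case: x. Qed.

Lemma complex_eq x y : complex.Re x = complex.Re y -> complex.Im x = complex.Im y -> x = y.
Proof. by case: x y => [a b] [c e] /= -> ->. Qed.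

End complex_modulus.

(** * Measurability of complex-valued functions *)

Section complex_measurable.
Context (R : realType) d (T : measurableType d) (D : set T).
Implicit Types f g : T -> R[i].
Local Notation cabs := (@Normc.normc R).

Lemma cmeasurable_funD f g : cmeasurable_fun D f -> cmeasurable_fun D g ->
  cmeasurable_fun D (fun z => f z + g z).
Proof.
move=> [f1 f2] [g1 g2]; split.
- by under eq_fun do rewrite Re_addc; exact: measurable_funD.
- by under eq_fun do rewrite Im_addc; exact: measurable_funD.
Qed.

Lemma cmeasurable_funM f g : cmeasurable_fun D f -> cmeasurable_fun D g ->
  cmeasurable_fun D (fun z => f z * g z).
Proof.
move=> [f1 f2] [g1 g2]; split.
- by under eq_fun do rewrite Re_mulc; apply: measurable_funB; exact: measurable_funM.
- by under eq_fun do rewrite Im_mulc; apply: measurable_funD; exact: measurable_funM.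
Qed.

Lemma cmeasurable_cst (a : R[i]) : cmeasurable_fun D (fun=> a).
Proof. by split; exact: measurable_cst. Qed.

Lemma cmeasurable_conj f : cmeasurable_fun D f -> cmeasurable_fun D (fun z => (f z)^*%C).
Proof.
move=> [f1 f2]; split; first by under eq_fun do rewrite Re_conjc.
by under eq_fun do rewrite Im_conjc; exact: measurableT_comp.
Qed.

Lemma cmeasurable_real (u : T -> R) : measurable_fun D u -> cmeasurable_fun D (fun z => (u z)%:C%C).
Proof. by move=> mu; split => //=; exact: measurable_cst. Qed.

Lemma measurable_normc f : cmeasurable_fun D f -> measurable_fun D (fun z => cabs (f z)).
Proof.
move=> [f1 f2].
have -> : (fun z => cabs (f z)) = (fun z => (complex.Re (f z) ^+ 2 + complex.Im (f z) ^+ 2) `^ 2^-1).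
  by apply/funext => z; case: (f z) => a b /=; rewrite powR12_sqrt// addr_ge0// sqr_ge0.
apply: (measurableT_comp (measurable_powR _)).
by apply: measurable_funD; exact: measurable_funX.
Qed.

End complex_measurable.

(** * Balls and distances in a Borel metric space *)

Section borel_metric_spaces.
Context (R : realType) (d : measure_display) (X : borelMetricType R d).

Lemma metric_ball_open (x : X) (r : R) : open (ball x r).
Proof.
rewrite openE => y; rewrite ballEmdist /= => xy.
apply/nbhs_ballP; exists (r - mdist x y) => /=; first by rewrite subr_gt0.
move=> z; rewrite !ballEmdist /= ltrBrDl; apply: le_lt_trans.
exact: metric_triangle.
Qed.

Lemma open_borel_measurable (A : set X) : open A -> measurable A.
Proof. by move=> oA; rewrite measurable_borelE; exact: sub_sigma_algebra. Qed.

Lemma measurable_metric_ball (x : X) (r : R) : measurable (ball x r).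
Proof. exact/open_borel_measurable/metric_ball_open. Qed.

Lemma measurable_mdist (x : X) : measurable_fun setT (mdist x : X -> R).
Proof.
apply: (measurability _ (RGenInftyO.measurableE R)) => //.
move=> /= _ [_ [r ->] <-]; rewrite setTI.
have -> : mdist x @^-1` `]-oo, r[ = ball x r; last exact: measurable_metric_ball.
by rewrite ballEmdist; apply/seteqP; split => y /=; rewrite in_itv.
Qed.

End borel_metric_spaces.

(** * Separability from positive finite volumes *)

Section separability.
Local Open Scope ereal_scope.
Context (R : realType) (d : measure_display) (X : borelMetricType R d).
Variable mu : {measure set X -> \bar R}.
Hypothesis vol_fin : forall (x : X) (r : R), (0 < r)%R -> 0 < vol mu x r < +oo.

Lemma bigcup_ball (x : X) : \bigcup_n ball x (n%:R : R) = setT.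
Proof.
apply/seteqP; split => // y _; exists (Num.truncn (mdist x y)).+1 => //.
by rewrite ballEmdist /= truncnS_gt.
Qed.

(** Sort the centres by a ball of radius n around the base point that contains them and by a lower
    bound 1 / (m + 1) for the measure of their own ball. Each class is finite, because its disjoint
    balls all lie in one ball of finite measure. *)
Lemma disjoint_balls_countable (A : set X) (e : R) : (0 < e)%R ->
  trivIset A (fun x => ball x e) -> countable A.
Proof.
move=> e0 tA.
pose F (w : nat * nat) := A `&` [set x | ball point w.1%:R x /\ (w.2.+1%:R^-1)%:E < mu (ball x e)].
have -> : A = \bigcup_(w in setT) F w.
  apply/seteqP; split => [x Ax|x [w _ []]//].
  have : setT x by [].
  rewrite -(bigcup_ball point) => -[n _ nx].
  have /andP[v0 voo] := vol_fin x e0.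
  have vf : vol mu x e \is a fin_num by rewrite ge0_fin_numE// ltW.
  exists (n, Num.truncn (fine (vol mu x e))^-1) => //; split => //=; split => //.
  rewrite -/(vol mu x e) -(fineK vf) lte_fin invf_plt ?posrE// ?truncnS_gt//.
  by rewrite fine_gt0// v0.
apply: bigcup_countable => // -[n m] _.
apply: finite_set_countable; apply: contrapT => /infiniteP/pcard_leP[f].
have fF i : F (n, m) (f i) by exact: funS.
have tB : trivIset setT (fun i => ball (f i) e).
  move=> i j _ _ /(tA _ _ (proj1 (fF i)) (proj1 (fF j))) /inj; apply; exact: in_setT.
have mB i : measurable (ball (f i) e) by exact: measurable_metric_ball.
have sub : \bigcup_i ball (f i) e `<=` ball point (n%:R + e)%R.
  move=> y [i _ iy]; have [_ [/= h _]] := fF i.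
  exact: ball_triangle h iy.
have ne0 : (0 < n%:R + e)%R by rewrite ltr_wpDl.
have /andP[_ voo] := vol_fin point ne0.
have : mu (\bigcup_i ball (f i) e) <= vol mu point (n%:R + e)%R.
  apply: le_measure sub; rewrite inE; first exact: bigcup_measurable.
  exact: measurable_metric_ball.
have -> : mu (\bigcup_i ball (f i) e) = \sum_(i <oo | i \in setT) mu (ball (f i) e).
  by apply: measure_bigcup.
pose c : R := (m.+1%:R^-1)%R.
have c0 : (0 < c)%R by rewrite invr_gt0.
have vf : vol mu point (n%:R + e)%R \is a fin_num by rewrite ge0_fin_numE.
(* So many disjoint balls of measure more than c that their total exceeds the volume of the ball
   containing them. *)
pose N := (Num.truncn (fine (vol mu point (n%:R + e)) / c)).+1.
apply/negP; rewrite -ltNge; apply: (@lt_le_trans _ _ (\sum_(0 <= i < N) mu (ball (f i) e))).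
  apply: (@lt_le_trans _ _ (\sum_(0 <= i < N) c%:E)).
    rewrite sumEFin big_const_nat subn0 iter_addr_0 -(fineK vf) lte_fin.
    by rewrite -(mulr_natr c) (mulrC c) -ltr_pdivrMr// truncnS_gt.
  by apply: lee_sum => i _; apply: ltW; have [_ []] := fF i.
rewrite (eq_eseriesl (Q := xpredT)); last by move=> i; exact: in_setT.
by apply: nneseries_lim_ge => i _ _; exact: measure_ge0.
Qed.

(** A maximal family of disjoint balls of radius 1 / (j + 1) is countable. Every point is within 2 /
    (j + 1) of some centre, since otherwise its own ball could be added to the family. The sequence
    enumerates the centres for all j. *)
Lemma exists_dense_sequence : exists s : nat -> X,
  forall x (e : R), (0 < e)%R -> exists n, (mdist (s n) x < e)%R.
Proof.
have H (j : nat) : { A : set X | countable A /\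
    forall x, exists2 a, A a & (mdist a x < 2 * j.+1%:R^-1)%R}.
  have [A [_ tA maxA]] := ex_maximal_disjoint_subcollection (fun x : X => ball x (j.+1%:R^-1 : R)) setT.
  exists A; split; first exact: disjoint_balls_countable tA.
  move=> x; apply: contrapT => nx.
  have far a : A a -> (2 * j.+1%:R^-1 <= mdist a x)%R.
    by move=> Aa; rewrite leNgt; apply/negP => ax; apply: nx; exists a.
  have j0 : (0 < j.+1%:R^-1 :> R)%R by rewrite invr_gt0.
  have disj a : A a -> ball a (j.+1%:R^-1 : R) `&` ball x (j.+1%:R^-1 : R) = set0.
    move=> /far h; apply/seteqP; split => // y []; rewrite !ballEmdist /= => ay xy.
    have tri : (mdist a x <= mdist a y + mdist x y)%R.
      by rewrite (metric_sym x y); exact: metric_triangle.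
    move: h; rewrite mulr_natl mulr2n => h.
    by have := lt_le_trans (le_lt_trans tri (ltrD ay xy)) h; rewrite ltxx.
  have nAx : ~ A x.
    move=> /far; rewrite mdistxx leNgt => /negP; apply; exact: mulr_gt0.
    apply: (maxA (x |` A) _ (@subsetT _ _)).
    split; first by move=> a Aa; right.
    by move=> xAA; apply/nAx/xAA; left.
  move=> a b [->|Aa] [->|Ab] //.
  - by rewrite setIC disj// => /set0P; rewrite eqxx.
  - by rewrite disj// => /set0P; rewrite eqxx.
  - exact: tA.
pose A := \bigcup_j sval (H j).
have cA : countable A by apply: bigcup_countable => // j _; have [] := svalP (H j).
have A0 : A !=set0.
  by have [_ /(_ point)[a Aa _]] := svalP (H 0%N); exists a; exists 0%N.
have [s sA] : exists s : nat -> X, A `<=` range s.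
  have /pfcard_geP[A00|[s]] := cA; first by move: A0; rewrite A00 => -[].
  by exists s => a Aa; have [n _ <-] := 'surj_s Aa; exists n.
exists s => x e e0.
have [j je] : exists j : nat, (2 * j.+1%:R^-1 < e)%R.
  exists (Num.truncn (2 / e)); rewrite ltr_pdivrMr// mulrC -ltr_pdivrMr//.
  exact: truncnS_gt.
have [_ /(_ x)[a Aa ax]] := svalP (H j).
have /sA[n _ sn] : A a by exists j.
by exists n; rewrite sn (lt_trans ax).
Qed.

End separability.

(** * Sigma-finiteness of the measures on X and X^+ *)

Section sigma_finite_wrapper.
Context (R : realType) (d : measure_display) (T : measurableType d).
Variables (mu : {measure set T -> \bar R}) (h : sigma_finite setT mu).

(* [mu] itself, repackaged with the proof [h] as a sigma-finite measure. *)
Definition sigma_finite_wrap of sigma_finite setT mu : set T -> \bar R := mu.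

Let wrap := sigma_finite_wrap h.

HB.instance Definition _ := isMeasure.Build _ _ _ wrap
  (measure0 mu) (measure_ge0 mu) (@measure_semi_sigma_additive _ _ _ mu).

HB.instance Definition _ := Measure_isSigmaFinite.Build _ _ _ wrap h.

End sigma_finite_wrapper.

Lemma product_sigma_finite (R : realType) (d1 d2 : measure_display)
    (T1 : measurableType d1) (T2 : measurableType d2)
    (m1 : {sigma_finite_measure set T1 -> \bar R})
    (m2 : {sigma_finite_measure set T2 -> \bar R}) :
  sigma_finite setT (m1 \x m2)%E.
Proof.
have /sigma_finiteP[F [FT ndF Foo]] := sigma_finiteT m1.
have /sigma_finiteP[G [GT ndG Goo]] := sigma_finiteT m2.
exists (fun n => F n `*` G n).
  apply/seteqP; split => // -[x y] _.
  have : setT x by []. have : setT y by [].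
  rewrite {1}GT FT => -[n _ ny] [m _ mx]; exists (maxn n m) => //; split => /=.
    by move: mx; apply/subsetPset; apply: ndF; exact: leq_maxr.
  by move: ny; apply/subsetPset; apply: ndG; exact: leq_maxl.
move=> n; have [mF Fn] := Foo n; have [mG Gn] := Goo n.
split; first exact: measurableX.
by rewrite product_measure1E// lte_mul_pinfty// ge0_fin_numE.
Qed.

(** * The kernel of the tent spaces *)

Section tent_kernel.
Local Open Scope ereal_scope.
Context (R : realType) (d : measure_display) (X : borelMetricType R d).
Variable mu : {measure set X -> \bar R}.
Hypothesis vol_fin : forall (x : X) (r : R), (0 < r)%R -> 0 < vol mu x r < +oo.
Variable alpha : R.
Hypothesis alpha0 : (0 < alpha)%R.

Lemma mu_sigma_finite : sigma_finite setT mu.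
Proof.
exists (fun n => ball point (n.+1%:R : R)).
  apply/seteqP; split => // y _; exists (Num.truncn (mdist point y)) => //.
  by rewrite ballEmdist /= truncnS_gt.
move=> n; split; first exact: measurable_metric_ball.
by have /andP[] := @vol_fin point n.+1%:R (ltr0Sn _ _).
Qed.

Definition sfmu : {sigma_finite_measure set X -> \bar R} :=
  sigma_finite_wrap mu_sigma_finite.

(* Convertible to [muplus mu], but with a sigma-finiteness instance. *)
Definition sfnu : {sigma_finite_measure set (X * R)%type -> \bar R} :=
  sigma_finite_wrap (product_sigma_finite sfmu (@dt_over_t R)).

Definition cone_graph : set (X * (X * R))%type :=
  [set w | (0 < w.2.2)%R /\ (mdist w.1 w.2.1 < alpha * w.2.2)%R].

Lemma measurable_Xplus : measurable (@Xplus R d X).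
Proof.
have -> : @Xplus R d X = setT `&` (snd @^-1` `]0%R, +oo[).
  by apply/seteqP; split => [[x t]|[x t] []] /=; rewrite in_itv/= andbT.
exact: (@measurable_snd _ _ X R measurableT _ (measurable_itv `]0%R, +oo[)).
Qed.

(** Along a dense sequence, d(x, y) < alpha * t holds iff d(s n, x) + d(s n, y) < alpha * t for some
    n. This exhibits the set as a countable union of sets measurable for the product
    sigma-algebra. *)
Lemma measurable_cone_graph : measurable cone_graph.
Proof.
have [s sd] := exists_dense_sequence vol_fin.
have -> : cone_graph = (snd @^-1` (@Xplus R d X)) `&`
    \bigcup_n [set w : X * (X * R) |
       (mdist (s n) w.1 + mdist (s n) w.2.1)%:E < (alpha * w.2.2)%:E].
  apply/seteqP; split => [[x [y t]] [/= t0 xy]|[x [y t]] [/= t0 [n _ /= h]]].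
    (* Half of the slack, since d(s n, x) + d(s n, y) is bounded by 2 * d(s n, x) + d(x, y). *)
    split => //; have e0 : (0 < (alpha * t - mdist x y) / 2)%R by rewrite divr_gt0// subr_gt0.
    have [n nx] := sd x _ e0; exists n => //=; rewrite lte_fin.
    have tri : (mdist (s n) y <= mdist (s n) x + mdist x y)%R by exact: metric_triangle.
    apply: (@le_lt_trans _ _ (mdist (s n) x + (mdist (s n) x + mdist x y))%R); first by rewrite lerD2l.
    by move: nx; lra.
  split => //=; move: h; rewrite lte_fin; apply: le_lt_trans.
  by rewrite (metric_sym (s n) x); exact: metric_triangle.
apply: measurableI.
  by rewrite -[X in measurable X]setTI; apply: measurable_snd => //; exact: measurable_Xplus.
apply: bigcup_measurable => n _; rewrite -[X in measurable X]setTI.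
apply: measurable_lte => //; apply/measurable_EFinP.
  apply: measurable_funD.
    exact: (measurableT_comp (measurable_mdist (s n))).
  apply: (measurableT_comp (measurable_mdist (s n))) => //=.
  exact: (measurableT_comp measurable_fst measurable_snd).
apply: measurable_funM => //.
exact: (measurableT_comp measurable_snd measurable_snd).
Qed.

(** The volume V(y, alpha * t), encoded as the measure of a section so that its joint measurability
    in (y, t) follows from that of [cone_graph]. *)
Definition pvol (z : X * R) : \bar R := mu (ysection cone_graph z).

Lemma ysection_cone_graph z : (0 < z.2)%R -> ysection cone_graph z = ball z.1 (alpha * z.2)%R.
Proof.
move=> z0; rewrite ballEmdist; apply/seteqP; split => x /=.
  by rewrite ysectionE /= => -[_ /=]; rewrite metric_sym.
by rewrite ysectionE /= => h; split => //=; rewrite metric_sym.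
Qed.

Lemma pvolE z : (0 < z.2)%R -> pvol z = vol mu z.1 (alpha * z.2)%R.
Proof. by move=> z0; rewrite /pvol ysection_cone_graph. Qed.

Lemma pvol_off z : ~ (0 < z.2)%R -> pvol z = 0.
Proof.
move=> z0; rewrite /pvol (_ : ysection _ _ = set0) ?measure0//.
by apply/seteqP; split => // x; rewrite ysectionE /= => -[].
Qed.

Lemma pvol_fin z : (0 < z.2)%R -> 0 < pvol z < +oo.
Proof. by move=> z0; rewrite pvolE//; apply: vol_fin; rewrite mulr_gt0. Qed.

Lemma measurable_pvol : measurable_fun setT pvol.
Proof.
exact: (@measurable_fun_ysection _ _ _ _ R sfmu _ measurable_cone_graph).
Qed.

(* The power [-1] equals the inverse on positive finite reals, and it is known to be measurable;
   at [t <= 0], where [pvol] is [0], the indicator vanishes. *)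
Definition kern (w : X * (X * R)) : \bar R :=
  (\1_cone_graph w)%:E * pvol w.2 `^ (-1).

Lemma measurable_kern : measurable_fun setT kern.
Proof.
apply: emeasurable_funM.
  by apply/measurable_EFinP; apply: measurable_indic; exact: measurable_cone_graph.
apply: measurable_fun_poweR.
exact: (measurableT_comp measurable_pvol measurable_snd).
Qed.

Lemma kern_ge0 w : 0 <= kern w.
Proof. by rewrite mule_ge0// ?poweR_ge0// lee_fin. Qed.

Lemma pvol_lty z : pvol z < +oo.
Proof.
have [z0|z0] := pselect (0 < z.2)%R; first by case/andP : (pvol_fin z0).
by rewrite pvol_off.
Qed.

Lemma kern_lty w : kern w < +oo.
Proof. by rewrite lte_mul_pinfty ?lee_fin// poweR_lty// pvol_lty. Qed.

Lemma kern_off x z : ~ Xplus z -> kern (x, z) = 0.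
Proof.
move=> z0; rewrite /kern indicE memNset ?mul0e// => -[/= h _]; exact: z0.
Qed.

Lemma poweRN1 (x : \bar R) : 0 < x < +oo -> x `^ (-1) = x^-1.
Proof.
case: x => [x /andP[x0 _]|/andP[_]|/andP[]]; [|by rewrite ltxx|by []].
rewrite lte_fin in x0.
by rewrite poweR_EFin powR_inv1 ?ltW// inver gt_eqF.
Qed.

Lemma kernE x z : Xplus z ->
  kern (x, z) = (\1_(ball z.1 (alpha * z.2)%R) x)%:E / vol mu z.1 (alpha * z.2)%R.
Proof.
move=> z0; rewrite /kern /= poweRN1 ?pvol_fin// pvolE//; congr (_%:E * _).
rewrite !indicE; congr (nat_of_bool _)%:R; rewrite -ysection_cone_graph//.
by rewrite mem_ysection.
Qed.

Lemma kern_markov z : Xplus z -> \int[mu]_x kern (x, z) = 1.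
Proof.
move=> z0; have /andP[v0 voo] := pvol_fin z0.
under eq_integral do rewrite kernE//.
rewrite ge0_integralZr//; last 2 first.
- by apply/measurable_EFinP; apply: measurable_indic; exact: measurable_metric_ball.
- by rewrite inve_ge0.
rewrite integral_indic//; last exact: measurable_metric_ball.
rewrite setIT -/(vol mu _ _) -pvolE// divee//; last first.
  by rewrite gt_eqF.
by rewrite ge0_fin_numE// ltW.
Qed.

End tent_kernel.

(** * Maximal functions, tent norms as energies, and the exhaustion of X^+ *)

Section tent_kernel_properties.
Local Open Scope ereal_scope.
Context (R : realType) (d : measure_display) (X : borelMetricType R d).
Variable mu : {measure set X -> \bar R}.
Hypothesis vol_fin : forall (x : X) (r : R), (0 < r)%R -> 0 < vol mu x r < +oo.
Variable alpha : R.
Hypothesis alpha0 : (0 < alpha)%R.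

Local Notation cabs := (@Normc.normc R).
Local Notation k := (kern mu alpha).

Lemma kern_neq0 x z : k (x, z) != 0 -> Xplus z /\ ball z.1 (alpha * z.2)%R x.
Proof.
have [z0|z0] := pselect (Xplus z); last by rewrite kern_off// eqxx.
rewrite (kernE vol_fin alpha0)// indicE; case: (boolP (x \in _)) => [|_]; first by rewrite inE.
by rewrite mul0e eqxx.
Qed.

Lemma HL_maximal_fun_ge0 f x : 0 <= HL_maximal_fun mu f x.
Proof.
apply: (@le_trans _ _ ((vol mu x 1)^-1 * \int[mu]_(y in ball x 1%R) (cabs (f y))%:E)).
  apply: mule_ge0; first by rewrite inve_ge0.
  by apply: integral_ge0 => y _; rewrite lee_fin; case: (f y) => a b; exact: sqrtr_ge0.
apply: ereal_sup_ubound; exists x, 1%R; split => //.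
exact: ballxx.
Qed.

(** The maximal function is lower semicontinuous because it is uncentred: a ball showing that it
    exceeds a at [x] shows the same at each of its points. *)
Lemma measurable_HL_maximal_fun f : measurable_fun setT (HL_maximal_fun mu f).
Proof.
apply: (measurability _ (ErealGenOInfty.measurableE R)).
move=> /= _ [_ [a ->]] <-; rewrite setTI; apply: open_borel_measurable.
rewrite openE => x /=; rewrite in_itv/= andbT => /ereal_sup_gt[_ [c [r [r0 cx ->]]] ha].
have : nbhs x (ball c r).
  by apply: open_nbhs_nbhs; split => //; exact: metric_ball_open.
apply: filterS => y cy; rewrite /= in_itv/= andbT; apply: (lt_le_trans ha).
by apply: ereal_sup_ubound; exists c, r.
Qed.

(** If z = (y, t) lies in the cone of [x], then B(y, alpha * t) contains [x] and competes in the
    supremum defining the maximal function at [x]. *)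
Lemma avg_kern_le (u : X -> \bar R) x z : measurable_fun setT u ->
  (forall x, 0 <= u x < +oo) -> k (x, z) != 0 ->
  kernel_avg (sfmu vol_fin) k u z <= HL_maximal_fun mu (fun x => (fine (u x))%:C%C) x.
Proof.
move=> mu' uoo /kern_neq0 [z0 zx].
have u0 y : 0 <= u y by case/andP : (uoo y).
have -> : kernel_avg (sfmu vol_fin) k u z = (vol mu z.1 (alpha * z.2)%R)^-1 *
    \int[mu]_(y in ball z.1 (alpha * z.2)%R) (cabs (fine (u y))%:C%C)%:E.
  rewrite integral_mkcond -ge0_integralZl//.
  - apply: eq_integral => y _; rewrite (kernE vol_fin alpha0)// patchE indicE.
    case: (boolP (y \in _)) => _; last by rewrite !mul0e mule0.
    rewrite mul1e normc_realE ger0_norm ?fine_ge0// fineK// ge0_fin_numE//.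
    by case/andP : (uoo y).
  - apply/(measurable_restrictT _ _).1; first exact: measurable_metric_ball.
    apply: measurable_funTS; apply/measurable_EFinP.
    rewrite (_ : (fun _ => _) = (fun y => fine (u y))); first exact: measurableT_comp.
    by apply/funext => y; rewrite normc_realE ger0_norm// fine_ge0.
  - move=> y _; rewrite patchE; case: ifPn => // _; rewrite lee_fin normc_realE//.
  - by rewrite inve_ge0.
apply: ereal_sup_ubound; exists z.1, (alpha * z.2)%R; split => //.
by rewrite mulr_gt0.
Qed.

Lemma kern_HL : HL_assumption mu -> averages_dominated (sfmu vol_fin) k.
Proof.
move=> HL r r1; have r0 : (0 < r)%R by exact: lt_trans r1.
have rn0 : (r != 0)%R by rewrite gt_eqF.
(* [HL] compares norms and does not say that its constant is nonnegative; the integrals of r-th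
   powers are compared with the r-th power of its positive part. *)
have [C HC] := HL r r1; exists (Num.max C 0 `^ r)%R; first exact: powR_ge0.
move=> u mu' uoo uroo.
have u0 y : 0 <= u y by case/andP : (uoo y).
have uf y : u y = (fine (u y))%:E.
  by rewrite fineK// ge0_fin_numE//; case/andP : (uoo y).
pose f x : R[i] := (fine (u x))%:C%C.
have Nf : 'N[mu]_r%:E[EFin \o (cabs \o f)] = (\int[mu]_x (u x `^ r)) `^ r^-1.
  rewrite unlock; congr (_ `^ _); apply: eq_integral => y _ /=.
  by rewrite expr0n/= addr0 sqrtr_sqr normr_id ger0_norm ?fine_ge0// -poweR_EFin -uf.
exists (HL_maximal_fun mu f); split.
- exact: measurable_HL_maximal_fun.
- by move=> x; exact: HL_maximal_fun_ge0.
- by move=> x z; exact: avg_kern_le.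
have -> : \int[mu]_x (HL_maximal_fun mu f x `^ r) = 'N[mu]_r%:E[HL_maximal_fun mu f] `^ r.
  by rewrite poweR_Lnorm//; apply: eq_integral => x _; rewrite gee0_abs// HL_maximal_fun_ge0.
have -> : (Num.max C 0 `^ r)%:E * \int[mu]_x (u x `^ r) =
    ((Num.max C 0)%:E * 'N[mu]_r%:E[EFin \o (cabs \o f)]) `^ r.
  rewrite poweRM ?Lnorm_ge0//; last by rewrite lee_fin le_max lexx orbT.
  rewrite poweR_EFin; congr (_ * _).
  by rewrite Nf poweRVK//; apply: integral_ge0 => x _; exact: poweR_ge0.
apply: ge0_le_poweR; [exact: ltW|exact: Lnorm_ge0|].
apply: (@le_trans _ _ (C%:E * 'N[mu]_r%:E[EFin \o (cabs \o f)])).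
  apply: HC; last by rewrite Nf poweR_lty.
  split => /=; first exact: measurableT_comp.
  exact: measurable_cst.
by rewrite lee_wpmul2r ?Lnorm_ge0// lee_fin le_max lexx.
Qed.

Lemma tent_A_sqfun (q : R) (f : X * R -> R[i]) (phi : X * R -> \bar R) x :
  (forall z, Xplus z -> phi z = (cabs (f z))%:E) ->
  tent_A mu q alpha f x = kernel_sqfun (sfnu vol_fin) k q phi x `^ q^-1.
Proof.
move=> fphi; rewrite /tent_A integral_mkcond; congr (_ `^ _).
apply: eq_integral => z _; rewrite patchE; have [z0|z0] := pselect (Xplus z); last first.
  by rewrite kern_off// mul0e ifF//; apply/negbTE; rewrite notin_setE => -[].
rewrite (kernE vol_fin alpha0)// indicE.
have -> : (z \in cone alpha x) = (x \in (ball z.1 (alpha * z.2)%R : set X)).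
  apply/idP/idP; rewrite !inE ballEmdist /=; first by move=> [_]; rewrite /= metric_sym.
  by move=> h; split => //=; rewrite metric_sym.
case: (boolP (x \in _)) => _; last by rewrite !mul0e.
by rewrite mul1e muleC fphi// poweR_EFin.
Qed.

Lemma tent_norm_energy (p q : R) (f : X * R -> R[i]) (phi : X * R -> \bar R) :
  (0 < p)%R -> (0 < q)%R ->
  (forall z, Xplus z -> phi z = (cabs (f z))%:E) ->
  tent_norm mu p q alpha f = kernel_energy (sfmu vol_fin) (sfnu vol_fin) k p q phi `^ p^-1.
Proof.
move=> p0 q0 fphi; rewrite /tent_norm unlock; congr (_ `^ _).
apply: eq_integral => x _; rewrite (tent_A_sqfun _ _ fphi) gee0_abs ?poweR_ge0//.
by rewrite -poweRrM mulrC.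
Qed.

(** Each condition in [K n] has its purpose. The product of a ball with [F n] has finite measure; V
    > 1 / (n + 1) bounds the kernel by n + 1; and t <= n + 1 together with y near the base point
    confines [x] to a fixed ball. *)
Lemma exists_exhaustion : exists (K : (set (X * R))^nat) (B : (set X)^nat) (kap : nat -> R),
  [/\ (forall n, measurable (K n) /\ sfnu vol_fin (K n) < +oo),
      (forall n, measurable (B n) /\ mu (B n) < +oo),
      (forall n, 0 <= kap n)%R /\
      (forall n x z, K n z -> k (x, z) <= (kap n)%:E * (\1_(B n) x)%:E),
      nondecreasing_seq K & \bigcup_n K n = @Xplus R d X].
Proof.
have /sigma_finiteP[F [FT ndF Foo]] := sigma_finiteT (@dt_over_t R).
pose N n : R := n.+1%:R.
have N0 n : (0 < N n)%R by [].
pose V := pvol mu alpha.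
pose K n := (ball point (N n) `*` F n) `&` [set z : X * R | (0 < z.2 <= N n)%R]
  `&` [set z | (N n)^-1%:E < V z].
have mK n : measurable (K n).
  apply: measurableI; first apply: measurableI.
  - by apply: measurableX; [exact: measurable_metric_ball|case: (Foo n)].
  - have -> : [set z : X * R | (0 < z.2 <= N n)%R] = setT `&` (snd @^-1` `]0%R, N n]).
      by apply/seteqP; split => [z|z []] /=; rewrite in_itv/=.
    exact: (@measurable_snd _ _ X R measurableT _ (measurable_itv _)).
  - rewrite -[X in measurable X]setTI; apply: emeasurable_fun_o_infty => //.
    exact: (measurable_pvol vol_fin alpha).
exists K, (fun n => ball point (N n + alpha * N n)%R), N; split.
- move=> n; split => //.
  apply: (@le_lt_trans _ _ (sfnu vol_fin (ball point (N n) `*` F n))).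
    apply: le_measure; rewrite ?inE//.
      by apply: measurableX; [exact: measurable_metric_ball|case: (Foo n)].
    by move=> z [[]].
  rewrite [ltLHS](product_measure1E (sfmu vol_fin) (@dt_over_t R))//; last 2 first.
  + exact: measurable_metric_ball.
  + by case: (Foo n).
  have /andP[v0 voo] := vol_fin point (N0 n).
  have [_ Fn] := Foo n; rewrite lte_mul_pinfty// ge0_fin_numE//.
- move=> n; split; first exact: measurable_metric_ball.
  have r0 : (0 < N n + alpha * N n)%R by rewrite addr_gt0// mulr_gt0.
  by have /andP[] := vol_fin point r0.
- split=> [n|n x z [[[/= z1 _] /andP[t0 tn]] Vz]]; first exact: ltW.
  have z0 : Xplus z by [].
  rewrite (kernE vol_fin alpha0)// -pvolE// indicE; case: (boolP (x \in _)) => [|_]; last first.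
    by rewrite mul0e mule_ge0// lee_fin// ltW.
  rewrite inE => zx; rewrite indicE mem_set ?mule1 ?mul1e; last first.
    apply: (@ball_triangle _ _ z.1) => //; apply: le_ball zx.
    by rewrite ler_pM2l.
  have /andP[v0 voo] := pvol_fin vol_fin alpha0 z0.
  rewrite inve_ple ?inE ?lee_fin ?ltW//.
  by rewrite inver gt_eqF// ltW.
- move=> m n mn; apply/subsetPset => z [[[/= z1 zF] /andP[t0 tn]] Vz].
  have Nmn : (N m <= N n)%R by rewrite ler_nat.
  split; [split; [split|]|] => /=.
  + by apply: le_ball z1.
  + by move: zF; apply/subsetPset; exact: ndF.
  + by rewrite t0 (le_trans tn).
  + by apply: le_lt_trans Vz; rewrite lee_fin lef_pV2 ?posrE ?N0.
- apply/seteqP; split => [z [n _ [[_ /andP[]]]]//|z z0].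
  have : setT z.1 by []; rewrite -(bigcup_ball point) => -[a _ ha].
  have : setT z.2 by []; rewrite FT => -[b _ hb].
  have /andP[v0 voo] := pvol_fin vol_fin alpha0 z0.
  have vf : V z \is a fin_num by rewrite ge0_fin_numE// ltW.
  pose c := Num.truncn z.2; pose e := Num.truncn (fine (V z))^-1.
  pose m := maxn (maxn a b) (maxn c e).
  exists m => //; split; [split; [split|]|] => /=.
  + apply: le_ball ha; rewrite ler_nat; apply: leqW.
    by rewrite /m -maxnA leq_maxl.
  + move: hb; apply/subsetPset; apply: ndF.
    by rewrite /m (leq_trans (leq_maxr a b))// leq_maxl.
  + rewrite z0/= (le_trans (ltW (truncnS_gt _)))// ler_nat ltnS.
    by rewrite /m (leq_trans (leq_maxl c e))// leq_maxr.
  + rewrite -(fineK vf) lte_fin invf_plt ?posrE ?fine_gt0 ?v0//.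
    apply: (lt_le_trans (truncnS_gt _)); rewrite ler_nat ltnS.
    by rewrite /m (leq_trans (leq_maxr c e))// leq_maxr.
Qed.

End tent_kernel_properties.

(** * Bounded functions supported in a given set *)

Section bounded_supported.
Context d (T : measurableType d) (R : realType).

Definition bounded_supported (K : set T) (u : T -> R) : Prop :=
  [/\ measurable_fun setT u, exists c, forall z, `|u z| <= c &
      forall z, ~ K z -> u z = 0].

Lemma bounded_supportedD K u v : bounded_supported K u -> bounded_supported K v ->
  bounded_supported K (fun z => u z + v z).
Proof.
move=> [mu [c uc] u0] [mv [c' vc] v0]; split.
- exact: measurable_funD.
- by exists (c + c') => z; rewrite (le_trans (ler_normD _ _))// lerD.
- by move=> z zK; rewrite u0// v0// addr0.
Qed.

Lemma bounded_supportedZ K c u : bounded_supported K u ->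
  bounded_supported K (fun z => c * u z).
Proof.
move=> [mu [c' uc] u0]; split.
- by apply: measurable_funM.
- by exists (`|c| * c') => z; rewrite normrM ler_wpM2l.
- by move=> z zK; rewrite u0// mulr0.
Qed.

Lemma bounded_supported0 K : bounded_supported K (fun=> 0).
Proof.
by split => //; exists 0 => z; rewrite normr0.
Qed.

Lemma bounded_supported_indic K E : measurable K -> measurable E ->
  bounded_supported K (\1_(E `&` K)).
Proof.
move=> mK mE; split.
- by apply: measurable_indic; exact: measurableI.
- exists 1 => z; rewrite indicE; case: (_ \in _); rewrite ?normr1 ?normr0//.
- by move=> z zK; rewrite indicE memNset// => -[].
Qed.

Lemma bounded_supported_sum K m (v : nat -> T -> R) :
  (forall i, bounded_supported K (v i)) ->
  bounded_supported K (fun z => \sum_(0 <= i < m) v i z).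
Proof.
move=> bv; elim: m => [|m IH].
  under eq_fun do rewrite big_geq//; exact: bounded_supported0.
under eq_fun do rewrite big_nat_recr//=; exact: bounded_supportedD.
Qed.

Lemma bounded_supported_integrableM (nu : {measure set T -> \bar R}) K (u f : T -> R) :
  bounded_supported K u -> nu.-integrable setT (EFin \o f) ->
  nu.-integrable setT (EFin \o (fun z => u z * f z)).
Proof.
move=> [mu [c uc] _] fi; have c0 : 0 <= c by exact: le_trans (uc point).
apply: (le_integrable measurableT _ _ (integrableZl measurableT c fi)).
- apply/measurable_EFinP; apply: measurable_funM => //.
  by apply/measurable_EFinP; exact: measurable_int fi.
- by move=> z _ /=; rewrite lee_fin normrM normrM ler_wpM2r// (ger0_norm c0).
Qed.

End bounded_supported.

(** * Integral representation of a functional on one set *)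

Section riesz_on_a_set.
Context d (T : measurableType d) (R : realType).
Variable nu : {sigma_finite_measure set T -> \bar R}.
Variable K : set T.
Hypothesis mK : measurable K.
Variable L : (T -> R) -> R.
Local Notation bs := (bounded_supported K).
Hypothesis LD : forall u v, bs u -> bs v -> L (fun z => u z + v z) = L u + L v.
Hypothesis LZ : forall c u, bs u -> L (fun z => c * u z) = c * L u.
Hypothesis L_ae : forall u, bs u -> {ae nu, forall z, u z = 0} -> L u = 0.
Hypothesis L_cvg : forall (u : (T -> R)^nat) c,
  (forall n, measurable_fun setT (u n)) -> (forall n z, `|u n z| <= c) ->
  (forall n z, ~ K z -> u n z = 0) -> (forall z, u ^~ z @ \oo --> 0) ->
  (fun n => L (u n)) @ \oo --> 0.

Let L_sum m (v : nat -> T -> R) : (forall i, bs (v i)) ->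
  L (fun z => \sum_(0 <= i < m) v i z) = \sum_(0 <= i < m) L (v i).
Proof.
move=> bv; elim: m => [|m IH].
  under eq_fun do rewrite big_geq//; rewrite big_geq// L_ae//; first exact: bounded_supported0.
  exact: aeW.
under eq_fun do rewrite big_nat_recr//=; rewrite LD ?IH ?big_nat_recr//.
exact: bounded_supported_sum.
Qed.

(** Nothing is known of [L] on nonmeasurable indicators, so the set function gets the default value
    0 there. *)
Let lam (E : set T) : \bar R := if `[< measurable E >] then (L (\1_(E `&` K)))%:E else 0%E.

Let lamE E : measurable E -> lam E = (L (\1_(E `&` K)))%:E.
Proof. by move=> mE; rewrite /lam; case: ifPn => // /asboolPn. Qed.

Let lam0 : lam set0 = 0%E.
Proof.
rewrite lamE// set0I L_ae//; last by apply: aeW => z; rewrite indic0.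
by rewrite -(set0I K); exact: bounded_supported_indic.
Qed.

Let lam_fin E : measurable E -> lam E \is a fin_num.
Proof. by move=> mE; rewrite lamE. Qed.

Let lam_sigma_additive : semi_sigma_additive lam.
Proof.
move=> F mF tF mUF; rewrite lamE//; set U := \bigcup_n F n.
have -> : (fun n => \sum_(0 <= i < n) lam (F i))%E =
          EFin \o (fun n => \sum_(0 <= i < n) L (\1_(F i `&` K))).
  by apply/funext => n /=; rewrite -sumEFin; apply: eq_bigr => i _; rewrite lamE.
apply/cvg_EFin; first exact: nearW.
have bF i : bs (\1_(F i `&` K) : T -> R) by exact: bounded_supported_indic.
pose s n z : R := \sum_(0 <= i < n) \1_(F i `&` K) z.
pose w n z : R := \1_(U `&` K) z + (-1) * s n z.
have Lw n : L (w n) = L (\1_(U `&` K)) - \sum_(0 <= i < n) L (\1_(F i `&` K)).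
  rewrite LD ?LZ ?L_sum ?mulN1r//; first exact: bounded_supported_sum.
    exact: bounded_supported_indic.
  by apply: bounded_supportedZ; exact: bounded_supported_sum.
have sE j z : (F j `&` K) z -> forall n, s n z = (j < n)%:R.
  move=> [Fj Kz]; elim => [|n IH]; first by rewrite /s big_geq.
  rewrite /s big_nat_recr//= -/(s n z) IH indicE (ltnS j n) (leq_eqVlt j n).
  have [jn|jn] := eqVneq j n.
    by rewrite -jn ltnn mem_set//= add0r.
  rewrite memNset ?addr0//= => -[Fn _]; have : (F j `&` F n) !=set0 by exists z.
  by move=> /(tF _ _ I I)/eqP; rewrite (negbTE jn).
have s0 z : ~ (U `&` K) z -> forall n, s n z = 0.
  move=> nz n; rewrite /s big1// => i _; rewrite indicE memNset// => -[Fi Kz].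
  by apply: nz; split => //; exists i.
(* The remainder is 1 at a point of [F j] within [K] until the j-th set has been counted, and 0
   afterwards. Hence it is bounded by 1 and tends to 0, as [L_cvg] requires. *)
have wcases z : (exists j, forall n, w n z = 1 - (j < n)%:R) \/ (forall n, w n z = 0).
  have [[[j _ Fj] Kz]|nz] := pselect ((U `&` K) z); [left; exists j|right] => n.
    rewrite /w (sE j)// mulN1r indicE mem_set//; split => //; by exists j.
  by rewrite /w s0// mulr0 addr0 indicE memNset.
have w_cvg : (fun n => L (w n)) @ \oo --> 0.
  apply: (L_cvg (c := 1)).
  - move=> n; have [] : bs (w n) => //; apply: bounded_supportedD.
      exact: bounded_supported_indic.
    by apply: bounded_supportedZ; exact: bounded_supported_sum.
  - move=> n z; have [[j ->]|->] := wcases z; last by rewrite normr0.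
    by case: (j < n)%N; rewrite ?subrr ?subr0 ?normr0 ?normr1.
  - move=> n z zK; rewrite /w s0 ?mulr0 ?addr0; last by move=> -[].
    by rewrite indicE memNset// => -[].
  - move=> z; have [[j wj]|w0] := wcases z; last first.
      by rewrite (_ : w ^~ z = cst 0); [exact: cvg_cst|apply/funext => n; rewrite w0].
    apply: cvg_near_cst; exists j.+1 => // n /= jn.
    by rewrite wj jn subrr.
have -> : (fun n => \sum_(0 <= i < n) L (\1_(F i `&` K))) =
          (fun n => L (\1_(U `&` K)) - L (w n)).
  by apply/funext => n; rewrite Lw opprB addrCA subrr addr0.
rewrite -[X in _ --> X]subr0; apply: cvgB => //; exact: cvg_cst.
Qed.

HB.instance Definition _ := isCharge.Build _ T R lam lam0 lam_fin lam_sigma_additive.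

Let lam_dom : lam `<< nu.
Proof.
move=> N nuN A mA AN; rewrite lamE// L_ae//; first exact: bounded_supported_indic.
exists A; split => //; first exact: nuN.
move=> z /= nz; apply: contrapT => zA; apply: nz.
by rewrite indicE memNset// => -[].
Qed.

Let a (z : T) : R := fine (Radon_Nikodym lam nu z).

Let aE z : (a z)%:E = Radon_Nikodym lam nu z.
Proof. by rewrite fineK// Radon_Nikodym_fin_num. Qed.

Let a_int : nu.-integrable setT (EFin \o a).
Proof.
apply: eq_integrable (Radon_Nikodym_integrable lam_dom) => // z _.
by rewrite /= aE.
Qed.

Let ma : measurable_fun setT a.
Proof. by apply/measurable_EFinP; exact: measurable_int a_int. Qed.

Let ua_int u : bs u -> nu.-integrable setT (EFin \o (fun z => u z * a z)).
Proof. by move=> bu; exact: bounded_supported_integrableM bu a_int. Qed.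

Let repr u := L u = \int[nu]_z (u z * a z).

Let repr_indic E : measurable E -> repr (\1_(E `&` K)).
Proof.
move=> mE; have mEK := measurableI _ _ mE mK.
have H : lam (E `&` K) = (\int[nu]_(z in E `&` K) Radon_Nikodym lam nu z)%E.
  exact: Radon_Nikodym_integral.
rewrite lamE// -setIA setIid in H.
rewrite /repr -[LHS]/(fine (_%:E)) H /Rintegral [in LHS]integral_mkcond; congr fine.
apply: eq_integral => z _; rewrite patchE indicE -aE.
by case: (boolP (z \in _)) => _; rewrite ?mul1r ?mul0r.
Qed.

Let reprD u v : bs u -> bs v -> repr u -> repr v -> repr (fun z => u z + v z).
Proof.
move=> bu bv ru rv; rewrite /repr LD// ru rv -RintegralD//; [|exact: ua_int..].
by apply: eq_Rintegral => z _; rewrite mulrDl.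
Qed.

Let reprZ c u : bs u -> repr u -> repr (fun z => c * u z).
Proof.
move=> bu ru; rewrite /repr LZ// ru -RintegralZl//; last exact: ua_int.
by apply: eq_Rintegral => z _; rewrite mulrA.
Qed.

(** The representation survives bounded pointwise limits: [L_cvg] applied to v n - u gives the left
    side, dominated convergence with majorant c * |a| the right side. *)
Let repr_cvg (v : (T -> R)^nat) u c : bs u ->
  (forall n, bs (v n)) -> (forall n z, `|v n z| <= c) ->
  (forall z, v ^~ z @ \oo --> u z) -> (forall n, repr (v n)) -> repr u.
Proof.
move=> bu bv vc vu rv; have c0 : 0 <= c by exact: le_trans (vc 0%N point).
have uc z : `|u z| <= c.
  have nv : (fun n => `|v n z|) @ \oo --> `|u z| by exact: cvg_norm (vu z).
  rewrite -(cvg_lim _ nv)//; apply: limr_le; first by apply/cvg_ex; eexists; exact: nv.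
  exact: nearW.
have [mu _ u0] := bu.
have Lvu : (fun n => L (v n)) @ \oo --> L u.
  have H : (fun n => L (fun z => v n z + (-1) * u z)) @ \oo --> 0.
    apply: (L_cvg (c := c + c)).
    - by move=> n; have [mv _ _] := bv n; apply: measurable_funD => //; apply: measurable_funM.
    - by move=> n z; rewrite mulN1r (le_trans (ler_normB _ _))// lerD.
    - by move=> n z zK; have [_ _ v0] := bv n; rewrite v0// u0// mulr0 addr0.
    - move=> z; under eq_fun do rewrite mulN1r.
      by rewrite -(subrr (u z)); apply: cvgB => //; exact: cvg_cst.
  have -> : (fun n => L (v n)) = (fun n => L (fun z => v n z + (-1) * u z) + L u).
    apply/funext => n; rewrite LD ?LZ//; last exact: bounded_supportedZ.
    by rewrite mulN1r subrK.
  by rewrite -[X in _ --> X]add0r; apply: cvgD => //; exact: cvg_cst.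
have cv : {ae nu, forall z, setT z -> (fun n => (v n z * a z)%:E) @ \oo --> (u z * a z)%:E}.
  apply: aeW => z _; apply/cvg_EFin; first exact: nearW.
  by apply: cvgMl => //; exact: vu.
have dom : {ae nu, forall z n, setT z -> (`|(v n z * a z)%:E| <= c%:E * `|(a z)%:E|)%E}.
  by apply: aeW => z n _; rewrite -EFinM lee_fin normrM ler_wpM2r.
have [_ _ H] := @dominated_convergence _ _ _ nu setT measurableT
  (fun n z => (v n z * a z)%:E) (fun z => (u z * a z)%:E) (fun z => c%:E * `|(a z)%:E|)%E
  (fun n => measurable_int _ (ua_int (bv n))) (measurable_int _ (ua_int bu)) cv
  (integrableZl measurableT c (integrable_abse a_int)) dom.
have H' : (fun n => \int[nu]_z (v n z * a z)) @ \oo --> \int[nu]_z (u z * a z).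
  by apply: fine_cvg; rewrite fineK//; apply: integrable_fin_num => //; exact: ua_int.
apply: (cvg_unique _ Lvu) => //.
by rewrite (_ : (fun n => L (v n)) = (fun n => \int[nu]_z (v n z * a z)))//; apply/funext => n; exact: rv.
Qed.

Let repr_sum m (v : nat -> T -> R) : (forall i, bs (v i)) -> (forall i, repr (v i)) ->
  repr (fun z => \sum_(0 <= i < m) v i z).
Proof.
move=> bv rv; elim: m => [|m IH].
  under eq_fun do rewrite big_geq//; rewrite /repr L_ae//; last by exact: aeW.
    by rewrite /Rintegral; under eq_integral do rewrite mul0r; rewrite integral0.
  exact: bounded_supported0.
under eq_fun do rewrite big_nat_recr//=; apply: reprD => //.
exact: bounded_supported_sum.
Qed.

Import HBNNSimple.

Let repr_ge0 u : bs u -> (forall z, 0 <= u z) -> repr u.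
Proof.
move=> bu u0; have [mu [c uc] uK] := bu.
have mEu : measurable_fun setT (EFin \o u) by exact/measurable_EFinP.
pose v := nnsfun_approx measurableT mEu.
have v_u z : (fun n => v n z) @ \oo --> u z.
  have := cvg_nnsfun_approx measurableT mEu (fun z _ => u0 z) (I : setT z).
  by move=> /fine_cvg.
have vle n z : v n z <= u z.
  have nd : nondecreasing_seq (fun n => v n z).
    by move=> i j ij; have /lefP := nd_nnsfun_approx measurableT mEu ij; exact.
  rewrite -(cvg_lim _ (v_u z))//; apply: nondecreasing_cvgn_le => //.
  by apply/cvg_ex; eexists; exact: v_u.
have bv n : bs (v n).
  split=> //.
  - exists c => z; rewrite ger0_norm//; apply: (le_trans (vle n z)).
    by rewrite (le_trans _ (uc z))// ler_norm.
  - by move=> z zK; apply/eqP; rewrite eq_le fun_ge0 andbT -[leRHS](uK z zK).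
apply: (repr_cvg (c := c) bu bv) => //.
  move=> n z; rewrite ger0_norm//; apply: (le_trans (vle n z)).
  by rewrite (le_trans _ (uc z))// ler_norm.
(* A simple function is the combination of indicators of its level sets. These are intersected with
   [K], which changes nothing as [v n] vanishes off [K], and makes each term admissible for [L]. *)
move=> n; pose s : seq R := finmap.enum_fset (fset_set (range (v n))).
have -> : (v n : T -> R) = (fun z => \sum_(0 <= i < size s) (s`_i * \1_((v n @^-1` [set s`_i]) `&` K) z)).
  apply/funext => z; rewrite {1}fimfunEord big_mkord; apply: eq_bigr => i _.
  rewrite !indicE in_setI; have [Kz|zK] := pselect (K z).
    by rewrite (mem_set Kz) andbT.
  rewrite (memNset zK) andbF mulr0.
  have [<-|sn] := eqVneq (v n z) (s`_i); last first.
    by rewrite memNset ?mulr0//= => /eqP; rewrite (negbTE sn).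
  by have [_ _ -> //] := bv n; rewrite mul0r.
have bi i : bs (\1_((v n @^-1` [set s`_i]) `&` K) : T -> R).
  by apply: bounded_supported_indic => //; exact: measurable_funPTI.
apply: (@repr_sum _ (fun i z => s`_i * \1_((v n @^-1` [set s`_i]) `&` K) z)) => i.
  exact: bounded_supportedZ.
apply: reprZ => //; apply: repr_indic; exact: measurable_funPTI.
Qed.

Lemma riesz_on_a_set : exists b : T -> R,
  [/\ measurable_fun setT b, nu.-integrable setT (EFin \o b) &
      forall u, bs u -> L u = \int[nu]_z (u z * b z)].
Proof.
exists a; split => // u bu; have [mu [c uc] uK] := bu.
pose up z := Num.max (u z) 0; pose un z := Num.max (- u z) 0.
have uE : u = (fun z => up z + (-1) * un z).
  apply/funext => z; rewrite mulN1r /up /un.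
  by case: (lerP (u z) 0) => [h|h]; [rewrite max_l ?oppr_ge0// add0r opprK|rewrite max_r ?oppr_le0 ?ltW// subr0].
have bup : bs up.
  split; first by apply: measurable_maxr.
    by exists c => z; rewrite /up; case: (lerP (u z) 0) => _; rewrite ?normr0 ?uc// (le_trans _ (uc z)).
  by move=> z zK; rewrite /up uK// maxxx.
have bun : bs un.
  split; first by apply: measurable_maxr => //; exact: measurableT_comp.
    exists c => z; rewrite /un; case: (lerP (- u z) 0) => _; rewrite ?normr0 ?normrN ?uc//.
    by rewrite (le_trans _ (uc z)).
  by move=> z zK; rewrite /un uK// oppr0 maxxx.
rewrite uE; apply: reprD => //; first exact: bounded_supportedZ.
  by apply: repr_ge0 => // z; rewrite le_max lexx orbT.
by apply: reprZ => //; apply: repr_ge0 => // z; rewrite le_max lexx orbT.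
Qed.

End riesz_on_a_set.

(** * Gluing the densities along the exhaustion *)

Section riesz_on_an_exhaustion.
Context d (T : measurableType d) (R : realType).
Variable nu : {sigma_finite_measure set T -> \bar R}.
Variable K : (set T)^nat.
Hypothesis mK : forall n, measurable (K n).
Hypothesis ndK : nondecreasing_seq K.
Variable L : (T -> R) -> R.
Local Notation bs n := (bounded_supported (K n)).
Hypothesis LD : forall n u v, bs n u -> bs n v -> L (fun z => u z + v z) = L u + L v.
Hypothesis LZ : forall n c u, bs n u -> L (fun z => c * u z) = c * L u.
Hypothesis L_ae : forall n u, bs n u -> {ae nu, forall z, u z = 0} -> L u = 0.
Hypothesis L_cvg : forall k (u : (T -> R)^nat) c,
  (forall n, measurable_fun setT (u n)) -> (forall n z, `|u n z| <= c) ->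
  (forall n z, ~ K k z -> u n z = 0) -> (forall z, u ^~ z @ \oo --> 0) ->
  (fun n => L (u n)) @ \oo --> 0.

Lemma bounded_supported_cut n A (u : T -> R) : measurable A -> bs n u -> A `<=` K n ->
  bounded_supported A (fun z => \1_A z * u z).
Proof.
move=> mA [mu [c uc] uK] AK; split.
- by apply: measurable_funM => //; exact: measurable_indic.
- exists c => z; rewrite normrM indicE; case: (_ \in _); rewrite ?normr1 ?mul1r//.
  by rewrite normr0 mul0r (le_trans _ (uc z)).
- by move=> z zA; rewrite indicE memNset// mul0r.
Qed.

Lemma bounded_supportedS (A B : set T) (u : T -> R) : A `<=` B ->
  bounded_supported A u -> bounded_supported B u.
Proof. by move=> AB [mu uc uA]; split => // z zB; apply: uA => /AB. Qed.

Lemma riesz_on_an_exhaustion : exists b : T -> R,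
  [/\ measurable_fun setT b,
      forall n, nu.-integrable setT (EFin \o (fun z => \1_(K n) z * b z)) &
      forall n u, bs n u -> L u = \int[nu]_z (u z * b z)].
Proof.
have Kmn m n : (m <= n)%N -> K m `<=` K n by move=> mn; apply/subsetPset; exact: ndK.
have H n : { a : T -> R | [/\ measurable_fun setT a, nu.-integrable setT (EFin \o a) &
    forall u, bs n u -> L u = \int[nu]_z (u z * a z)] }.
  apply: cid; apply: riesz_on_a_set => //.
  - exact: LD. - exact: LZ. - exact: L_ae. - exact: L_cvg.
pose a n := sval (H n).
have ma n : measurable_fun setT (a n) by case: (svalP (H n)).
have ia n : nu.-integrable setT (EFin \o a n) by case: (svalP (H n)).
have La n u : bs n u -> L u = \int[nu]_z (u z * a n z) by case: (svalP (H n)) => _ _; exact.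
(* Each density [a n] is used only on the layer that [K n] adds, so the densities need not be
   compared on overlaps. *)
pose A n := if n is m.+1 then K n `\` K m else K 0%N.
have mA n : measurable (A n) by case: n => [|n] //=; exact: measurableD.
have AK n : A n `<=` K n by case: n => [|n]//=; exact: subDsetl.
have Az n z : K n z -> forall i, (n < i)%N -> \1_(A i) z = 0 :> R.
  move=> Kz [//|i]; rewrite ltnS => ni; rewrite indicE memNset// => -[_]; apply.
  exact: Kmn Kz.
pose b n z : R := \sum_(0 <= i < n.+1) \1_(A i) z * a i z.
have bS n z : b n.+1 z = b n z + \1_(A n.+1) z * a n.+1 z by rewrite /b big_nat_recr.
have iA n (f : T -> R) : nu.-integrable setT (EFin \o f) ->
    nu.-integrable setT (EFin \o (fun z => \1_(A n) z * f z)).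
  apply: (@bounded_supported_integrableM _ _ _ nu (K n)); split; first exact: measurable_indic.
    by exists 1 => z; rewrite indicE; case: (_ \in _); rewrite ?normr1 ?normr0.
  by move=> z zK; rewrite indicE memNset// => /AK.
have main n : [/\ nu.-integrable setT (EFin \o b n), forall z, ~ K n z -> b n z = 0 &
    forall u, bs n u -> L u = \int[nu]_z (u z * b n z)].
  elim: n => [|n [ib b0 Lb]].
    have b0E z : b 0%N z = \1_(A 0%N) z * a 0%N z by rewrite /b big_nat1.
    have -> : b 0%N = (fun z => \1_(A 0%N) z * a 0%N z) by apply/funext.
    split; first exact: iA.
      by move=> z zK; rewrite indicE memNset// mul0r.
    move=> u bu; rewrite (La 0%N)//; apply: eq_Rintegral => z _.
    have [Kz|zK] := pselect (K 0%N z); first by rewrite indicE mem_set// mul1r.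
    by have [_ _ ->//] := bu; rewrite !mul0r.
  have -> : b n.+1 = (fun z => b n z + \1_(A n.+1) z * a n.+1 z) by apply/funext.
  split.
  - rewrite (_ : _ \o _ = (EFin \o b n) \+ (EFin \o (fun z => \1_(A n.+1) z * a n.+1 z)))//.
    by apply: integrableD => //; exact: iA.
  - move=> z zK; rewrite b0 ?add0r; last by move=> /(Kmn _ _ (leqnSn n)).
    by rewrite indicE memNset ?mul0r// => /AK.
  - move=> u bu; have bu1 := bounded_supported_cut (mK n) bu (Kmn _ _ (leqnSn n)).
    have bu2 := bounded_supportedS (@AK n.+1) (bounded_supported_cut (mA n.+1) bu (@AK n.+1)).
    have uE : u = (fun z => \1_(K n) z * u z + \1_(A n.+1) z * u z).
      apply/funext => z; rewrite -mulrDl !indicE.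
      have [Kz|zK] := pselect (K n z).
        by rewrite (mem_set Kz) memNset ?addr0 ?mul1r// => -[].
      rewrite (memNset zK) add0r; have [Kz|zK'] := pselect (K n.+1 z).
        by rewrite mem_set ?mul1r.
      by have [_ _ ->//] := bu; rewrite mulr0.
    rewrite {1}uE (LD (n := n.+1))//; last first.
      exact: (bounded_supportedS (Kmn _ _ (leqnSn n)) bu1).
    rewrite Lb// (La n.+1)// -RintegralD//; last 2 first.
    + exact: bounded_supported_integrableM bu1 ib.
    + exact: bounded_supported_integrableM bu2 (ia n.+1).
    apply: eq_Rintegral => z _; rewrite mulrDr; congr (_ + _); last by rewrite mulrAC mulrC.
    have [Kz|zK] := pselect (K n z); first by rewrite indicE mem_set// mul1r.
    by rewrite b0// !mulr0.
(* At each point the sequence is eventually constant, and it is constantly 0 outside the union of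
   the [K n]. The limit is integrable on each [K n] but perhaps not globally. *)
pose bl z := limn (b ^~ z).
have b_eq n z : K n z -> forall m, (n <= m)%N -> b m z = b n z.
  move=> Kz; elim => [|m IH]; first by rewrite leqn0 => /eqP ->.
  rewrite leq_eqVlt => /predU1P[->//|]; rewrite ltnS => nm.
  by rewrite bS IH// (Az n)// mul0r addr0.
have b_cvg z : b ^~ z @ \oo --> bl z.
  have [[n Kz]|nK] := pselect (exists n, K n z).
    apply/cvg_ex; exists (b n z); apply: cvg_near_cst; exists n => // m /= nm.
    exact: b_eq.
  apply/cvg_ex; exists 0; apply: cvg_near_cst; apply: nearW => m.
  by have [_ -> //] := main m => Kz; apply: nK; exists m.
have blE n z : K n z -> bl z = b n z.
  move=> Kz; apply: cvg_lim => //; apply: cvg_near_cst; exists n => // m /= nm.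
  exact: b_eq.
exists bl; split.
- apply: (measurable_fun_cvg (h := b)) => [n|z _]; last exact: b_cvg.
  by have [/measurable_int/measurable_EFinP] := main n.
- move=> n; have [ib b0 _] := main n; apply: eq_integrable ib => // z _ /=.
  have [Kz|zK] := pselect (K n z); first by rewrite indicE mem_set// mul1r (blE n).
  by rewrite indicE memNset// mul0r b0.
- move=> n u bu; have [_ _ ->//] := main n; apply: eq_Rintegral => z _.
  have [Kz|zK] := pselect (K n z); first by rewrite (blE n).
  by have [_ _ ->//] := bu; rewrite !mul0r.
Qed.

End riesz_on_an_exhaustion.

(** * Tent norms of complex functions and the pairing *)

Section tent_functionals.
Context (R : realType) (d : measure_display) (X : borelMetricType R d).
Variable mu : {measure set X -> \bar R}.
Hypothesis vol_fin : forall (x : X) (r : R), 0 < r -> (0 < vol mu x r < +oo)%E.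
Variable alpha : R.
Hypothesis alpha0 : 0 < alpha.

Local Notation cabs := (@Normc.normc R).
Local Notation k := (kern mu alpha).
Local Notation D := (@Xplus R d X).
Local Notation Z := (X * R)%type.
Local Notation M := (sfmu vol_fin).
Local Notation N := (sfnu vol_fin).
Local Notation energy := (kernel_energy M N k).

Let mD : measurable D. Proof. exact: measurable_Xplus. Qed.
Let mk : measurable_fun setT k. Proof. exact: measurable_kern. Qed.
Let k0 w : (0 <= k w)%E. Proof. exact: kern_ge0. Qed.
Let kD x z : ~ D z -> k (x, z) = 0%E. Proof. exact: kern_off. Qed.
Let k1 z : D z -> (\int[M]_x k (x, z) = 1)%E. Proof. exact: kern_markov. Qed.

(** Elements of a tent space are measurable on [D] only and arbitrary elsewhere; extending the
    modulus by 0 gives the globally measurable function that the energies take. *)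
Definition cmod (f : Z -> R[i]) : Z -> \bar R := (fun z => (cabs (f z))%:E) \_ D.

Lemma cmod_on f z : D z -> cmod f z = (cabs (f z))%:E.
Proof. by move=> Dz; rewrite /cmod patchE mem_set. Qed.

Lemma cmod_off f z : ~ D z -> cmod f z = 0%E.
Proof. by move=> Dz; rewrite /cmod patchE memNset. Qed.

Lemma cmod_ge0 f z : (0 <= cmod f z)%E.
Proof.
have [Dz|Dz] := pselect (D z); last by rewrite cmod_off.
by rewrite cmod_on// lee_fin normc_ge0.
Qed.

Lemma measurable_cmod f : cmeasurable_fun D f -> measurable_fun setT (cmod f).
Proof.
move=> mf; apply/(measurable_restrictT _ _).1 => //.
by apply/measurable_EFinP; exact: measurable_normc.
Qed.

Lemma tent_normE p q f : 0 < p -> 0 < q ->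
  tent_norm mu p q alpha f = (energy p q (cmod f) `^ p^-1)%E.
Proof. by move=> p0 q0; apply: tent_norm_energy => // z Dz; exact: cmod_on. Qed.

Lemma tent_norm_lty p q f : 0 < p -> 0 < q ->
  (tent_norm mu p q alpha f < +oo)%E <-> (energy p q (cmod f) < +oo)%E.
Proof.
move=> p0 q0; rewrite (tent_normE _ p0 q0); split; last exact: poweR_lty.
by apply: lty_poweRy; rewrite invr_neq0// gt_eqF.
Qed.

Lemma le_tent_norm p q f g : 0 < p -> 0 < q ->
  cmeasurable_fun D f -> cmeasurable_fun D g ->
  (forall z, D z -> cabs (f z) <= cabs (g z)) ->
  (tent_norm mu p q alpha f <= tent_norm mu p q alpha g)%E.
Proof.
move=> p0 q0 mf mg fg; rewrite !(tent_normE _ p0 q0); apply: ge0_le_poweR.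
- by rewrite invr_ge0 ltW.
- exact: energy_ge0.
apply: (le_energy M N mk k0 kD) => //; [exact: measurable_cmod..|exact: cmod_ge0|].
by move=> z Dz; rewrite !cmod_on// lee_fin fg.
Qed.

Lemma tent_normZ p q (a : R[i]) f : 0 < p -> 0 < q -> cmeasurable_fun D f ->
  tent_norm mu p q alpha (fun z => a * f z) = ((cabs a)%:E * tent_norm mu p q alpha f)%E.
Proof.
move=> p0 q0 mf; rewrite !(tent_normE _ p0 q0).
have mF := measurable_cmod mf; have F0 := cmod_ge0 f.
have sE x : kernel_sqfun N k q (cmod (fun z => a * f z)) x = ((cabs a `^ q)%:E * kernel_sqfun N k q (cmod f) x)%E.
  rewrite /kernel_sqfun -ge0_integralZl//; last 3 first.
  - by apply: emeasurable_funM; [exact: measurable_kernel_l|exact: measurable_fun_poweR].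
  - by move=> z _; rewrite mule_ge0// poweR_ge0.
  - by rewrite lee_fin powR_ge0.
  apply: eq_integral => z _; have [Dz|Dz] := pselect (D z); last by rewrite kD// !mul0e mule0.
  by rewrite !cmod_on// Normc.normcM EFinM poweRM ?lee_fin ?normc_ge0// poweR_EFin muleCA.
have -> : energy p q (cmod (fun z => a * f z)) = ((cabs a `^ p)%:E * energy p q (cmod f))%E.
  rewrite /kernel_energy -ge0_integralZl//; last 3 first.
  - by apply: measurable_fun_poweR; exact: measurable_sqfun.
  - by move=> x _; exact: poweR_ge0.
  - by rewrite lee_fin powR_ge0.
  apply: eq_integral => x _; rewrite sE poweRM ?lee_fin ?powR_ge0//; last exact: sqfun_ge0.
  by rewrite poweR_EFin -powRrM; congr ((_ `^ _)%:E * _)%E; field; rewrite gt_eqF.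
rewrite poweRM ?lee_fin ?powR_ge0//; last exact: energy_ge0.
by rewrite poweR_EFin -powRrM mulfV ?gt_eqF// powRr1// normc_ge0.
Qed.

Section pairing.
Variables p q p' q' : R.
Hypotheses (p0 : 0 < p) (p'0 : 0 < p') (pp' : p^-1 + p'^-1 = 1).
Hypotheses (q0 : 0 < q) (q'0 : 0 < q') (qq' : q^-1 + q'^-1 = 1).
Local Notation T := (tent_space mu p q alpha).
Local Notation T' := (tent_space mu p' q' alpha).

Lemma pairing_abs_le f g : cmeasurable_fun D f -> cmeasurable_fun D g ->
  (\int[muplus mu]_(z in D) (cabs (pairing_integrand f g z))%:E <=
   tent_norm mu p q alpha f * tent_norm mu p' q' alpha g)%E.
Proof.
move=> mf mg; rewrite (tent_normE f p0 q0) (tent_normE g p'0 q'0).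
apply: le_trans (pairing_le_energy N mk k0 kD k1 (measurable_cmod mf) (measurable_cmod mg)
  (cmod_ge0 f) (cmod_ge0 g) p0 p'0 pp' q0 q'0 qq').
rewrite le_eqVlt; apply/orP; left; apply/eqP; apply: eq_integral => z; rewrite inE => Dz.
by rewrite !cmod_on// -EFinM /pairing_integrand Normc.normcM normc_conj.
Qed.

Lemma cmeasurable_pairing_integrand f g : cmeasurable_fun D f -> cmeasurable_fun D g ->
  cmeasurable_fun D (pairing_integrand f g).
Proof. by move=> mf mg; apply: cmeasurable_funM => //; exact: cmeasurable_conj. Qed.

Lemma tent_pairing_converges f g : T f -> T' g -> pairing_converges mu f g.
Proof.
move=> [mf foo] [mg goo]; split; first exact: cmeasurable_pairing_integrand.
apply: le_lt_trans (pairing_abs_le mf mg) _.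
have [A0 B0] : (0 <= tent_norm mu p q alpha f)%E /\ (0 <= tent_norm mu p' q' alpha g)%E.
  by split; exact: Lnorm_ge0.
by apply: lte_mul_pinfty => //; rewrite ge0_fin_numE.
Qed.

End pairing.

Lemma pairing_integrable f g : pairing_converges mu f g ->
  (muplus mu).-integrable D (EFin \o (fun z => complex.Re (pairing_integrand f g z))) /\
  (muplus mu).-integrable D (EFin \o (fun z => complex.Im (pairing_integrand f g z))).
Proof.
move=> [[mRe mIm] foo].
have mabs := measurable_normc (conj mRe mIm).
have H (u : Z -> R) : measurable_fun D u -> (forall z, `|u z| <= cabs (pairing_integrand f g z)) ->
    (muplus mu).-integrable D (EFin \o u).
  move=> mu' uf; apply/integrableP; split; first exact/measurable_EFinP.
  apply: le_lt_trans foo; apply: ge0_le_integral => //.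
  - by apply/measurable_EFinP; exact: measurableT_comp.
  - exact/measurable_EFinP.
  - by move=> z _; rewrite lee_fin.
split; apply: H => // z; [exact: normc_Re|exact: normc_Im].
Qed.

(** The factor 2 comes from bounding the real and imaginary parts separately; it is harmless for an
    equivalence of norms. *)
Lemma pairing_normc_le f g : pairing_converges mu f g ->
  ((cabs (pairing mu f g))%:E <= 2%:E * \int[muplus mu]_(z in D) (cabs (pairing_integrand f g z))%:E)%E.
Proof.
move=> fg; have [iRe iIm] := pairing_integrable fg; have [mfg foo] := fg.
have mabs := measurable_normc mfg.
have H (u : Z -> R) : (muplus mu).-integrable D (EFin \o u) ->
    (forall z, `|u z| <= cabs (pairing_integrand f g z)) ->
    ((`|\int[muplus mu]_(z in D) u z|%R)%:E <= \int[muplus mu]_(z in D) (cabs (pairing_integrand f g z))%:E)%E.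
  move=> iu uf; rewrite EFin_normr_Rintegral//.
  apply: le_trans (le_abse_integral _ mD (measurable_int _ iu)) _.
  apply: ge0_le_integral => //.
  - by apply: measurableT_comp => //; exact: measurable_int iu.
  - exact/measurable_EFinP.
  - by move=> z _; rewrite lee_fin.
apply: (@le_trans _ _ (`|complex.Re (pairing mu f g)| + `|complex.Im (pairing mu f g)|)%:E).
  by rewrite lee_fin normc_le_ReIm.
rewrite EFinD mule_natl mule2n; apply: leeD; apply: H => // z; [exact: normc_Re|exact: normc_Im].
Qed.

End tent_functionals.

#[local] Opaque tent_norm.

(** * Bounded functionals, density of bounded functions, and representation *)

Section tent_duality.
Context (R : realType) (d : measure_display) (X : borelMetricType R d).
Variable mu : {measure set X -> \bar R}.
Hypothesis vol_fin : forall (x : X) (r : R), 0 < r -> (0 < vol mu x r < +oo)%E.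
Variable alpha : R.
Hypothesis alpha0 : 0 < alpha.

Local Notation cabs := (@Normc.normc R).
Local Notation k := (kern mu alpha).
Local Notation D := (@Xplus R d X).
Local Notation Z := (X * R)%type.
Local Notation M := (sfmu vol_fin).
Local Notation N := (sfnu vol_fin).
Local Notation energy := (kernel_energy M N k).

Let mD : measurable D. Proof. exact: measurable_Xplus. Qed.
Let mk : measurable_fun setT k. Proof. exact: measurable_kern. Qed.
Let k0 w : (0 <= k w)%E. Proof. exact: kern_ge0. Qed.
Let koo w : (k w < +oo)%E. Proof. exact: kern_lty. Qed.
Let kD x z : ~ D z -> k (x, z) = 0%E. Proof. exact: kern_off. Qed.

Variables (K : (set Z)^nat) (B : (set X)^nat) (kap : nat -> R).
Hypotheses (mK : forall n, measurable (K n)) (mB : forall n, measurable (B n)).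
Hypotheses (nuK : forall n, (N (K n) < +oo)%E) (muB : forall n, (M (B n) < +oo)%E).
Hypothesis kap0 : forall n, 0 <= kap n.
Hypothesis kK : forall n x z, K n z -> (k (x, z) <= (kap n)%:E * (\1_(B n) x)%:E)%E.
Hypothesis ndK : nondecreasing_seq K.
Hypothesis KD : \bigcup_n K n = D.

Let KsubD n : K n `<=` D. Proof. by rewrite -KD => z Kz; exists n. Qed.

Variables p q : R.
Hypotheses (p0 : 0 < p) (q0 : 0 < q).
Local Notation T := (tent_space mu p q alpha).
Local Notation tnorm := (tent_norm mu p q alpha).
Local Notation bs n := (bounded_supported (K n)).

Definition cbounded_supported n (f : Z -> R[i]) : Prop :=
  bs n (fun z => complex.Re (f z)) /\ bs n (fun z => complex.Im (f z)).

Lemma cbounded_cmeasurable n f : cbounded_supported n f -> cmeasurable_fun D f.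
Proof. by move=> [[mRe _ _] [mIm _ _]]; split; exact: measurable_funTS. Qed.

Lemma cbounded_off n f z : cbounded_supported n f -> ~ K n z -> f z = 0.
Proof. by move=> [[_ _ hRe] [_ _ hIm]] zK; apply: complex_eq; [exact: hRe|exact: hIm]. Qed.

Lemma cbounded_supportedP n f c : cmeasurable_fun D f -> (forall z, cabs (f z) <= c) ->
  (forall z, ~ K n z -> f z = 0) -> cbounded_supported n f.
Proof.
move=> [mRe mIm] fc fK.
have aux (h : R[i] -> R) : h 0 = 0 -> (forall x, `|h x| <= cabs x) ->
    measurable_fun D (fun z => h (f z)) -> bs n (fun z => h (f z)).
  move=> h0 hle mh.
  (* Since [f] is 0 off [K n], hence off [D], measurability on [D] is measurability everywhere. *)
  have E : (fun z => h (f z)) = (fun z => h (f z)) \_ D.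
    apply/funext => z; rewrite patchE; case: ifPn => // /negP zD.
    by rewrite fK// => Kz; apply: zD; rewrite inE; exact: KsubD Kz.
  split.
  - by rewrite E; apply/(measurable_restrictT _ _).1.
  - by exists c => z; apply: le_trans (hle _) _.
  - by move=> z zK; rewrite fK.
by split; apply: aux => //; [exact: normc_Re|exact: normc_Im].
Qed.

Lemma cbounded_tent n f : cbounded_supported n f -> T f.
Proof.
move=> bf; have mf := cbounded_cmeasurable bf; split => //.
apply/(tent_norm_lty vol_fin alpha0 f p0 q0).
have [[_ [c fc] _] [_ [c' fc'] _]] := bf.
have c0 : 0 <= c + c'.
  by rewrite addr_ge0//; [exact: le_trans (fc point)|exact: le_trans (fc' point)].
have fcc z : (0 <= cmod f z <= (c + c')%:E)%E.
  rewrite cmod_ge0/=; have [Dz|Dz] := pselect (D z); last by rewrite cmod_off.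
  rewrite cmod_on// lee_fin; apply: le_trans (normc_le_ReIm _) _.
  by rewrite lerD.
apply: (energy_bounded_support mk k0 (mK n) (mB n) (nuK n) (muB n) (kap0 n) (@kK n) p0 q0 c0 _ fcc).
  exact: measurable_cmod.
move=> z zK; have [Dz|Dz] := pselect (D z); last by rewrite cmod_off.
by rewrite cmod_on// (cbounded_off bf zK) Normc.normc0.
Qed.

Lemma tent_sub f g : cmeasurable_fun D f -> T g -> (forall z, D z -> cabs (f z) <= cabs (g z)) -> T f.
Proof.
move=> mf [mg goo] fg; split; first exact: mf.
exact: le_lt_trans (le_tent_norm vol_fin alpha0 p0 q0 mf mg fg) goo.
Qed.

Lemma tent_norm_dominated_cvg0 (f : (Z -> R[i])^nat) F : (forall n, cmeasurable_fun D (f n)) -> T F ->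
  (forall n z, D z -> cabs (f n z) <= cabs (F z)) ->
  (forall z, D z -> (fun n => cabs (f n z)) @ \oo --> 0) ->
  (fun n => tnorm (f n)) @ \oo --> 0%E.
Proof.
move=> mf [mF Foo] fF f_0.
have -> : (fun n => tnorm (f n)) = (fun n => (energy p q (cmod (f n)) `^ p^-1)%E).
  by apply/funext => n; exact: tent_normE.
apply: cvg0_poweR; first by rewrite invr_gt0.
  by move=> n; exact: energy_ge0.
apply: (energy_dominated_cvg0 mk k0 koo kD (F := cmod F)) => //.
- by move=> n; exact: measurable_cmod.
- exact: measurable_cmod.
- by move=> n z; exact: cmod_ge0.
- move=> n z; have [Dz|Dz] := pselect (D z); last by rewrite !cmod_off.
  by rewrite !cmod_on// lee_fin fF.
- exact/(tent_norm_lty vol_fin alpha0 F p0 q0).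
- move=> z Dz; have -> : (fun n => cmod (f n) z) = EFin \o (fun n => cabs (f n z)).
    by apply/funext => n; rewrite cmod_on.
  by apply/cvg_EFin; [exact: nearW|exact: f_0].
Qed.

(** Used for the countable additivity behind the Radon-Nikodym step and for the density of bounded
    functions. *)
Lemma functional_dominated_cvg0 L (f : (Z -> R[i])^nat) F :
  bounded_linear_functional mu p q alpha L -> (forall n, cmeasurable_fun D (f n)) -> T F ->
  (forall n z, D z -> cabs (f n z) <= cabs (F z)) ->
  (forall z, D z -> (fun n => cabs (f n z)) @ \oo --> 0) ->
  (fun n => cabs (L (f n))) @ \oo --> 0.
Proof.
move=> [_ _ _ [C LC]] mf TF fF f_0; have cf := tent_norm_dominated_cvg0 mf TF fF f_0.
have H : (fun n => (cabs (L (f n)))%:E) @ \oo --> 0%E.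
  apply: (@squeeze_cvge _ _ _ _ (cst 0%E) _ (fun n => C%:E * tnorm (f n))%E).
  - apply: nearW => n; apply/andP; split; first by rewrite lee_fin; exact: normc_ge0.
    by apply: LC; apply: (tent_sub (mf n) TF) => z Dz; exact: fF.
  - exact: cvg_cst.
  - by rewrite -[X in _ --> X](mule0 C%:E); apply: cvgeZl.
by have /fine_cvg := H.
Qed.

Section pairing_functional.
Variables p' q' : R.
Hypotheses (p'0 : 0 < p') (pp' : p^-1 + p'^-1 = 1) (q'0 : 0 < q') (qq' : q^-1 + q'^-1 = 1).
Local Notation T' := (tent_space mu p' q' alpha).

Let tpc f g : T f -> T' g -> pairing_converges mu f g.
Proof. exact: (tent_pairing_converges vol_fin alpha0 p0 p'0 pp' q0 q'0 qq'). Qed.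

Lemma pairing_bound f g : T f -> T' g ->
  ((cabs (pairing mu f g))%:E <= 2%:E * (tnorm f * tent_norm mu p' q' alpha g))%E.
Proof.
move=> Tf Tg; apply: le_trans (pairing_normc_le (tpc Tf Tg)) _.
rewrite lee_wpmul2l//; case: Tf Tg => [mf _] [mg _].
exact: (pairing_abs_le vol_fin alpha0 p0 p'0 pp' q0 q'0 qq').
Qed.

Lemma pairing_functional g : T' g ->
  bounded_linear_functional mu p q alpha (fun f => pairing mu f g).
Proof.
move=> Tg; split.
- move=> f1 f2 Tf1 Tf2 ff.
  have [iRe1 iIm1] := pairing_integrable (tpc Tf1 Tg).
  have [iRe2 iIm2] := pairing_integrable (tpc Tf2 Tg).
  congr (_ +i* _)%C; rewrite /Rintegral; congr fine; apply: ae_eq_integral => //.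
  + exact: measurable_int iRe1.
  + exact: measurable_int iRe2.
  + by apply: filterS ff => z fz Dz; rewrite /pairing_integrand fz.
  + exact: measurable_int iIm1.
  + exact: measurable_int iIm2.
  + by apply: filterS ff => z fz Dz; rewrite /pairing_integrand fz.
- move=> f1 f2 Tf1 Tf2.
  have [iRe1 iIm1] := pairing_integrable (tpc Tf1 Tg).
  have [iRe2 iIm2] := pairing_integrable (tpc Tf2 Tg).
  apply: complex_eq; rewrite /pairing /= -RintegralD//; apply: eq_Rintegral => z _.
  + by rewrite /pairing_integrand mulrDl Re_addc.
  + by rewrite /pairing_integrand mulrDl Im_addc.
- move=> a f Tf; have [iRe iIm] := pairing_integrable (tpc Tf Tg).
  apply: complex_eq; rewrite /pairing.
  + rewrite (Re_mulc a (_ +i* _)%C) /= -!RintegralZl// -RintegralB//; last 2 first.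
    * exact: (integrableZl mD _ iRe).
    * exact: (integrableZl mD _ iIm).
    by apply: eq_Rintegral => z _; rewrite /pairing_integrand -mulrA Re_mulc.
  + rewrite (Im_mulc a (_ +i* _)%C) /= -!RintegralZl// -RintegralD//; last 2 first.
    * exact: (integrableZl mD _ iIm).
    * exact: (integrableZl mD _ iRe).
    by apply: eq_Rintegral => z _; rewrite /pairing_integrand -mulrA Im_mulc.
- have [mg goo] := Tg; exists (2 * fine (tent_norm mu p' q' alpha g)) => f Tf.
  apply: le_trans (pairing_bound Tf Tg) _.
  have g0 : (0 <= tent_norm mu p' q' alpha g)%E by exact: Lnorm_ge0.
  by rewrite EFinM fineK ?ge0_fin_numE// -muleA (muleC (tnorm f)).
Qed.

Lemma pairingBr f g h : T f -> T' g -> T' h ->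
  pairing mu f (fun z => g z - h z) = pairing mu f g - pairing mu f h.
Proof.
move=> Tf Tg Th.
have [iRe1 iIm1] := pairing_integrable (tpc Tf Tg).
have [iRe2 iIm2] := pairing_integrable (tpc Tf Th).
have E z : pairing_integrand f (fun z => g z - h z) z =
    pairing_integrand f g z - pairing_integrand f h z.
  by rewrite /pairing_integrand rmorphB mulrBr.
apply: complex_eq.
- rewrite Re_subc /pairing [LHS]/= [RHS]/= -RintegralB//; apply: eq_Rintegral => z _.
  by rewrite E Re_subc.
- rewrite Im_subc /pairing [LHS]/= [RHS]/= -RintegralB//; apply: eq_Rintegral => z _.
  by rewrite E Im_subc.
Qed.

End pairing_functional.

(** Restrict [f] to the part of [K n] where |f| <= n. The rest is dominated by |f| and tends to 0
    pointwise on [D], so both functionals tend to 0 on it. *)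
Lemma functional_density L1 L2 :
  bounded_linear_functional mu p q alpha L1 -> bounded_linear_functional mu p q alpha L2 ->
  (forall n f, cbounded_supported n f -> L1 f = L2 f) -> forall f, T f -> L1 f = L2 f.
Proof.
move=> bL1 bL2 L12 f Tf; have [mf foo] := Tf.
pose S n := K n `&` [set z | (cmod f z <= n%:R%:E)%E].
have mS n : measurable (S n).
  apply: measurableI => //; rewrite -[X in measurable X]setTI.
  by apply: emeasurable_fun_infty_c => //; exact: measurable_cmod.
pose fn n z : R[i] := ((\1_(S n) z)%:C * f z)%C.
pose rn n z : R[i] := f z + (-1) * fn n z.
have fnE n z : fn n z = if z \in S n then f z else 0.
  by rewrite /fn indicE; case: ifP => _; rewrite ?mul1r ?mul0r.
have Sle n z : S n z -> cabs (f z) <= n%:R.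
  by move=> [Kz /=]; rewrite cmod_on ?lee_fin//; exact: KsubD Kz.
have mfn n : cmeasurable_fun D (fn n).
  apply: cmeasurable_funM => //; apply: cmeasurable_real.
  by apply: measurable_funTS; exact: measurable_indic.
have mrn n : cmeasurable_fun D (rn n).
  by apply: cmeasurable_funD => //; apply: cmeasurable_funM => //; exact: cmeasurable_cst.
have bfn n : cbounded_supported n (fn n).
  apply: (@cbounded_supportedP n _ n%:R) => // z.
    by rewrite fnE; case: ifPn => [|_]; [rewrite inE; exact: Sle|rewrite Normc.normc0].
  by move=> zK; rewrite fnE ifF//; apply/negbTE; rewrite notin_setE => -[].
have Tfn n : T (fn n) by exact: cbounded_tent (bfn n).
have rnE n z : rn n z = if z \in S n then 0 else f z.
  by rewrite /rn fnE mulN1r; case: ifP => _; rewrite ?subrr ?subr0.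
have rn_le n z : D z -> cabs (rn n z) <= cabs (f z).
  by move=> _; rewrite rnE; case: ifP => // _; rewrite Normc.normc0 normc_ge0.
have rn_0 z : D z -> (fun n => cabs (rn n z)) @ \oo --> 0.
  move=> Dz; apply: cvg_near_cst.
  have : (\bigcup_n K n) z by rewrite KD.
  move=> [m _ Kz]; exists (maxn m (Num.truncn (cabs (f z))).+1) => // n /=.
  rewrite geq_max => /andP[mn fn']; rewrite rnE ifT ?Normc.normc0// inE; split.
    by move: Kz; apply/subsetPset; exact: ndK.
  rewrite /= cmod_on// lee_fin; apply: le_trans (ltW (truncnS_gt _)) _.
  by rewrite ler_nat.
have Trn n : T (rn n) by apply: (tent_sub (mrn n) Tf) => z; exact: rn_le.
have LE L : bounded_linear_functional mu p q alpha L -> forall n, L f = L (fn n) + L (rn n).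
  move=> [_ LD _ _] n; rewrite -(LD _ _ (Tfn n) (Trn n)); congr L; apply/funext => z.
  by rewrite fnE rnE; case: ifP => _; rewrite ?addr0 ?add0r.
have c1 := functional_dominated_cvg0 bL1 mrn Tf rn_le rn_0.
have c2 := functional_dominated_cvg0 bL2 mrn Tf rn_le rn_0.
apply/eqP; rewrite -subr_eq0; apply/eqP/Normc.eq0_normc.
have le n : cabs (L1 f - L2 f) <= cabs (L1 (rn n)) + cabs (L2 (rn n)).
  rewrite (LE _ bL1 n) (LE _ bL2 n) (L12 n _ (bfn n)) opprD addrACA subrr add0r.
  by rewrite -(normcN (L2 _)); exact: le_normcD.
have c12 : (fun n => cabs (L1 (rn n)) + cabs (L2 (rn n))) @ \oo --> 0.
  by rewrite -[X in _ --> X](addr0 0); exact: cvgD.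
apply/eqP; rewrite eq_le normc_ge0 andbT -(cvg_lim _ c12)//.
by apply: limr_ge; [apply/cvg_ex; eexists; exact: c12|exact: nearW].
Qed.

Lemma exists_density_on_bounded L : bounded_linear_functional mu p q alpha L ->
  exists g : Z -> R[i], cmeasurable_fun D g /\
    forall n f, cbounded_supported n f -> L f = pairing mu f g.
Proof.
move=> bL; have [Lae LD LZ [C LC]] := bL.
have creal n (u : Z -> R) : bs n u -> cbounded_supported n (fun z => (u z)%:C%C).
  by move=> bu; split => //=; exact: bounded_supported0.
have Treal n (u : Z -> R) : bs n u -> T (fun z => (u z)%:C%C).
  by move=> bu; exact: cbounded_tent (creal _ _ bu).
have L0 : L (fun=> 0) = 0.
  have := LZ 0 _ (Treal 0%N (fun=> 0) (@bounded_supported0 _ _ R _)); rewrite !mul0r.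
  exact.
(* The real representation is applied to [L] on real functions followed by [h], where [h] is the
   real part and then the imaginary part. *)
have riesz (h : R[i] -> R) : (forall x y, h (x + y) = h x + h y) ->
    (forall c x, h (c%:C%C * x) = c * h x) -> (forall x, `|h x| <= cabs x) ->
    exists b : Z -> R, [/\ measurable_fun setT b,
      forall n, N.-integrable setT (EFin \o (fun z => \1_(K n) z * b z)) &
      forall n u, bs n u -> h (L (fun z => (u z)%:C%C)) = \int[N]_z (u z * b z)].
  move=> hD hZ hle.
  have h0 : h 0 = 0 by have := hZ 0 0; rewrite mulr0 mul0r.
  apply: (@riesz_on_an_exhaustion _ _ _ N K mK ndK (fun u => h (L (fun z => (u z)%:C%C)))).
  - move=> n u v bu bv; rewrite -hD -LD; [|exact: Treal bu|exact: Treal bv].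
    by congr (h (L _)); apply/funext => z; rewrite rmorphD.
  - move=> n c u bu; rewrite -hZ -LZ; last exact: Treal bu.
    by congr (h (L _)); apply/funext => z; rewrite rmorphM.
  - move=> n u bu u0; rewrite (Lae _ (fun=> 0)) ?L0 ?h0//.
    + exact: Treal bu.
    + exact: (Treal 0%N (fun=> 0) (@bounded_supported0 _ _ R _)).
    + by apply: filterS u0 => z uz _; rewrite uz.
  - move=> m u c mu' uc uK u0; have c0 : 0 <= c by exact: le_trans (uc 0%N point).
    have bF : bs m (fun z => c * \1_(K m) z).
      apply: bounded_supportedZ; rewrite -{2}(setIid (K m)).
      exact: bounded_supported_indic.
    have H : (fun n => cabs (L (fun z => (u n z)%:C%C))) @ \oo --> 0.
      apply: (functional_dominated_cvg0 bL _ (Treal _ _ bF)).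
      + by move=> n; apply: cmeasurable_real; exact: measurable_funTS.
      + move=> n z Dz; rewrite !normc_realE normrM (ger0_norm c0) indicE.
        have [Kz|Kz] := pselect (K m z); first by rewrite mem_set// normr1 mulr1.
        by rewrite uK// normr0 mulr_ge0.
      + move=> z Dz; under eq_fun do rewrite normc_realE.
        by rewrite -(normr0 R); apply: cvg_norm; exact: u0.
    apply/cvgr0Pnorm_lt => e e0; have /cvgr0Pnorm_lt/(_ e e0) := H.
    apply: filterS => n; rewrite ger0_norm ?normc_ge0//.
    exact: le_lt_trans (hle _).
have ZRe (c : R) (x : R[i]) : complex.Re (c%:C%C * x) = c * complex.Re x.
  by rewrite Re_mulc /= mul0r subr0.
have ZIm (c : R) (x : R[i]) : complex.Im (c%:C%C * x) = c * complex.Im x.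
  by rewrite Im_mulc /= mul0r addr0.
have [a [ma ia La]] := riesz _ (@Re_addc R) ZRe (@normc_Re R).
have [b [mb ib Lb]] := riesz _ (@Im_addc R) ZIm (@normc_Im R).
(* The pairing conjugates its second argument, so g = a - i * b makes the density that multiplies
   [f] equal to a + i * b. *)
exists (fun z => (a z +i* - b z)%C); split.
  by split => /=; apply: measurable_funTS => //; exact: measurableT_comp.
move=> n f [bRe bIm].
have TI : T (fun z => 'i%C * (complex.Im (f z))%:C%C).
  apply: (tent_sub _ (Treal _ _ bIm)).
    apply: cmeasurable_funM; first exact: cmeasurable_cst.
    by apply: cmeasurable_real; case: bIm => m _ _; exact: measurable_funTS.
  move=> z _; rewrite Normc.normcM [cabs 'i%C]/= expr0n /= add0r expr1n sqrtr1 mul1r//.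
have intM u (c : Z -> R) : bs n u -> N.-integrable setT (EFin \o (fun z => \1_(K n) z * c z)) ->
    N.-integrable D (EFin \o (fun z => u z * c z)) /\
    \int[N]_(z in D) (u z * c z) = \int[N]_z (u z * c z).
  move=> bu ic; have [_ _ uK] := bu.
  have i1 : N.-integrable setT (EFin \o (fun z => u z * c z)).
    apply: eq_integrable (bounded_supported_integrableM bu ic) => // z _ /=.
    have [Kz|zK] := pselect (K n z); first by rewrite indicE mem_set// mul1r.
    by rewrite uK// !mul0r.
  split; first exact: integrableS i1.
  rewrite Rintegral_mkcond; apply: eq_Rintegral => z _; rewrite patchE.
  by case: ifPn => // /negP zD; rewrite uK ?mul0r// => /KsubD Dz; apply: zD; rewrite inE.
have Lf : L f = L (fun z => (complex.Re (f z))%:C%C) + 'i%C * L (fun z => (complex.Im (f z))%:C%C).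
  rewrite -(LZ _ _ (Treal _ _ bIm)) -(LD _ _ (Treal _ _ bRe) TI).
  by congr L; apply/funext => z; rewrite -complexE.
have [i1 e1] := intM _ _ bRe (ia n). have [i2 e2] := intM _ _ bIm (ib n).
have [i3 e3] := intM _ _ bRe (ib n). have [i4 e4] := intM _ _ bIm (ia n).
rewrite Lf; apply: complex_eq.
- rewrite Re_addc Re_mulc /= mul0r mul1r sub0r (La n _ bRe) (Lb n _ bIm) -e1 -e2 -RintegralB//.
  by apply: eq_Rintegral => z _; rewrite /pairing_integrand Re_mulc Re_conjc Im_conjc /= opprK.
- rewrite Im_addc Im_mulc /= mul0r mul1r add0r (Lb n _ bRe) (La n _ bIm) -e3 -e4 -RintegralD//.
  by apply: eq_Rintegral => z _; rewrite /pairing_integrand Im_mulc Re_conjc Im_conjc /= opprK.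
Qed.

End tent_duality.

(** * The dual norm estimate and the duality *)

Section tent_dual_norm.
Context (R : realType) (d : measure_display) (X : borelMetricType R d).
Variable mu : {measure set X -> \bar R}.
Hypothesis vol_fin : forall (x : X) (r : R), 0 < r -> (0 < vol mu x r < +oo)%E.
Hypothesis HL : HL_assumption mu.
Variable alpha : R.
Hypothesis alpha0 : 0 < alpha.

Local Notation cabs := (@Normc.normc R).
Local Notation k := (kern mu alpha).
Local Notation D := (@Xplus R d X).
Local Notation Z := (X * R)%type.
Local Notation M := (sfmu vol_fin).
Local Notation N := (sfnu vol_fin).
Local Notation energy := (kernel_energy M N k).

Let mD : measurable D. Proof. exact: measurable_Xplus. Qed.
Let mk : measurable_fun setT k. Proof. exact: measurable_kern. Qed.
Let k0 w : (0 <= k w)%E. Proof. exact: kern_ge0. Qed.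
Let kD x z : ~ D z -> k (x, z) = 0%E. Proof. exact: kern_off. Qed.
Let k1 z : D z -> (\int[M]_x k (x, z) = 1)%E. Proof. exact: kern_markov. Qed.

Variables (K : (set Z)^nat) (B : (set X)^nat) (kap : nat -> R).
Hypotheses (mK : forall n, measurable (K n)) (mB : forall n, measurable (B n)).
Hypotheses (nuK : forall n, (N (K n) < +oo)%E) (muB : forall n, (M (B n) < +oo)%E).
Hypothesis kap0 : forall n, 0 <= kap n.
Hypothesis kK : forall n x z, K n z -> (k (x, z) <= (kap n)%:E * (\1_(B n) x)%:E)%E.
Hypothesis ndK : nondecreasing_seq K.
Hypothesis KD : \bigcup_n K n = D.

Let KsubD n : K n `<=` D. Proof. by rewrite -KD => z Kz; exists n. Qed.

Variables p q p' q' : R.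
Hypotheses (p1 : 1 < p) (p'1 : 1 < p') (pp' : p^-1 + p'^-1 = 1).
Hypotheses (q1 : 1 < q) (q'1 : 1 < q') (qq' : q^-1 + q'^-1 = 1).
Let p0 : 0 < p. Proof. exact: lt_trans p1. Qed.
Let p'0 : 0 < p'. Proof. exact: lt_trans p'1. Qed.
Let q0 : 0 < q. Proof. exact: lt_trans q1. Qed.
Let q'0 : 0 < q'. Proof. exact: lt_trans q'1. Qed.
Local Notation T := (tent_space mu p q alpha).
Local Notation T' := (tent_space mu p' q' alpha).
Local Notation tnorm := (tent_norm mu p q alpha).
Local Notation tnorm' := (tent_norm mu p' q' alpha).

Lemma mul_conjc (x : R[i]) : x * (x^*)%C = ((cabs x) ^+ 2)%:C%C.
Proof.
case: x => a b; apply: complex_eq; rewrite ?Re_mulc ?Im_mulc /=.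
  by rewrite sqr_sqrtr ?addr_ge0 ?sqr_ge0// mulrN opprK -!expr2.
by rewrite mulrN mulrC addNr.
Qed.

Lemma test_class_witness g phi n : cmeasurable_fun D g -> test_class K (cmod g) phi n ->
  exists f, [/\ cbounded_supported K n f, forall z, (cmod f z <= phi z)%E &
    (\int[N]_(z in D) (phi z * cmod g z) = (cabs (pairing mu f g))%:E)%E].
Proof.
move=> mg [mphi phin phiK phig].
have phi0 z : (0 <= phi z)%E by case/andP : (phin z).
have phif z : phi z = (fine (phi z))%:E.
  rewrite fineK// ge0_fin_numE//; case/andP : (phin z) => _ /le_lt_trans; apply.
  by rewrite ltry.
have phir0 z : 0 <= fine (phi z) by exact: fine_ge0.
(* [phi] times the phase of [g], so that f times the conjugate of g is phi * |g|, with nothing lost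
   to cancellation. Where g = 0 the inverse is 0 and f = 0, so |f| <= phi may be strict there. *)
pose f z : R[i] := ((fine (phi z) * (cabs (g z))^-1)%:C * g z)%C.
have fle z : cabs (f z) <= fine (phi z).
  rewrite /f Normc.normcM normc_realE normrM (ger0_norm (phir0 z)) ger0_norm ?invr_ge0 ?normc_ge0//.
  have [->|gz] := eqVneq (g z) 0; first by rewrite Normc.normc0 mulr0.
  have gz0 : cabs (g z) != 0 by apply: contra_neq gz => /Normc.eq0_normc.
  by rewrite -mulrA mulVf// mulr1.
have mr : measurable_fun D (fun z => fine (phi z)).
  by apply: measurable_funTS; exact: measurableT_comp.
have mng := measurable_normc mg.
have mf : cmeasurable_fun D f.
  apply: cmeasurable_funM => //; apply: cmeasurable_real; apply: measurable_funM => //.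
  have -> : (fun z => (cabs (g z))^-1) = (fun z => cabs (g z) `^ (-1)).
    by apply/funext => z; rewrite powR_inv1// normc_ge0.
  exact: (measurableT_comp (measurable_powR _)).
have bf : cbounded_supported K n f.
  apply: (cbounded_supportedP KD (c := n%:R)) => //.
    move=> z; apply: (le_trans (fle z)); rewrite -lee_fin -phif.
    by case/andP : (phin z).
  by move=> z zK; rewrite /f phiK// mul0r mul0r.
exists f; split => //.
  move=> z; have [Dz|Dz] := pselect (D z); last by rewrite cmod_off.
  by rewrite cmod_on// phif lee_fin.
have pE z : pairing_integrand f g z = (fine (phi z) * cabs (g z))%:C%C.
  rewrite /pairing_integrand /f -mulrA mul_conjc -rmorphM; congr (_%:C)%C.
  have [->|gz] := eqVneq (cabs (g z)) 0; first by rewrite expr0n !mulr0.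
  by rewrite expr2 mulrA mulfVK.
have prE : pairing mu f g = (\int[muplus mu]_(z in D) (fine (phi z) * cabs (g z)))%:C%C.
  apply: complex_eq; rewrite /pairing [LHS]/= [RHS]/=.
    by apply: eq_Rintegral => z _; rewrite pE.
  transitivity (\int[muplus mu]_(z in D) (0 : R)); last by rewrite /Rintegral integral0.
  by apply: eq_Rintegral => z _; rewrite pE.
have fin : (\int[N]_(z in D) (phi z * cmod g z) \is a fin_num)%E.
  have ge0 : (0 <= \int[N]_(z in D) (phi z * cmod g z))%E.
    by apply: integral_ge0 => z _; rewrite mule_ge0// cmod_ge0.
  rewrite ge0_fin_numE//.
  (* [phi] is at most n and vanishes off [K n] and wherever |g| > n, so the product is at most n * n
     on a set of finite measure. *)
  apply: (@le_lt_trans _ _ (\int[N]_(z in K n) (cst (n%:R * n%:R)%:E z))%E); last first.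
    by rewrite integral_cst// lte_mul_pinfty//; exact: nuK.
  rewrite integral_mkcond [leRHS]integral_mkcond; apply: ge0_le_integral => //.
  - by move=> z _; rewrite patchE; case: ifPn => // _; rewrite mule_ge0// cmod_ge0.
  - apply/(measurable_restrictT _ _).1 => //; apply: measurable_funTS.
    by apply: emeasurable_funM => //; exact: measurable_cmod.
  - by apply/(measurable_restrictT _ _).1 => //; exact: measurable_cst.
  - move=> z _; rewrite !patchE; have [Kz|zK] := pselect (K n z); last first.
      by rewrite phiK// mul0e (memNset zK); case: ifP.
    rewrite (mem_set Kz) (mem_set (KsubD Kz)).
    have [h|h] := leP (cmod g z) n%:R%:E; last by rewrite phig// mul0e lee_fin mulr_ge0.
    by rewrite EFinM; apply: lee_pmul => //; [exact: cmod_ge0|case/andP : (phin z)].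
rewrite prE normc_realE ger0_norm; last first.
  by apply: Rintegral_ge0 => z _; rewrite mulr_ge0// normc_ge0.
have E : (\int[N]_(z in D) (phi z * cmod g z) =
          \int[muplus mu]_(z in D) (fine (phi z) * cabs (g z))%:E)%E.
  by apply: eq_integral => z; rewrite inE => Dz; rewrite cmod_on// [in LHS]phif.
by rewrite /Rintegral -E fineK.
Qed.

(** As [g] is not assumed to lie in the dual tent space, this proves membership of the density. It
    also gives uniqueness, with c = 0, and the lower norm bound. *)
Lemma tent_dual_norm_bound : exists2 C : R, 0 <= C & forall (c : R) g, 0 <= c ->
  cmeasurable_fun D g ->
  (forall n f, cbounded_supported K n f -> ((cabs (pairing mu f g))%:E <= c%:E * tnorm f)%E) ->
  (tnorm' g <= (C * c)%:E)%E.
Proof.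
have [C C0 HC] := dual_bound mk k0 kD k1 (kern_HL vol_fin alpha0 HL) mK mB nuK muB
  kap0 kK ndK KD p1 p'1 pp' q1 q'1 qq'.
exists C => // c g c0 mg H; rewrite (tent_normE vol_fin alpha0 g p'0 q'0).
apply: HC => //.
- exact: measurable_cmod.
- exact: cmod_ge0.
- by move=> z Dz; rewrite cmod_on// ltry.
move=> phi n tc; have [mphi phin _ _] := tc.
have [f [bf fphi ->]] := test_class_witness mg tc.
apply: le_trans (H _ _ bf) _; rewrite (tent_normE vol_fin alpha0 f p0 q0).
apply: lee_wpmul2l; first by rewrite lee_fin.
apply: ge0_le_poweR.
- by rewrite invr_ge0 ltW.
- exact: energy_ge0.
apply: (le_energy M N mk k0 kD) => //.
- exact: (measurable_cmod (cbounded_cmeasurable bf)).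
- exact: cmod_ge0.
Qed.

(** The pairing inequality, with the two exponent pairs exchanged, bounds the integral of |w| over
    [K n] by the norm of [w] times that of an indicator; so w = 0 almost everywhere on each
    [K n]. *)
Lemma tent_norm_eq0_ae w : cmeasurable_fun D w -> (tnorm' w <= 0)%E ->
  {ae muplus mu, forall z, D z -> w z = 0}.
Proof.
move=> mw w0; have mW := measurable_cmod mw.
have Ew : (energy p' q' (cmod w) `^ p'^-1 = 0)%E.
  by apply/eqP; rewrite eq_le poweR_ge0 andbT -(tent_normE vol_fin alpha0 w p'0 q'0).
have ind_m n : measurable_fun setT (fun z => (\1_(K n) z)%:E : \bar R).
  by apply/measurable_EFinP; exact: measurable_indic.
have ind0 n z : (0 <= (\1_(K n) z)%:E :> \bar R)%E by rewrite lee_fin.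
have H n : {ae N, forall z, (cmod w z * (\1_(K n) z)%:E = 0)%E}.
  apply: ge0_integral_eq0_ae.
  - exact: emeasurable_funM.
  - by move=> z; rewrite mule_ge0// cmod_ge0.
  apply/eqP; rewrite eq_le integral_ge0 ?andbT; last first.
    by move=> z _; rewrite mule_ge0// cmod_ge0.
  have -> : (\int[N]_z (cmod w z * (\1_(K n) z)%:E) = \int[N]_(z in D) (cmod w z * (\1_(K n) z)%:E))%E.
    rewrite [RHS]integral_mkcond; apply: eq_integral => z _; rewrite patchE.
    by case: ifPn => // /negP zD; rewrite cmod_off ?mul0e// => Dz; apply: zD; rewrite inE.
  have := @pairing_le_energy _ _ _ _ _ M N D k mk k0 kD k1 (cmod w) (fun z => (\1_(K n) z)%:E)
    p' p q' q mW (ind_m n) (cmod_ge0 w) (ind0 n) p'0 p0 _ q'0 q0 _.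
  by rewrite Ew mul0e; apply; rewrite addrC.
have : {ae N, forall z, forall n, (cmod w z * (\1_(K n) z)%:E = 0)%E} by apply: ae_foralln.
apply: filterS => z Hz Dz; have : (\bigcup_n K n) z by rewrite KD.
move=> [n _ Kz]; have := Hz n; rewrite indicE mem_set// mule1 cmod_on//.
by move=> h; apply: Normc.eq0_normc; have [] := h.
Qed.

Lemma functional_norm_upper g : T' g ->
  (functional_norm mu p q alpha (fun f => pairing mu f g) <= 2%:E * tnorm' g)%E.
Proof.
move=> Tg; apply: ge_ereal_sup => _ [f [Tf f1] <-].
apply: le_trans (pairing_bound vol_fin alpha0 p0 q0 p'0 pp' q'0 qq' Tf Tg) _.
apply: lee_wpmul2l => //; rewrite -[leRHS]mul1e; apply: lee_wpmul2r => //.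
exact: Lnorm_ge0.
Qed.

(** The supremum of the empty set would be -oo; the zero function shows that the unit ball is not
    empty. *)
Lemma functional_norm_ge0 L : bounded_linear_functional mu p q alpha L ->
  (0 <= functional_norm mu p q alpha L)%E.
Proof.
move=> [_ _ LZ _]; have b0 : cbounded_supported K 0%N (fun=> 0 : R[i]).
  by split => /=; exact: (@bounded_supported0 _ _ R _).
have T0 : T (fun=> 0).
  exact: (cbounded_tent alpha0 mK mB nuK muB kap0 kK p0 q0 b0).
apply: (@le_trans _ _ (cabs (L (fun=> 0)))%:E); first by rewrite lee_fin; exact: normc_ge0.
apply: ereal_sup_ubound; exists (fun=> 0) => //; split; first exact: T0.
have := tent_normZ vol_fin alpha0 0 p0 q0 (cbounded_cmeasurable b0).
under eq_fun do rewrite mulr0.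
by move=> ->; rewrite Normc.normc0 mul0e.
Qed.

Lemma functional_norm_bound g f : T' g -> T f ->
  ((cabs (pairing mu f g))%:E <=
   functional_norm mu p q alpha (fun f => pairing mu f g) * tnorm f)%E.
Proof.
move=> Tg Tf; have [mf foo] := Tf; have [mg goo] := Tg.
have bL := pairing_functional vol_fin alpha0 p0 q0 p'0 pp' q'0 qq' Tg.
set F := functional_norm _ _ _ _ _.
have F0 : (0 <= F)%E by exact: functional_norm_ge0 bL.
have f0 : (0 <= tnorm f)%E by exact: Lnorm_ge0.
have ffin : tnorm f \is a fin_num by rewrite ge0_fin_numE.
(* A function of norm 0 cannot be normalised; its pairing vanishes by [pairing_bound]. *)
have [fE|fn0] := eqVneq (tnorm f) 0%E.
  apply: le_trans (pairing_bound vol_fin alpha0 p0 q0 p'0 pp' q'0 qq' Tf Tg) _.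
  by rewrite fE mul0e !mule0.
pose t := fine (tnorm f).
have t0 : 0 < t by rewrite fine_gt0// lt0e fn0 f0 foo.
have tE : tnorm f = t%:E by rewrite fineK.
pose h z : R[i] := ((t^-1)%:C * f z)%C.
have mh : cmeasurable_fun D h by apply: cmeasurable_funM => //; exact: cmeasurable_cst.
have h1 : tnorm h = 1%E.
  rewrite (tent_normZ vol_fin alpha0 _ p0 q0 mf) normc_realE tE -EFinM.
  by rewrite ger0_norm ?invr_ge0 ?ltW// mulVf ?gt_eqF.
have Th : T h by split; [exact: mh|rewrite h1 ltry].
have : ((cabs (pairing mu h g))%:E <= F)%E.
  by apply: ereal_sup_ubound; exists h => //; split; [exact: Th|rewrite h1].
have [_ _ LZ _] := bL; rewrite (LZ _ _ Tf) Normc.normcM normc_realE.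
rewrite ger0_norm; last by rewrite invr_ge0 ltW.
rewrite EFinM tE => H.
rewrite -[leLHS]mul1e -(mulfV (lt0r_neq0 t0)) EFinM -muleA (muleC F).
by apply: lee_wpmul2l => //; rewrite lee_fin ltW.
Qed.

Lemma tent_duality_pairing :
  [/\ forall g, T' g ->
        (forall f, T f -> pairing_converges mu f g) /\
        bounded_linear_functional mu p q alpha (fun f => pairing mu f g),
      forall L, bounded_linear_functional mu p q alpha L ->
        exists g, [/\ T' g,
          forall f, T f -> L f = pairing mu f g &
          forall h, T' h -> (forall f, T f -> L f = pairing mu f h) ->
            h = g %[ae muplus mu in D]] &
      exists c C : R, [/\ 0 < c, 0 < C &
        forall g, T' g ->
          (c%:E * tnorm' g <=
             functional_norm mu p q alpha (fun f => pairing mu f g) <=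
             C%:E * tnorm' g)%E]].
Proof.
have [C C0 HC] := tent_dual_norm_bound.
have bTent n f : cbounded_supported K n f -> T f.
  exact: (cbounded_tent alpha0 mK mB nuK muB kap0 kK p0 q0).
split.
- move=> g Tg; split.
    by move=> f Tf; exact: (tent_pairing_converges vol_fin alpha0 p0 p'0 pp' q0 q'0 qq' Tf Tg).
  exact: (pairing_functional vol_fin alpha0 p0 q0 p'0 pp' q'0 qq' Tg).
- move=> L bL.
  have [g [mg Lg]] := exists_density_on_bounded alpha0 mK mB nuK muB kap0 kK ndK KD p0 q0 bL.
  have Tg : T' g.
    split; first exact: mg.
    have [_ _ _ [c Lc]] := bL.
    (* Boundedness of [L] does not provide a nonnegative constant. *)
    apply: le_lt_trans (HC (Num.max c 0) g _ mg _) _.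
    + by rewrite le_max lexx orbT.
    + move=> n f bf; rewrite -(Lg n f bf); apply: le_trans (Lc _ (bTent _ _ bf)) _.
      apply: lee_wpmul2r; first exact: Lnorm_ge0.
      by rewrite lee_fin le_max lexx.
    + exact: ltry.
  have bg := pairing_functional vol_fin alpha0 p0 q0 p'0 pp' q'0 qq' Tg.
  exists g; split; first exact: Tg.
    exact: (functional_density alpha0 mK mB nuK muB kap0 kK ndK KD p0 q0 bL bg Lg).
  move=> h Th Lh.
  have mw : cmeasurable_fun D (fun z => h z - g z).
    have [mh _] := Th; have -> : (fun z => h z - g z) = (fun z => h z + (-1) * g z).
      by apply/funext => z; rewrite mulN1r.
    by apply: cmeasurable_funD => //; apply: cmeasurable_funM => //; exact: cmeasurable_cst.
  have : (tnorm' (fun z => h z - g z)%R <= (C * 0)%:E)%E.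
    apply: (HC 0 _ _ mw) => // n f bf.
    rewrite (pairingBr vol_fin alpha0 p0 q0 p'0 pp' q'0 qq' (bTent _ _ bf) Th Tg).
    by rewrite -(Lh _ (bTent _ _ bf)) -(Lg _ _ bf) subrr Normc.normc0 mul0e.
  rewrite mulr0 => /(tent_norm_eq0_ae mw); apply: filterS => z Hz Dz.
  by apply/eqP; rewrite -subr_eq0; apply/eqP; exact: Hz.
(* [C] may be 0, hence C + 1 before inverting; the 2 is that of [functional_norm_upper]. *)
- exists (C + 1)^-1, 2; split => //; first by rewrite invr_gt0 ltr_wpDl.
  move=> g Tg; apply/andP; split; last exact: functional_norm_upper.
  have bg := pairing_functional vol_fin alpha0 p0 q0 p'0 pp' q'0 qq' Tg.
  have [mg goo] := Tg.
  set F := functional_norm _ _ _ _ _.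
  have F0 : (0 <= F)%E by exact: functional_norm_ge0 bg.
  have Foo : (F < +oo)%E.
    apply: le_lt_trans (functional_norm_upper Tg) _; apply: lte_mul_pinfty => //.
  have Ffin : F \is a fin_num by rewrite ge0_fin_numE.
  have : (tnorm' g <= (C * fine F)%:E)%E.
    apply: (HC _ _ _ mg) => [|n f bf]; first exact: fine_ge0.
    by rewrite fineK//; exact: (functional_norm_bound Tg (bTent _ _ bf)).
  move=> /(lee_wpmul2l (_ : 0 <= ((C + 1)^-1)%:E)%E) H.
  apply: le_trans (H _) _; first by rewrite lee_fin invr_ge0 addr_ge0.
  rewrite -EFinM -[leRHS](fineK Ffin) lee_fin mulrA ler_piMl ?fine_ge0//.
  by rewrite mulrC ler_pdivrMr ?mul1r ?lerDl// ltr_wpDl.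
Qed.

End tent_dual_norm.

Theorem proposition3p10 (R : realType) (d : measure_display)
    (X : borelMetricType R d) (mu : {measure set X -> \bar R})
    (vol_fin : forall (x : X) (r : R), 0 < r -> (0 < vol mu x r < +oo)%E)
    (proper_or_doubling : proper_space mu \/ doubling_space mu)
    (HL : HL_assumption mu)
    (p q alpha : R) (p_gt1 : 1 < p) (q_gt1 : 1 < q) (alpha_gt0 : 0 < alpha) :
  let p' := conjugate_exponent p in
  let q' := conjugate_exponent q in
  let T := tent_space mu p q alpha in
  let T' := tent_space mu p' q' alpha in
  [/\ forall g, T' g ->
        (forall f, T f -> pairing_converges mu f g) /\
        bounded_linear_functional mu p q alpha (fun f => pairing mu f g),
      forall L, bounded_linear_functional mu p q alpha L ->
        exists g, [/\ T' g,
          forall f, T f -> L f = pairing mu f g &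
          forall h, T' h -> (forall f, T f -> L f = pairing mu f h) ->
            h = g %[ae muplus mu in @Xplus R d X]] &
      exists c C : R, [/\ 0 < c, 0 < C &
        forall g, T' g ->
          (c%:E * tent_norm mu p' q' alpha g <=
             functional_norm mu p q alpha (fun f => pairing mu f g) <=
             C%:E * tent_norm mu p' q' alpha g)%E]].
Proof.
have conj (r : R) : 1 < r -> 1 < conjugate_exponent r /\ r^-1 + (conjugate_exponent r)^-1 = 1.
  move=> r1; have r0 : r != 0 by rewrite gt_eqF// (lt_trans _ r1).
  split; first by rewrite /conjugate_exponent ltr_pdivlMr ?subr_gt0// mul1r ltrBlDr ltrDl.
  by rewrite /conjugate_exponent invf_div; field.
have [p'1 pp'] := conj p p_gt1; have [q'1 qq'] := conj q q_gt1.
have [K [B [kap [HK HB [kap0 kK] ndK KD]]]] := exists_exhaustion vol_fin alpha_gt0.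
exact: (tent_duality_pairing HL alpha_gt0 (fun n => (HK n).1) (fun n => (HB n).1)
  (fun n => (HK n).2) (fun n => (HB n).2) kap0 kK ndK KD p_gt1 p'1 pp' q_gt1 q'1 qq').
Qed.
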